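(* Let $\mathbf A_n=\mathbf U_n\mathbf T_n\mathbf V_n$ be the isotropic random matrices and $\mathbf P_n$ the bounded finite rank perturbations described in the context. Suppose that there exists $M'>0$ such that $\mathbb P(\|\mathbf T_n^{-1}\|_{\mathrm{op}}>M')\to0$ and that there is a deterministic $a>0$ such that $$\frac1n\sum_{i=1}^n s_i^{-2}\longrightarrow\frac1{a^2}\quad\text{in probability.}$$ Then for all $\delta\in\,]0,a[$, with probability tending to one as $n\to\infty$, $$\mu_{\mathbf A_n+\mathbf P_n}\big(\{z\in\mathbb C : |z|<a-\delta\}\big)=0,$$ where $\mu_{\mathbf A_n+\mathbf P_n}$ is the empirical spectral distribution of $\mathbf A_n+\mathbf P_n$.
   Context: For each $n\ge1$, $\mathbf A_n=\mathbf U_n\mathbf T_n\mathbf V_n$ is an $n\times n$ random matrix, where $\mathbf T_n=\operatorname{diag}(s_1,\ldots,s_n)$ with non-negative numbers $s_i$ (depending implicitly on $n$, possibly random), and $\mathbf U_n,\mathbf V_n$ are independent Haar-distributed unitary $n\times n$ matrices, independent of $\mathbf T_n$. $\|\cdot\|_{\mathrm{op}}$ is the operator norm (with $\|\mathbf T_n^{-1}\|_{\mathrm{op}}=\infty$ if $\mathbf T_n$ is not invertible). Standing hypotheses: (1) there is a deterministic $b\ge0$ such that $\frac1n\operatorname{Tr}(\mathbf T_n^2)\to b^2$ in probability as $n\to\infty$; (2) there is $M>0$ such that $\mathbb P(\|\mathbf T_n\|_{\mathrm{op}}>M)\to0$; (3) there is a constant $\kappa>0$ such that for all $n$ and all $z\in\mathbb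 C$, $\operatorname{Im}(z)>n^{-\kappa}$ implies $|\operatorname{Im}(G_{\mu_{\mathbf T_n}}(z))|\le\frac1\kappa$, where $\mu_{\mathbf T_n}$ is the empirical spectral distribution of $\mathbf T_n$ and $G_\mu(z)=\int\frac{\mu(dx)}{z-x}$ is the Stieltjes transform. $(\mathbf P_n)$ is a sequence of $n\times n$ complex matrices (possibly random, but independent of $\mathbf U_n,\mathbf T_n,\mathbf V_n$) with rank at most a fixed integer $r$ and with $\|\mathbf P_n\|_{\mathrm{op}}$ bounded by a constant independent of $n$. *)

(* Defs.v *)
From HB Require Import structures.
From mathcomp Require Import all_boot all_order all_algebra.
From mathcomp Require Import spectral complex.
From mathcomp Require Import all_classical all_reals all_analysis.

Set Implicit Arguments.
Unset Strict Implicit.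
Unset Printing Implicit Defensive.

Import Order.TTheory GRing.Theory Num.Theory.

Local Open Scope classical_set_scope.
Local Open Scope ring_scope.

(* The real-valued modulus of R[i]; its order-theoretic norm takes values in R[i]. *)
Notation cabs := ComplexField.Normc.normc.

HB.instance Definition _ (R : realType) := isPointed.Build R[i] 0.

Definition complex_display : measure_display. Proof. exact: default_measure_display. Qed.

Section complex_measurable.
Variable R : realType.

(* C is identified with R^2, so this is the Borel sigma-algebra. *)
Definition complex_measurable : set_system R[i] :=
  g_sigma_preimageU (@complex.Re R) (@complex.Im R).

Let cmeas0 : complex_measurable set0.
Proof. exact: sigma_algebra0. Qed.

Let cmeasC A : complex_measurable A -> complex_measurable (~` A).
Proof. exact: sigma_algebraC. Qed.

Let cmeas_bigcup (F : (set R[i])^nat) :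
  (forall k, complex_measurable (F k)) -> complex_measurable (\bigcup_k F k).
Proof. exact: sigma_algebra_bigcup. Qed.

HB.instance Definition _ := @isMeasurable.Build complex_display R[i]
  complex_measurable cmeas0 cmeasC cmeas_bigcup.

End complex_measurable.

Definition matrix_display : measure_display -> measure_display.
Proof. exact. Qed.

Section matrix_measurable.
Context d (T : measurableType d) (m n : nat).

(* The smallest sigma-algebra making every entry measurable; for T = R or R[i]
   it is the Borel sigma-algebra. *)
Definition matrix_measurable : set_system 'M[T]_(m, n) :=
  <<s \bigcup_(ij in [set: 'I_m * 'I_n])
        preimage_set_system setT (fun A : 'M[T]_(m, n) => A ij.1 ij.2)
          measurable >>.

Let mmeas0 : matrix_measurable set0.
Proof. exact: sigma_algebra0. Qed.

Let mmeasC A : matrix_measurable A -> matrix_measurable (~` A).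
Proof. exact: sigma_algebraC. Qed.

Let mmeas_bigcup (F : (set 'M[T]_(m, n))^nat) :
  (forall k, matrix_measurable (F k)) -> matrix_measurable (\bigcup_k F k).
Proof. exact: sigma_algebra_bigcup. Qed.

HB.instance Definition _ := @isMeasurable.Build (matrix_display d) 'M[T]_(m, n)
  matrix_measurable mmeas0 mmeasC mmeas_bigcup.

End matrix_measurable.

Definition diagC (R : realType) (n : nat) (s : 'rV[R]_n) : 'M[R[i]]_n :=
  diag_mx (map_mx (real_complex R) s).

Definition l2norm (R : realType) (n : nat) (x : 'cV[R[i]]_n) : R :=
  Num.sqrt (\sum_(i < n) cabs (x i ord0) ^+ 2).

Definition opnorm (R : realType) (n : nat) (A : 'M[R[i]]_n) : R :=
  sup [set l2norm (A *m x) | x in [set x : 'cV[R[i]]_n | l2norm x <= 1]].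

Definition opnorm_inv (R : realType) (n : nat) (A : 'M[R[i]]_n) : \bar R :=
  if A \in unitmx then (opnorm (invmx A))%:E else +oo%E.

(* The n complex eigenvalues, listed with algebraic multiplicity. *)
Definition eigenvalues (R : realType) (n : nat) (A : 'M[R[i]]_n) : seq R[i] :=
  sval (closed_field_poly_normal (char_poly A)).

(* Dirac masses at the eigenvalues, each with weight 1/n. *)
Definition esd (R : realType) (n : nat) (A : 'M[R[i]]_n) :
    {measure set R[i] -> \bar R} :=
  mscale (n%:R^-1)%:nng (msum (fun k => \d_((eigenvalues A)`_k)) n).

(* The complex-valued integral of 1 / (z - x), computed componentwise; measures
   on the real line are viewed as measures on C. *)
Definition stieltjes (R : realType) (mu : {measure set R[i] -> \bar R})
    (z : R[i]) : R[i] :=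
  Complex (\int[mu]_x complex.Re (z - x)^-1) (\int[mu]_x complex.Im (z - x)^-1).

(* Haar measure of the compact group U(n), seen as a measure on all n x n
   matrices: the left-invariant probability measure carried by U(n). *)
Definition haar_unitary (R : realType) (n : nat)
    (mu : probability 'M[R[i]]_n R) : Prop :=
  {ae mu, forall M : 'M[R[i]]_n, M \is unitarymx} /\
  forall W : 'M[R[i]]_n, W \is unitarymx ->
  forall B : set 'M[R[i]]_n, measurable B -> mu (mulmx W @^-1` B) = mu B.

(* Choosing some of the B's to be the full set gives the product rule for
   subfamilies. *)
Definition independent4 (R : realType) (d : measure_display)
    (Omega : measurableType d) (P : probability Omega R)
    (d1 d2 d3 d4 : measure_display)
    (E1 : measurableType d1) (E2 : measurableType d2)
    (E3 : measurableType d3) (E4 : measurableType d4)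
    (X1 : {RV P >-> E1}) (X2 : {RV P >-> E2})
    (X3 : {RV P >-> E3}) (X4 : {RV P >-> E4}) : Prop :=
  forall (B1 : set E1) (B2 : set E2) (B3 : set E3) (B4 : set E4),
    measurable B1 -> measurable B2 -> measurable B3 -> measurable B4 ->
    P (X1 @^-1` B1 `&` X2 @^-1` B2 `&` X3 @^-1` B3 `&` X4 @^-1` B4) =
    (P (X1 @^-1` B1) * P (X2 @^-1` B2) * P (X3 @^-1` B3) * P (X4 @^-1` B4))%E.

(* Since the limit is a constant, each n may have its own probability space. *)
Definition cvg_in_probability (R : realType) (d : nat -> measure_display)
    (Omega : forall n, measurableType (d n))
    (P : forall n, probability (Omega n) R)
    (X : forall n, Omega n -> R) (l : R) : Prop :=
  forall eps : R, 0 < eps ->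
    P n [set w | eps < `|X n w - l|] @[n --> \oo] --> 0%E.

(* Main.v *)
Require Import Defs.
From HB Require Import structures.
From mathcomp Require Import all_boot all_order all_algebra.
From mathcomp Require Import fingroup perm cyclic separable cyclotomic ring lra zify.
From mathcomp Require Import spectral complex.
From mathcomp Require Import all_classical all_reals all_analysis.
From mathcomp Require Import measurable_realfun.

(* For [s] invertible, [A + P - z] is singular if and only if
   [F z = \det (1 + s^-1 U^-1 (P - z) V^-1)] vanishes. By Haar invariance and independence, [U] and
   [V] may be replaced by [q U] and [q' V] with [q, q'] ranging over any finite family of unitary
   matrices. The family consists of the products [D G D' S], with [D, D'] diagonal matrices of
   roots of unity, [G] a fixed unitary matrix with entries of equal modulus and [S] a permutation
   matrix. So it suffices to show that for fixed [u, v, s, P] with the average of [s_i^-2] close to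
   [a^-2], all but a small proportion of the pairs [(q, q')] give an [F] without zeros in the disc.

   Expand [F z] as a sum of the sums of principal minors [e_m], and write [f z = \det (1 - z X)]
   for the same function with [P = 0], where [X = s^-1 U^-1 V^-1]. Averaging over the family and Maclaurin's inequality give
   [E |e_m X|^2 <= t^m], with [t] the average of [s_i^-2]. Since [P] has bounded rank, the same
   averages show that the coefficients of [F - f] are small in mean square, so that [F - f] is
   uniformly small on the disc. The traces of the powers of [X] have bounded second moments; by
   Newton's identities they control the coefficients of [1 / f], hence [|f|] is bounded below on
   the disc and [F] has no zero there. *)

(** A finite family turns every expectation into a finite sum over a [numClosedFieldType]; Haar
    measure enters only through invariance under finitely many left translations. The factor [G]
    serves the traces: it spreads every row, so that closed walks visiting an index twice contribute
    O(1/n) to the second moments. The phases are roots of unity of order n + 1: this order separates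
    all multisets of at most n indices, and n + 1 points of a circle control a polynomial of degree
    n on a smaller disc, which makes bounds at single points uniform.

    Second moments of [e_m X] bound [f] from above only and cannot exclude zeros; the formal inverse
    of [f] does, and only its first m0 coefficients are used, with m0 fixed. Hence the trace
    estimates may lose factorials in the degree and use M'^2 in the error terms, while the bounds on
    [e_m], needed up to m = n, must have the exact rate t^m. Summability of (t |z|^2)^m limits the
    disc to |z| < a. The smallness of [F - f] comes from 'C(n - i, m - i) / 'C(n, m) <= m / n for i
    >= 1: every term that involves [P] loses this factor. *)

Set Implicit Arguments.
Unset Strict Implicit.
Unset Printing Implicit Defensive.

Import Order.TTheory GRing.Theory Num.Theory.

Local Open Scope ring_scope.
Local Open Scope sesquilinear_scope.

(** * Sums of principal minors *)

Section minors.
Variable C : numClosedFieldType.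
Variables m n : nat.
Implicit Types (X Y Z : 'M[C]_n) (f g h : {ffun 'I_m -> 'I_n}) (s : 'S_m).

Definition fperm f s : {ffun 'I_m -> 'I_n} := [ffun l => f (s l)].

(** The entry at (f, g) of the m-th tensor power of [X]. Multi-indices are arbitrary maps, so that
    sums over them factor into products. *)
Definition tprod X f g : C := \prod_l X (f l) (g l).

Definition minor X f g : C := \det (mxsub f g X).

Lemma fpermM f s t : fperm (fperm f s) t = fperm f (t * s)%g.
Proof. by apply/ffunP => l; rewrite !ffunE permM. Qed.

Lemma fperm1 f : fperm f 1%g = f.
Proof. by apply/ffunP => l; rewrite ffunE perm1. Qed.

Lemma fperm_inj s : injective (fperm ^~ s).
Proof.
apply: (can_inj (g := fperm ^~ s^-1%g)) => f.
by rewrite fpermM mulVg fperm1.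
Qed.

Lemma tprod_perm X f g s : tprod X (fperm f s) (fperm g s) = tprod X f g.
Proof.
rewrite /tprod [RHS](reindex_inj (@perm_inj _ s)) /=.
by apply: eq_bigr => l _; rewrite !ffunE.
Qed.

Lemma tprod_mul X Y f h : \sum_g tprod X f g * tprod Y g h = tprod (X *m Y) f h.
Proof.
rewrite /tprod; under [RHS]eq_bigr do rewrite mxE.
rewrite bigA_distr_bigA /=; apply: eq_bigr => g _.
by rewrite big_split.
Qed.

Lemma minorE X f g : minor X f g = \sum_(s : 'S_m) (-1) ^+ s * tprod X f (fperm g s).
Proof.
rewrite /minor /determinant; apply: eq_bigr => s _; congr (_ * _).
by apply: eq_bigr => l _; rewrite !mxE ffunE.
Qed.

Lemma minor_permr X f g s : minor X f (fperm g s) = (-1) ^+ s * minor X f g.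
Proof.
rewrite !minorE mulr_sumr (reindex_inj (mulIg s^-1%g)) /=.
apply: eq_bigr => t _; rewrite fpermM -mulgA mulVg mulg1 mulrA; congr (_ * _).
by rewrite odd_permM odd_permV signr_addb mulrC.
Qed.

Lemma minor_perml X f g s : minor X (fperm f s) g = (-1) ^+ s * minor X f g.
Proof.
rewrite /minor -det_tr -[in RHS]det_tr !trmx_mxsub.
exact: (minor_permr X^T g f s).
Qed.

(** Each set of m indices is the range of m! injections [g], hence the factor compared with the
    usual formula. When the first minor is expanded, all permutations contribute the same:
    reindexing [g] moves the permutation into the second minor, whose antisymmetry absorbs the
    sign. *)
Lemma CauchyBinet X Y f h :
  \sum_g minor X f g * minor Y g h = (m`!)%:R * minor (X *m Y) f h.
Proof.
under eq_bigr do rewrite minorE mulr_suml.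
rewrite exchange_big /=.
have E (s : 'S_m) : \sum_g (-1) ^+ s * tprod X f (fperm g s) * minor Y g h =
    minor (X *m Y) f h.
  rewrite minorE (reindex_inj (@fperm_inj s^-1%g)) /=.
  under eq_bigr => g _ do rewrite fpermM mulgV fperm1 minor_perml odd_permV
    mulrAC !mulrA -signr_addb addbb mul1r mulrC minorE mulr_sumr.
  rewrite exchange_big /=; apply: eq_bigr => t _.
  rewrite -tprod_mul mulr_sumr; apply: eq_bigr => g _.
  by rewrite mulrCA.
rewrite (eq_bigr _ (fun s _ => E s)) sumr_const.
by rewrite card_Sn mulr_natl.
Qed.

Lemma minor_notinjl X f g : ~~ injectiveb f -> minor X f g = 0.
Proof.
move=> /injectivePn[i [j ij fij]]; apply: (determinant_alternate ij) => k.
by rewrite !mxE fij.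
Qed.

Lemma minor_notinjr X f g : ~~ injectiveb g -> minor X f g = 0.
Proof. by move=> gi; rewrite /minor -det_tr trmx_mxsub; apply: (minor_notinjl X^T). Qed.

Lemma minor_conj X f g : minor (X ^t*) f g = (minor X g f)^*.
Proof.
rewrite /minor -det_tr -(det_map_mx (@Num.conj C)); congr (\det _).
by apply/matrixP => i j; rewrite !mxE.
Qed.

Lemma minor1 f : injectiveb f -> minor 1%:M f f = 1.
Proof.
move=> /injectiveP fi; rewrite /minor.
suff -> : mxsub f f (1%:M : 'M[C]_n) = 1%:M by rewrite det1.
by apply/matrixP => i j; rewrite !mxE (inj_eq fi).
Qed.

Lemma minorZ (c : C) X f g : minor (c *: X) f g = c ^+ m * minor X f g.
Proof.
rewrite /minor -detZ; apply: (congr1 determinant).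
by apply/matrixP => i j; rewrite !mxE.
Qed.

(* The sum of the principal minors of size [m]: maps with a repeated value contribute 0 and
   every set of indices is the range of [m`!] injections. *)
Definition em X : C := (m`!)%:R^-1 * \sum_f minor X f f.

Lemma emZ (c : C) X : em (c *: X) = c ^+ m * em X.
Proof.
rewrite /em mulrCA; congr (_ * _); rewrite mulr_sumr.
by apply: eq_bigr => f _; rewrite minorZ.
Qed.

Lemma fact_neq0 : (m`!)%:R != 0 :> C.
Proof. by rewrite pnatr_eq0 -lt0n fact_gt0. Qed.

Lemma em_mul X Y :
  em (X *m Y) = (m`!)%:R^-2 * \sum_f \sum_g minor X f g * minor Y g f.
Proof.
rewrite /em expr2 invfM -mulrA; congr (_ * _); rewrite mulr_sumr.
apply: eq_bigr => f _; rewrite CauchyBinet mulrA mulVf ?mul1r //;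
exact: fact_neq0.
Qed.

Lemma em_mulC X Y : em (X *m Y) = em (Y *m X).
Proof.
rewrite !em_mul exchange_big /=; congr (_ * _).
by apply: eq_bigr => f _; apply: eq_bigr => g _; rewrite mulrC.
Qed.

Lemma em_trig X : is_trig_mx X ->
  em X = (m`!)%:R^-1 * \sum_(f : {ffun 'I_m -> 'I_n} | injectiveb f) \prod_l X (f l) (f l).
Proof.
move=> /is_trig_mxP Xt; rewrite /em; congr (_ * _).
rewrite (bigID (fun f : {ffun 'I_m -> 'I_n} => injectiveb f)) /= [X in _ + X]big1 ?addr0; last first.
  by move=> f; exact: minor_notinjl.
apply: eq_bigr => f /injectiveP fi; rewrite minorE (bigD1 1%g) //= odd_perm1 mul1r.
rewrite fperm1 big1 ?addr0 // => s s1.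
(* Otherwise f (s l) <= f l for all l; the two sums over l agree, so equality holds throughout, and
   injectivity of [f] gives s = 1. *)
have [l lts] : exists l, (f l < f (s l))%N.
  apply/existsP; apply: contraNT s1; rewrite negb_exists => /forallP fs.
  have fs' l : (f (s l) <= f l)%N by rewrite leqNgt.
  have /eqP : (\sum_l f (s l) = \sum_l f l)%N.
    by rewrite [RHS](reindex_inj (@perm_inj _ s)).
  have := @leqif_sum _ predT (fun l => f (s l) == f l :> nat)
    (fun l => f (s l) : nat) (fun l => f l : nat).
  case=> [l _ | _ ->]; first by apply/leqifP; case: eqP => [//|/eqP]; rewrite ltn_neqAle fs' andbT.
  move=> /forall_inP H; apply/eqP/permP => l; rewrite perm1; apply: fi; apply: val_inj.
  exact/eqP/H.
by rewrite /tprod (bigD1 l) //= ffunE Xt // mul0r mulr0.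
Qed.

End minors.

Section det1em.
Variable C : numClosedFieldType.

Lemma sum_inj_prod m n (x : 'I_n -> C) :
  \sum_(f : {ffun 'I_m -> 'I_n} | injectiveb f) \prod_l x (f l) =
  (m`!)%:R * \sum_(S : {set 'I_n} | #|S| == m) \prod_(i in S) x i.
Proof.
rewrite (partition_big (fun f : {ffun 'I_m -> 'I_n} => [set f l | l in 'I_m]%SET)
   (fun S => #|S| == m)) /=; last first.
  by move=> f /injectiveP fi; rewrite card_imset ?card_ord.
rewrite mulr_sumr; apply: eq_bigr => S /eqP cS.
rewrite (eq_bigr (fun=> \prod_(i in S) x i)) => [|f /andP[/injectiveP fi /eqP <-]]; last first.
  by rewrite big_imset /=; [apply: eq_bigl => l | move=> ? ? _ _; exact: fi].
rewrite sumr_const mulr_natl; congr (_ *+ _).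
have := card_inj_ffuns_on 'I_m (mem S); rewrite card_ord cS ffactnn => <-.
apply: eq_card => f; rewrite unfold_in !inE; case: injectiveP => fi; last by rewrite ?andbF.
rewrite andbT andTb; apply/eqP/ffun_onP => [<- l | fS]; first by apply/imsetP; exists l.
apply/eqP; rewrite eqEcard card_imset // card_ord cS leqnn andbT.
by apply/fintype.subsetP => _ /imsetP[l _ ->].
Qed.

Lemma mulmx_trig_diag n (A B : 'M[C]_n) i : is_trig_mx A -> is_trig_mx B ->
  (A *m B) i i = A i i * B i i.
Proof.
move=> /is_trig_mxP At /is_trig_mxP Bt; rewrite mxE (bigD1 i) //= big1 ?addr0 // => j.
rewrite neq_ltn => /orP[ji|ij]; first by rewrite (Bt j i) // mulr0.
by rewrite (At i j) // mul0r.
Qed.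

Lemma unitary_trig n (A : 'M[C]_n) : exists (P L : 'M[C]_n),
  [/\ P \in unitmx, is_trig_mx L & A = invmx P *m L *m P].
Proof.
case: n A => [|n] A.
  exists 1%:M, A; rewrite unitmx1 [A]flatmx0 invmx1 mulmx1 mul1mx; split => //.
  by apply/is_trig_mxP => - [].
have [P Pu PA] := @Schur C _ A isT; have Pu' := unitarymx_unit Pu.
exists P, (P *m A *m invmx P); split => //; first by move: PA; rewrite /similar_to /= conjumx.
by rewrite !mulmxA mulVmx // mul1mx mulmxKV.
Qed.

Lemma det_trig1 n (L : 'M[C]_n) : is_trig_mx L -> \det (1%:M + L) = \prod_i (1 + L i i).
Proof.
move=> Lt; rewrite det_trig; first by apply: eq_bigr => i _; rewrite !mxE eqxx.
apply/is_trig_mxP => i j ij; rewrite !mxE (is_trig_mxP Lt) // addr0.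
by case: eqP ij => // ->; rewrite ltnn.
Qed.

(** Both sides are invariant under similarity, the right one by [em_mulC], so the matrix may be
    taken triangular. There the claim is the expansion of the product of the 1 + L i i over
    subsets. *)
Lemma det1em n (X : 'M[C]_n) : \det (1%:M + X) = \sum_(m < n.+1) em m X.
Proof.
have [P [L [Pu Lt ->]]] := unitary_trig X.
have -> : 1%:M + invmx P *m L *m P = invmx P *m (1%:M + L) *m P.
  by rewrite mulmxDr mulmx1 mulmxDl mulVmx.
rewrite !det_mulmx mulrAC -det_mulmx mulVmx // det1 mul1r det_trig1 //.
under [RHS]eq_bigr => m _ do rewrite -mulmxA em_mulC -mulmxA mulmxV // mulmx1 (em_trig _ Lt).
rewrite [RHS](eq_bigr (fun m : 'I_n.+1 => \sum_(S : {set 'I_n} | #|S| == m) \prod_(i in S) L i i)); last first.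
  by move=> m _; rewrite (sum_inj_prod _ (fun i => L i i)) mulrA mulVf ?mul1r // fact_neq0.
under eq_bigr => i _ do rewrite addrC.
rewrite bigA_distr /=.
have cS (S : {set 'I_n}) : (#|S| < n.+1)%N by rewrite ltnS -[X in (_ <= X)%N]card_ord max_card.
rewrite (partition_big (fun S : {set 'I_n} => Ordinal (cS S)) xpredT) //=.
apply: eq_bigr => m _; apply: eq_big => S; first by rewrite -val_eqE.
by move=> _; rewrite [RHS]big_mkcond.
Qed.

End det1em.

Section roots.
Variable C : numClosedFieldType.

Lemma prim_root_ex N : (0 < N)%N -> exists w : C, N.-primitive_root w.
Proof.
move=> N_gt0; pose p : {poly C} := 'X^N - 1.
have [rs Dp] := closed_field_poly_normal p.
rewrite (monicP _) ?monicXnsubC // scale1r in Dp.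
have rn1 : all N.-unity_root rs by apply/allP=> z; rewrite -root_prod_XsubC -Dp.
have sz_r : (N < (size rs).+1)%N by rewrite -(size_prod_XsubC rs id) -Dp size_XnsubC.
have [|z _ zp] := hasP (has_prim_root N_gt0 rn1 _ sz_r); last by exists z.
by rewrite -separable_prod_XsubC -Dp separable_Xn_sub_1 // pnatr_eq0 -lt0n.
Qed.

Variables (N : nat) (w : C).
Hypothesis wP : N.-primitive_root w.

Lemma prim_norm : `|w| = 1.
Proof.
have N_gt0 := prim_order_gt0 wP.
have /eqP := congr1 Num.norm (prim_expr_order wP).
by rewrite normrX normr1 pexpr_eq1 ?normr_ge0 // => /eqP.
Qed.

Lemma prim_conj : w^* = w^-1.
Proof. by rewrite invC_norm prim_norm expr1n invr1 mul1r. Qed.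

Lemma prim_neq0 : w != 0.
Proof. by rewrite -normr_eq0 prim_norm oner_eq0. Qed.

(** Orthogonality of the characters of Z/N. Exponents below N can be compared without reduction;
    this is why the order of the root must exceed the degree m later on. *)
Lemma prim_sum a b : (a < N)%N -> (b < N)%N ->
  \sum_(j < N) (w ^+ j) ^+ a * ((w ^+ j) ^+ b)^* = if a == b then N%:R else 0.
Proof.
move=> aN bN; have w0 := prim_neq0.
pose z := w ^+ a / w ^+ b.
rewrite (eq_bigr (fun j : 'I_N => z ^+ j)); last first.
  move=> j _; rewrite !rmorphXn /= prim_conj /z expr_div_n -!exprM.
  by rewrite [(j * a)%N]mulnC [(j * b)%N]mulnC !exprM exprVn exprVn.
case: eqP => [ab|/eqP ab].
  rewrite (eq_bigr (fun=> 1)) ?sumr_const ?card_ord // => j _.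
  by rewrite /z ab divff ?expf_neq0 // expr1n.
have z1 : z != 1.
  rewrite /z; apply: contraNneq ab => /(congr1 ( *%R^~ (w ^+ b))).
  rewrite mulfVK ?expf_neq0 // mul1r => /eqP.
  by rewrite (eq_prim_root_expr wP) !modn_small.
have zN : z ^+ N = 1.
  by rewrite /z expr_div_n -!exprM ![(_ * N)%N]mulnC !exprM (prim_expr_order wP) !expr1n divr1.
have /esym := subrX1 z N; rewrite zN subrr => /eqP; rewrite mulf_eq0 subr_eq0 (negPf z1).
by move=> /eqP.
Qed.

End roots.

(** * Averages over diagonal phases and permutations *)

Section sim.
Variables m n : nat.
Implicit Types (f g : {ffun 'I_m -> 'I_n}) (s : 'S_m).

(** The multiplicity of [i] as a value of [f]; [sim] thus says that two maps have the same multiset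
    of values, that is, the same phase under every diagonal matrix. *)
Definition cnt f (i : 'I_n) : nat := \sum_(l < m) (f l == i).

Definition sim f g := [forall i, cnt f i == cnt g i].

Lemma sim_sym f g : sim f g = sim g f.
Proof. by apply: eq_forallb => i; rewrite eq_sym. Qed.

Lemma cnt_le f i : (cnt f i <= m)%N.
Proof.
apply: (@leq_trans (\sum_(l < m) 1)); last by rewrite sum1_card card_ord.
by apply: leq_sum => l _; case: eqP.
Qed.

Lemma sim_fperm f s : sim f (fperm f s).
Proof.
apply/forallP => i; apply/eqP; rewrite /cnt (reindex_inj (@perm_inj _ s)) /=.
by apply: eq_bigr => l _; rewrite ffunE.
Qed.

Lemma simP f g : sim f g -> exists s, g = fperm f s.
Proof.
move=> /forallP fg; pose t (h : {ffun 'I_m -> 'I_n}) := [tuple h l | l < m].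
have /tuple_permP[s Es] : perm_eq (t g) (t f).
  have ct h i : count_mem i (t h) = cnt h i.
    rewrite /cnt /= count_map -sum1_count big_mkcond /= big_enum /=.
    by apply: eq_bigr => l _; case: eqP.
  by apply/allP => i _; apply/eqP; rewrite [LHS]ct [RHS]ct; apply/esym/eqP.
exists s; apply/ffunP => l; rewrite ffunE.
have := congr1 (fun u => nth (g l) u l) Es.
by rewrite -!tnth_nth !tnth_mktuple.
Qed.

Lemma card_sim f : (#|[set g | sim f g]%SET| <= m`!)%N.
Proof.
rewrite -card_Sn; apply: leq_trans (leq_imset_card (fperm f) predT).
apply/subset_leq_card/fintype.subsetP => g; rewrite inE => /simP[s ->].
exact: imset_f.
Qed.

Lemma sim_inj f : injectiveb f ->
  forall (V : nmodType) (G : {ffun 'I_m -> 'I_n} -> V),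
  \sum_(g | sim f g) G g = \sum_(s : 'S_m) G (fperm f s).
Proof.
move=> /injectiveP fi V G.
rewrite -(big_imset _ (h := fperm f)) /=; last first.
  move=> s t _ _ /ffunP st; apply/permP => l; have := st l.
  by rewrite !ffunE => /fi.
apply: eq_bigl => g; apply/idP/imsetP => [/simP[s ->]|[s _ ->]]; first by exists s.
exact: sim_fperm.
Qed.

Lemma sim_injective f g : sim f g -> injectiveb f = injectiveb g.
Proof.
have H f' s : injectiveb f' -> injectiveb (fperm f' s).
  by move=> /injectiveP fi; apply/injectiveP => l k; rewrite !ffunE => /fi /perm_inj.
move=> /simP[s ->]; apply/idP/idP; first exact: H.
by move=> /(H _ s^-1%g); rewrite fpermM mulVg fperm1.
Qed.

Definition pcomp (p : 'S_n) f : {ffun 'I_m -> 'I_n} := [ffun l => p (f l)].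

Lemma pcomp_perm p f s : pcomp p (fperm f s) = fperm (pcomp p f) s.
Proof. by apply/ffunP => l; rewrite !ffunE. Qed.

Lemma pcompM p q f : pcomp p (pcomp q f) = pcomp (q * p)%g f.
Proof. by apply/ffunP => l; rewrite !ffunE permM. Qed.

Lemma pcomp_injective p f : injectiveb (pcomp p f) = injectiveb f.
Proof.
apply/injectiveP/injectiveP => fi l k.
  by move=> e; apply: fi; rewrite !ffunE e.
by rewrite !ffunE => /perm_inj /fi.
Qed.

Lemma pcomp_inj p : injective (pcomp p).
Proof. by move=> f g /ffunP fg; apply/ffunP => l; have := fg l; rewrite !ffunE => /perm_inj. Qed.

(** Each injection [h] is straightened to the initial segment: list its values first and the other
    indices afterwards, and send every index to its position in this list. *)
Lemma inj_extend f g : injectiveb f -> injectiveb g -> exists p, g = pcomp p f.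
Proof.
suff H (h : {ffun 'I_m -> 'I_n}) : injectiveb h ->
    exists p : 'S_n, forall l, val (p (h l)) = val l.
  move=> fi gi; have [p Hp] := H f fi; have [q Hq] := H g gi.
  exists (p * q^-1)%g; apply/ffunP => l; rewrite ffunE permM.
  by apply: (canRL (permK q)); apply: val_inj; rewrite Hp Hq.
move=> /injectiveP hi.
pose s := codom h ++ [seq i <- enum 'I_n | i \notin codom h].
have us : uniq s.
  rewrite cat_uniq filter_uniq ?enum_uniq // andbT; apply/andP; split; first exact/injectiveP.
  by apply/hasPn => i; rewrite mem_filter => /andP[].
have ms i : i \in s by rewrite mem_cat mem_filter mem_enum andbT orbN.
have is_lt i : (index i s < n)%N.
  rewrite -[X in (_ < X)%N]card_ord -(eq_card (_ : s =i predT)); last by move=> k; rewrite ms.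
  by rewrite (card_uniqP us) index_mem.
have pi : injective (fun i => Ordinal (is_lt i)).
  by move=> i j /(congr1 val) /= ij; rewrite -(nth_index i (ms i)) ij nth_index.
exists (perm pi) => l; rewrite permE /= index_cat codom_f /codom /image_mem.
by rewrite index_map // index_enum_ord.
Qed.

(** Transitivity on injections makes the mean over permutations independent of the injection;
    averaging it over all injections as well gives the mean of [G] over injections. *)
Lemma perm_avg (V : nmodType) f (G : {ffun 'I_m -> 'I_n} -> V) : injectiveb f ->
  (\sum_(p : 'S_n) G (pcomp p f)) *+ n ^_ m = (\sum_(g : {ffun 'I_m -> 'I_n} | injectiveb g) G g) *+ n`!.
Proof.
move=> fi.
have H (g : {ffun 'I_m -> 'I_n}) : injectiveb g -> \sum_(p : 'S_n) G (pcomp p g) = \sum_(p : 'S_n) G (pcomp p f).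
  move=> gi; have [q ->] := inj_extend fi gi.
  rewrite [RHS](reindex_inj (mulgI q)) /=.
  by apply: eq_bigr => p _; rewrite pcompM.
have /esym E : \sum_(g : {ffun 'I_m -> 'I_n} | injectiveb g) \sum_(p : 'S_n) G (pcomp p g) =
    (\sum_(p : 'S_n) G (pcomp p f)) *+ n ^_ m.
  rewrite (eq_bigr _ H) sumr_const; congr (_ *+ _).
  have := @card_inj_ffuns 'I_m 'I_n; rewrite !card_ord => <-.
  by apply: eq_card => g; rewrite !inE.
rewrite {}E exchange_big /=.
rewrite (eq_bigr (fun=> \sum_(g : {ffun 'I_m -> 'I_n} | injectiveb g) G g)).
  by rewrite sumr_const card_Sn.
move=> p _; rewrite [RHS](reindex_inj (@pcomp_inj p)) /=.
by apply: eq_bigl => g; rewrite pcomp_injective.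
Qed.

End sim.

Section phase.
Variables (C : numClosedFieldType) (N : nat) (w : C).
Hypothesis wP : N.-primitive_root w.
Variables m n : nat.
Hypothesis mN : (m < N)%N.
Implicit Types (f g : {ffun 'I_m -> 'I_n}) (d : {ffun 'I_n -> 'I_N}).

Definition wt d f : C := \prod_l w ^+ d (f l).

Lemma wtE d f : wt d f = \prod_i (w ^+ d i) ^+ cnt f i.
Proof.
rewrite /wt (eq_bigr (fun l => \prod_i (w ^+ d i) ^+ (f l == i))); last first.
  move=> l _; rewrite (bigD1 (f l)) //= eqxx big1 ?mulr1 // => i.
  by rewrite eq_sym => /negPf ->.
rewrite exchange_big /=; apply: eq_bigr => i _.
by rewrite /cnt -prodrXr.
Qed.

Lemma sum_wt f g : \sum_d wt d f * (wt d g)^* = if sim f g then (N ^ n)%:R else 0.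
Proof.
under eq_bigr do rewrite !wtE rmorph_prod /= -big_split /=.
rewrite -(bigA_distr_bigA (fun i (j : 'I_N) => (w ^+ j) ^+ cnt f i * ((w ^+ j) ^+ cnt g i)^*)) /=.
have E i : \sum_(j < N) (w ^+ j) ^+ cnt f i * ((w ^+ j) ^+ cnt g i)^* =
    if cnt f i == cnt g i then N%:R else 0.
  by apply: prim_sum => //; apply: leq_ltn_trans mN; exact: cnt_le.
rewrite (eq_bigr _ (fun i _ => E i)); case: ifP => [/forallP fg|/negbT].
  by rewrite (eq_bigr (fun=> N%:R)) => [|i _]; rewrite ?prodr_const ?card_ord ?natrX // fg.
rewrite negb_forall => /existsP[i /negPf fg].
by rewrite (bigD1 i) //= fg mul0r.
Qed.

Lemma phase_sq (G : {ffun 'I_m -> 'I_n} -> C) :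
  \sum_d `|\sum_f wt d f * G f| ^+ 2 =
  (N ^ n)%:R * \sum_f \sum_(g | sim f g) G f * (G g)^*.
Proof.
rewrite (eq_bigr (fun d => \sum_f \sum_g wt d f * G f * (wt d g * G g)^*)); last first.
  move=> d _; rewrite normCK rmorph_sum /= mulr_suml.
  by apply: eq_bigr => f _; rewrite mulr_sumr.
rewrite exchange_big mulr_sumr /=; apply: eq_bigr => f _.
rewrite exchange_big mulr_sumr [RHS]big_mkcond /=; apply: eq_bigr => g _.
under eq_bigr do rewrite rmorphM /= mulrACA.
by rewrite -mulr_suml sum_wt; case: ifP; rewrite ?mul0r.
Qed.

Lemma sim_bound (G : {ffun 'I_m -> 'I_n} -> C) :
  \sum_f \sum_(g | sim f g) `|G f| * `|G g| <= (m`!)%:R * \sum_f `|G f| ^+ 2.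
Proof.
have H f g : `|G f| * `|G g| <= (`|G f| ^+ 2 + `|G g| ^+ 2) / 2.
  rewrite ler_pdivlMr ?ltr0n // mulr_natr.
  by apply: (real_leif_mean_square_scaled _ _).1; rewrite ?normr_real.
apply: (@le_trans _ _ (\sum_f \sum_(g | sim f g) (`|G f| ^+ 2 + `|G g| ^+ 2) / 2)).
  by apply: ler_sum => f _; apply: ler_sum => g _; exact: H.
under eq_bigr do rewrite -mulr_suml big_split /=.
rewrite -mulr_suml big_split /=.
rewrite [X in _ + X](_ : _ = \sum_f \sum_(g | sim f g) `|G f| ^+ 2); last first.
  rewrite (exchange_big_dep xpredT) //=; apply: eq_bigr => f _.
  by apply: eq_bigl => g; rewrite sim_sym.
rewrite -mulr2n -[X in X / _]mulr_natr mulfK ?pnatr_eq0 // mulr_sumr; apply: ler_sum => f _.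
rewrite sumr_const -[leLHS]mulr_natl ler_wpM2r ?exprn_ge0 // ler_nat.
by apply: leq_trans (card_sim f); rewrite cardsE.
Qed.

(** Averaging over phases keeps only the pairs of maps with equal multisets of values. Every map has
    at most m! such partners, itself included, which is the whole loss compared with exact
    orthogonality. *)
Lemma phase_avg (G : {ffun 'I_m -> 'I_n} -> C) :
  \sum_d `|\sum_f wt d f * G f| ^+ 2 <= (N ^ n * m`!)%:R * \sum_f `|G f| ^+ 2.
Proof.
rewrite natrM -mulrA.
rewrite -[leLHS]ger0_norm; last by apply: sumr_ge0 => d _; exact: exprn_ge0.
rewrite phase_sq normrM normr_nat ler_wpM2l ?ler0n //.
apply: le_trans (sim_bound G).
apply: (le_trans (ler_norm_sum _ _ _)); apply: ler_sum => f _.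
apply: (le_trans (ler_norm_sum _ _ _)); apply: ler_sum => g _.
by rewrite normrM norm_conjC.
Qed.

End phase.

Lemma sqr_norm_sum (C : numClosedFieldType) (I : finType) (z : I -> C) :
  `|\sum_i z i| ^+ 2 <= #|I|%:R * \sum_i `|z i| ^+ 2.
Proof.
apply: (@le_trans _ _ ((\sum_i `|z i|) ^+ 2)).
  by rewrite lerXn2r ?nnegrE ?sumr_ge0 // ler_norm_sum.
rewrite expr2 mulr_suml; under eq_bigr do rewrite mulr_sumr.
apply: (@le_trans _ _ (\sum_i \sum_j (`|z i| ^+ 2 + `|z j| ^+ 2) / 2)).
  apply: ler_sum => i _; apply: ler_sum => j _.
  rewrite ler_pdivlMr ?ltr0n // mulr_natr.
  by apply: (real_leif_mean_square_scaled _ _).1; rewrite ?normr_real.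
under eq_bigr do rewrite -mulr_suml big_split /= sumr_const.
rewrite -mulr_suml big_split /= sumr_const -sumrMnl.
rewrite -mulr2n -[X in X / _]mulr_natr mulfK ?pnatr_eq0 // mulr_natl.
by rewrite ?sumrMnl lexx.
Qed.

Section unitary_moments.
Variables (C : numClosedFieldType) (m n : nat).
Implicit Types (f g a b : {ffun 'I_m -> 'I_n}) (Z Y : 'M[C]_n).

Definition tpow (t : 'I_n -> C) f : C := \prod_l t (f l).

Lemma tprod1 a b : tprod (1%:M : 'M[C]_n) a b = (a == b)%:R.
Proof.
rewrite /tprod; case: eqP => [->|/eqP ab].
  by rewrite big1 // => l _; rewrite mxE eqxx.
have [l abl] : exists l, a l != b l.
  apply/existsP; apply: contraNT ab; rewrite negb_exists => /forallP H.
  by apply/eqP/ffunP => l; apply/eqP; rewrite -[_ == _]negbK.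
by rewrite (bigD1 l) //= mxE (negPf abl) mul0r.
Qed.

Lemma tprod_conj Z a b : tprod (Z ^t*) a b = (tprod Z b a)^*.
Proof. by rewrite /tprod rmorph_prod /=; apply: eq_bigr => l _; rewrite !mxE. Qed.

(** The tensor power of a unitary matrix is unitary. *)
Lemma tprod_parseval Z (x : {ffun 'I_m -> 'I_n} -> C) : Z \is unitarymx ->
  \sum_g `|\sum_b x b * tprod Z b g| ^+ 2 = \sum_b `|x b| ^+ 2.
Proof.
move=> /unitarymxP ZZ.
rewrite (eq_bigr (fun g => \sum_a \sum_b x a * (x b)^* * (tprod Z a g * tprod (Z ^t*) g b))); last first.
  move=> g _; rewrite normCK rmorph_sum /= mulr_suml.
  apply: eq_bigr => a _; rewrite mulr_sumr; apply: eq_bigr => b _.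
  by rewrite rmorphM /= tprod_conj mulrACA.
rewrite exchange_big /=; apply: eq_bigr => a _.
rewrite exchange_big /= (bigD1 a) //= [X in _ + X]big1 ?addr0.
  by rewrite -mulr_sumr tprod_mul ZZ tprod1 eqxx mulr1 normCK.
by move=> b ba; rewrite -mulr_sumr tprod_mul ZZ tprod1 eq_sym (negPf ba) mulr0.
Qed.

(** A minor is a signed sum of m! entries of the tensor power: Cauchy-Schwarz costs one factor m!,
    and the sum over the permutations another. *)
Lemma minor_parseval_le Z (x : {ffun 'I_m -> 'I_n} -> C) : Z \is unitarymx ->
  \sum_g `|\sum_b x b * minor Z b g| ^+ 2 <= ((m`!) ^ 2)%:R * \sum_b `|x b| ^+ 2.
Proof.
move=> Zu.
pose V g := \sum_b x b * tprod Z b g.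
have E g : \sum_b x b * minor Z b g = \sum_(s : 'S_m) (-1) ^+ s * V (fperm g s).
  rewrite /V; under [RHS]eq_bigr do rewrite mulr_sumr.
  rewrite exchange_big /=; apply: eq_bigr => b _.
  by rewrite minorE mulr_sumr; apply: eq_bigr => s _; rewrite mulrCA.
apply: (@le_trans _ _ (\sum_g (m`!)%:R * \sum_(s : 'S_m) `|V (fperm g s)| ^+ 2)).
  apply: ler_sum => g _; rewrite E.
  apply: le_trans (sqr_norm_sum _) _; rewrite card_Sn ler_wpM2l ?ler0n //.
  by apply: ler_sum => s _; rewrite normrM normrX normrN1 expr1n mul1r.
rewrite -mulr_sumr exchange_big /=.
rewrite (eq_bigr (fun=> \sum_b `|x b| ^+ 2)); last first.
  move=> s _; rewrite -(tprod_parseval x Zu) [RHS](reindex_inj (@fperm_inj _ _ s)) /=.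
  by [].
by rewrite sumr_const card_Sn -[X in _ * X]mulr_natl mulrA -natrM mulnn.
Qed.

Lemma minor_row_norm Z f : Z \is unitarymx ->
  \sum_g `|minor Z f g| ^+ 2 <= (m`!)%:R.
Proof.
move=> /unitarymxP ZZ; have [fi|fi] := boolP (injectiveb f); last first.
  by rewrite big1 ?ler0n // => g _; rewrite minor_notinjl // normr0 expr0n.
under eq_bigr do rewrite normCK -minor_conj.
by rewrite CauchyBinet ZZ minor1 // mulr1.
Qed.

Lemma perm_avg_le f (G : {ffun 'I_m -> 'I_n} -> C) : injectiveb f ->
  (forall g, 0 <= G g) ->
  (n ^_ m)%:R * \sum_(p : 'S_n) G (pcomp p f) <= (n`!)%:R * \sum_g G g.
Proof.
move=> fi G0; rewrite !mulr_natl perm_avg // lerMn2r; apply/orP; right.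
by rewrite [leRHS](bigID (fun g : {ffun 'I_m -> 'I_n} => injectiveb g)) /= lerDl sumr_ge0.
Qed.

Section avg.
Variables (N : nat) (w : C).
Hypotheses (wP : N.-primitive_root w) (mN : (m < N)%N).
Variables (Z Y : 'M[C]_n) (t : 'I_n -> C).
Hypotheses (Zu : Z \is unitarymx) (Yu : Y \is unitarymx).
Variable x : {ffun 'I_m -> 'I_n} -> {ffun 'I_m -> 'I_n} -> C.

Let L (d d' : {ffun 'I_n -> 'I_N}) (p p' : 'S_n) :=
  \sum_f \sum_a \sum_b tpow t f * (wt w d a * minor Z f (pcomp p a)) * x a b *
     (wt w d' f * minor Y b (pcomp p' f)).

(** The phases d' separate the terms with different f, the phases d those with different a. What is
    left for given f and a is a product of a function of p and a function of p', so the two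
    permutation averages decouple: the first is bounded by a row of minors of [Z], the second by
    Parseval for [Y]. The power of m! collects two from the phases, one from [minor_row_norm] and
    two from [minor_parseval_le]. *)
Lemma two_sided_avg :
  ((n ^_ m) ^ 2)%:R * \sum_d \sum_d' \sum_p \sum_p' `|L d d' p p'| ^+ 2 <=
  ((N ^ n * n`!) ^ 2 * m`! ^ 5)%:R *
  ((\sum_(f : {ffun 'I_m -> 'I_n} | injectiveb f) `|tpow t f| ^+ 2) *
   (\sum_a \sum_b `|x a b| ^+ 2)).
Proof.
pose X p' f a := \sum_b x a b * minor Y b (pcomp p' f).
pose W (d : {ffun 'I_n -> 'I_N}) p p' f := \sum_a wt w d a * (minor Z f (pcomp p a) * X p' f a).
have LE d d' p p' : L d d' p p' = \sum_f wt w d' f * (tpow t f * W d p p' f).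
  apply: eq_bigr => f _; rewrite /W [RHS]mulrA mulr_sumr; apply: eq_bigr => a _.
  rewrite /X; do 3!rewrite [in RHS]mulr_sumr.
  by apply: eq_bigr => b _; ring.
have step1 p p' : \sum_d \sum_d' `|L d d' p p'| ^+ 2 <=
   ((N ^ n * m`!) ^ 2)%:R *
   \sum_f `|tpow t f| ^+ 2 * \sum_a `|minor Z f (pcomp p a)| ^+ 2 * `|X p' f a| ^+ 2.
  apply: (@le_trans _ _ (\sum_d (N ^ n * m`!)%:R * \sum_f `|tpow t f| ^+ 2 * `|W d p p' f| ^+ 2)).
    apply: ler_sum => d _; rewrite (eq_bigr _ (fun d' _ => congr1 (fun z => `|z| ^+ 2) (LE d d' p p'))).
    apply: (le_trans (phase_avg wP mN _)); rewrite ler_wpM2l ?ler0n //.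
    by apply: ler_sum => f _; rewrite normrM exprMn.
  set c := (N ^ n * m`!)%N; rewrite -mulr_sumr -mulnn natrM -[leRHS]mulrA ler_wpM2l ?ler0n //.
  rewrite exchange_big /= mulr_sumr; apply: ler_sum => f _.
  rewrite -mulr_sumr [leRHS]mulrCA ler_wpM2l ?exprn_ge0 //.
  apply: (le_trans (phase_avg wP mN _)); rewrite ler_wpM2l ?ler0n //.
  by apply: ler_sum => a _; rewrite normrM exprMn.
have step2 f a : (n ^_ m)%:R * \sum_(p : 'S_n) `|minor Z f (pcomp p a)| ^+ 2 <= (n`! * m`!)%:R.
  have [ai|ai] := boolP (injectiveb a); last first.
    rewrite big1 ?mulr0 ?ler0n // => p _.
    by rewrite minor_notinjr ?pcomp_injective // normr0 expr0n.
  apply: le_trans (perm_avg_le (G := fun g => `|minor Z f g| ^+ 2) ai _) _.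
    by move=> g; rewrite exprn_ge0.
  by rewrite natrM ler_wpM2l ?ler0n // minor_row_norm.
have step3 f a : injectiveb f -> (n ^_ m)%:R * \sum_(p : 'S_n) `|X p f a| ^+ 2 <=
    (n`! * (m`!) ^ 2)%:R * \sum_b `|x a b| ^+ 2.
  move=> fi.
  apply: le_trans (perm_avg_le (G := fun g => `|\sum_b x a b * minor Y b g| ^+ 2) fi _) _.
    by move=> g; rewrite exprn_ge0.
  by rewrite natrM -mulrA ler_wpM2l ?ler0n // minor_parseval_le.
have -> : \sum_d \sum_d' \sum_p \sum_p' `|L d d' p p'| ^+ 2 =
    \sum_p \sum_p' \sum_d \sum_d' `|L d d' p p'| ^+ 2.
  under eq_bigr do rewrite exchange_big /=.
  rewrite exchange_big /=; apply: eq_bigr => p _.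
  under eq_bigr do rewrite exchange_big /=.
  by rewrite exchange_big.
apply: (@le_trans _ _ (((n ^_ m) ^ 2)%:R * (((N ^ n * m`!) ^ 2)%:R *
   \sum_(p : 'S_n) \sum_(p' : 'S_n) \sum_f `|tpow t f| ^+ 2 * \sum_a `|minor Z f (pcomp p a)| ^+ 2 * `|X p' f a| ^+ 2))).
  rewrite ler_wpM2l ?ler0n // mulr_sumr; apply: ler_sum => p _.
  by rewrite mulr_sumr; apply: ler_sum => p' _; exact: step1.
have -> : \sum_(p : 'S_n) \sum_(p' : 'S_n) \sum_f `|tpow t f| ^+ 2 * \sum_a `|minor Z f (pcomp p a)| ^+ 2 * `|X p' f a| ^+ 2 =
  \sum_f `|tpow t f| ^+ 2 * \sum_a ((\sum_(p : 'S_n) `|minor Z f (pcomp p a)| ^+ 2) * (\sum_(p' : 'S_n) `|X p' f a| ^+ 2)).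
  under eq_bigr do rewrite exchange_big /=.
  rewrite exchange_big /=; apply: eq_bigr => f _.
  under eq_bigr do rewrite -mulr_sumr.
  rewrite -mulr_sumr; congr (_ * _).
  transitivity (\sum_(p : 'S_n) \sum_a \sum_(p' : 'S_n)
      `|minor Z f (pcomp p a)| ^+ 2 * `|X p' f a| ^+ 2).
    by apply: eq_bigr => p _; rewrite exchange_big.
  rewrite exchange_big /=; apply: eq_bigr => a _.
  rewrite mulr_suml; apply: eq_bigr => p _.
  by rewrite mulr_sumr.
rewrite (bigID (fun f : {ffun 'I_m -> 'I_n} => injectiveb f)) /= [X in _ + X]big1 ?addr0; last first.
  move=> f fi; rewrite big1 ?mulr0 // => a _.
  by rewrite big1 ?mul0r // => p _; rewrite minor_notinjl // normr0 expr0n.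
rewrite mulr_suml !mulr_sumr; apply: ler_sum => f fi.
rewrite !mulr_sumr; apply: ler_sum => a _.
set A := \sum_p _; set B := \sum_p _; set D := \sum_b _.
have A0 : 0 <= A by apply: sumr_ge0 => p _; rewrite exprn_ge0.
have B0 : 0 <= B by apply: sumr_ge0 => p _; rewrite exprn_ge0.
have D0 : 0 <= D by apply: sumr_ge0 => p _; rewrite exprn_ge0.
have := ler_pM (mulr_ge0 (ler0n _ _) A0) (mulr_ge0 (ler0n _ _) B0) (step2 f a) (step3 f a fi).
rewrite -/A -/B -/D => H.
have tf0 : 0 <= `|tpow t f| ^+ 2 by rewrite exprn_ge0.
have {H} := ler_wpM2l (mulr_ge0 (ler0n _ ((N ^ n * m`!) ^ 2)) tf0) H.
congr (_ <= _); rewrite !natrM ?natrX ?natrM; ring.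
Qed.
End avg.
End unitary_moments.

Section maclaurin.
Variables (C : numClosedFieldType) (n : nat) (x : 'I_n -> C).
Hypothesis x0 : forall i, 0 <= x i.

(** For j <= n this is n! times the normalised elementary symmetric function e_j / 'C(n, j). *)
Let A j := \sum_(p : 'S_n) \prod_(i < n | (i < j)%N) x (p i).

Let sum_perm_swap i k (F : 'S_n -> C) :
  \sum_(p : 'S_n) F p = \sum_(p : 'S_n) F (tperm i k * p)%g.
Proof. exact: (reindex_inj (mulgI (tperm i k))). Qed.

(** Multiply the product of the first j factors by x (p i). For i >= j, exchanging i with j turns
    the sum over p into [A j.+1]. For i < j the factor x (p i) is squared, and after symmetrising
    under the exchange of i and j the square dominates x (p i) * x (p j). *)
Let A_rec j : (j < n)%N -> n%:R * A j.+1 <= (\sum_i x i) * A j.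
Proof.
move=> jn; pose k := Ordinal jn.
have AS : A j.+1 = \sum_(p : 'S_n) (\prod_(i < n | (i < j)%N) x (p i)) * x (p k).
  apply: eq_bigr => p _; rewrite (bigD1 k) //= mulrC; congr (_ * _).
  by apply: eq_bigl => i; rewrite ltnS [RHS]ltn_neqAle andbC.
have -> : (\sum_i x i) * A j = \sum_(i < n) \sum_(p : 'S_n) (\prod_(l < n | (l < j)%N) x (p l)) * x (p i).
  rewrite /A mulr_sumr exchange_big /=; apply: eq_bigr => p _.
  rewrite -mulr_sumr mulrC; congr (_ * _).
  exact: (reindex_inj (@perm_inj _ p)).
rewrite mulr_natl -[X in _ *+ X]card_ord -sumr_const; apply: ler_sum => i _.
have [ij|ji] := ltnP i j; last first.
  rewrite AS (sum_perm_swap i k); apply: ler_sum => p _.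
  rewrite !permM tpermR; rewrite (eq_bigr (fun l => x (p l))) //= => l lj.
  have [li lk] : i != l /\ k != l.
    by split; rewrite -val_eqE /= neq_ltn ?lj ?(leq_trans lj ji) ?orbT.
  by rewrite permM tpermD.
have ik : i != k by rewrite -val_eqE /= neq_ltn ij.
pose R p := \prod_(l < n | (l < j)%N && (l != i)) x ((p : 'S_n) l).
have E1 (p : 'S_n) : \prod_(l < n | (l < j)%N) x (p l) = x (p i) * R p by rewrite (bigD1 i).
have RE (p : 'S_n) : R (tperm i k * p)%g = R p.
  apply: eq_bigr => l /andP[lj li]; have lk : l != k by rewrite -val_eqE /= neq_ltn lj.
  by rewrite permM tpermD // eq_sym.
have R0 p : 0 <= R p by apply: prodr_ge0.
rewrite AS (eq_bigr (fun p : 'S_n => x (p i) * x (p k) * R p)); last by move=> p _; rewrite E1 mulrAC.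
rewrite [leRHS](eq_bigr (fun p : 'S_n => x (p i) * x (p i) * R p)); last by move=> p _; rewrite E1 mulrAC.
rewrite -(ler_pMn2r (n := 2)) // !mulr2n [X in _ <= _ + X](sum_perm_swap i k) -!big_split /=.
apply: ler_sum => p _; rewrite RE !permM tpermL. rewrite -mulr2n -mulrnAl -mulrDl ler_wpM2r //.
rewrite -!expr2; apply: (real_leif_mean_square_scaled _ _).1; exact: ger0_real.
Qed.

Lemma maclaurin m : (m <= n)%N ->
  \sum_(f : {ffun 'I_m -> 'I_n} | injectiveb f) \prod_l x (f l) <=
  (n ^_ m)%:R * (n%:R^-1 * \sum_i x i) ^+ m.
Proof.
move=> mn.
have s0 : 0 <= \sum_i x i by apply: sumr_ge0.
have Am j : (j <= n)%N -> A j <= (n`!)%:R * (n%:R^-1 * \sum_i x i) ^+ j.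
  elim: j => [|j IH] jn.
    by rewrite /A; under eq_bigr do rewrite big_pred0_eq; rewrite sumr_const card_Sn mulr1.
  have n0 : 0 < n%:R :> C by rewrite ltr0n; apply: leq_trans jn.
  rewrite exprS mulrCA -mulrA mulrC ler_pdivlMr // mulrC.
  by apply: (le_trans (A_rec jn)); rewrite ler_wpM2l // IH // ltnW.
have wi : injectiveb [ffun l : 'I_m => widen_ord mn l].
  by apply/injectiveP => l k; rewrite !ffunE => /(congr1 val) /= /val_inj.
have := esym (perm_avg (fun f : {ffun 'I_m -> 'I_n} => \prod_l x (f l)) wi).
have -> : \sum_(p : 'S_n) \prod_l x (pcomp p [ffun l => widen_ord mn l] l) = A m.
  apply: eq_bigr => p _; rewrite (big_ord_narrow mn) /=.
  by apply: eq_bigr => l _; rewrite !ffunE.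
rewrite -[LHS]mulr_natl -[RHS]mulr_natl => E.
rewrite -(ler_pM2l (x := (n`!)%:R)) ?ltr0n ?fact_gt0 // E.
by rewrite mulrCA ler_wpM2l ?ler0n // Am.
Qed.

End maclaurin.

Section phase_perm.
Variables (C : numClosedFieldType) (N : nat) (w : C).
Hypothesis wP : N.-primitive_root w.
Variable n : nat.

Definition ppmx (d : {ffun 'I_n -> 'I_N}) (p : 'S_n) : 'M[C]_n :=
  \matrix_(i, j) ((i == p j)%:R * w ^+ d j).

Lemma mul_ppmx k (Z : 'M[C]_(k, n)) d p i j : (Z *m ppmx d p) i j = Z i (p j) * w ^+ d j.
Proof.
rewrite mxE (bigD1 (p j)) //= mxE eqxx mul1r big1 ?addr0 // => l /negPf lj.
by rewrite mxE lj mul0r mulr0.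
Qed.

Lemma ppmx_unitary d p : ppmx d p \is unitarymx.
Proof.
rewrite -trmxC_unitary; apply/unitarymxP; rewrite trmxCK; apply/matrixP => i j.
rewrite mul_ppmx !mxE (inj_eq perm_inj) rmorphM /= rmorph_nat [j == i]eq_sym.
case: eqP => [->|_]; rewrite ?mul0r // mul1r mulrC -normCK normrX.
by rewrite (prim_norm wP) !expr1n.
Qed.

Lemma minor_ppmx m (Z : 'M[C]_n) d p (f a : {ffun 'I_m -> 'I_n}) :
  minor (Z *m ppmx d p) f a = wt w d a * minor Z f (pcomp p a).
Proof.
rewrite !minorE mulr_sumr; apply: eq_bigr => s _; rewrite mulrCA; congr (_ * _).
rewrite -pcomp_perm /tprod /wt [X in X * _](reindex_inj (@perm_inj _ s)) /= -big_split /=.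
by apply: eq_bigr => l _; rewrite mul_ppmx !ffunE mulrC.
Qed.

Lemma minor_diag m (t : 'rV[C]_n) Z (f a : {ffun 'I_m -> 'I_n}) :
  minor (diag_mx t *m Z) f a = tpow (t 0) f * minor Z f a.
Proof.
rewrite !minorE mulr_sumr; apply: eq_bigr => s _; rewrite mulrCA; congr (_ * _).
rewrite /tprod /tpow -big_split /=.
by apply: eq_bigr => l _; rewrite mul_diag_mx !mxE.
Qed.

Lemma em_sandwich m (t : 'rV[C]_n) (Z X Y : 'M[C]_n) :
  em m (diag_mx t *m (Z *m X *m Y)) = (m`!)%:R^-3 *
  \sum_(f : {ffun 'I_m -> 'I_n}) \sum_(a : {ffun 'I_m -> 'I_n}) \sum_(b : {ffun 'I_m -> 'I_n})
    tpow (t 0) f * minor Z f a * minor X a b * minor Y b f.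
Proof.
rewrite /em (_ : (m`!)%:R^-3 = (m`!)%:R^-1 * (m`!)%:R^-2 :> C); last first.
  by rewrite -invfM -exprS.
rewrite -[RHS]mulrA; congr (_ * _); rewrite mulr_sumr; apply: eq_bigr => f _.
rewrite minor_diag.
have m0 := fact_neq0 C m.
have -> : minor (Z *m X *m Y) f f = (m`!)%:R^-2 *
    \sum_b (\sum_a minor Z f a * minor X a b) * minor Y b f.
  under eq_bigr do rewrite CauchyBinet -mulrA.
  by rewrite -mulr_sumr CauchyBinet expr2 invfM -!mulrA !mulKf.
rewrite mulrCA; congr (_ * _); rewrite mulr_sumr exchange_big /=.
apply: eq_bigr => b _; rewrite mulr_suml mulr_sumr.
by apply: eq_bigr => a _; rewrite !mulrA.
Qed.

(** The squared Hilbert-Schmidt distance between the m-th compound matrices; the prefactor removes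
    the m! orderings of each set of rows and of columns. *)
Definition minor_dist2 m (X X' : 'M[C]_n) : C :=
  (m`!)%:R^-2 * \sum_(a : {ffun 'I_m -> 'I_n}) \sum_b `|minor X a b - minor X' a b| ^+ 2.

(** By Cauchy-Binet each term of the expanded square is the trace of the compound of a product. For
    X = P - z and X' = - z the four products are scalar matrices up to bounded rank. *)
Lemma minor_dist2E m X X' : minor_dist2 m X X' =
  em m (X *m X ^t*) - em m (X *m X' ^t*) - em m (X' *m X ^t*) + em m (X' *m X' ^t*).
Proof.
rewrite !em_mul -!mulrBr -mulrDr; congr (_ * _).
rewrite -!sumrB -big_split /=; apply: eq_bigr => a _.
rewrite -!sumrB -big_split /=; apply: eq_bigr => b _.
by rewrite normCK !minor_conj rmorphB /= mulrBl !mulrBr; ring.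
Qed.

Lemma em1 m : em m (1%:M : 'M[C]_n) = 'C(n, m)%:R.
Proof.
rewrite em_trig; last exact: scalar_mx_is_trig.
rewrite (eq_bigr (fun=> 1)) => [|f _]; last by rewrite big1 // => l _; rewrite mxE eqxx.
have -> : \sum_(f : {ffun 'I_m -> 'I_n} | injectiveb f) (1 : C) = (n ^_ m)%:R.
  rewrite sumr_const; congr (_ *+ _).
  have := @card_inj_ffuns 'I_m 'I_n; rewrite !card_ord => <-.
  by apply: eq_card => f; rewrite !inE.
by rewrite -bin_ffact natrM mulrC mulfK // fact_neq0.
Qed.

(* Only the invariance of the two outer factors under signed permutations is averaged over here;
   it already gives the second moment that Haar measure would. *)
Lemma em_second_moment m (t : 'rV[C]_n) (Z X X' Y : 'M[C]_n) : (m <= n)%N -> (m < N)%N ->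
  Z \is unitarymx -> Y \is unitarymx ->
  \sum_d \sum_d' \sum_p \sum_p'
    `|em m (diag_mx t *m (Z *m ppmx d p *m X *m (Y *m ppmx d' p'))) -
      em m (diag_mx t *m (Z *m ppmx d p *m X' *m (Y *m ppmx d' p')))| ^+ 2 <=
  ((N ^ n * n`!) ^ 2)%:R *
  ((n%:R^-1 * \sum_i `|t 0 i| ^+ 2) ^+ m * (minor_dist2 m X X' / 'C(n, m)%:R)).
Proof.
move=> mn mN Zu Yu.
pose x (a b : {ffun 'I_m -> 'I_n}) := minor X a b - minor X' a b.
have m0 := fact_neq0 C m.
have nm0 : 0 < (n ^_ m)%:R :> C by rewrite ltr0n ffact_gt0.
have H := two_sided_avg wP mN (t 0) Zu Yu x.
set S' := \sum_d _; move: H; set S := (X in _ * X <= _) => H.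
have -> : S' = (m`!)%:R^-6 * S.
  rewrite /S /S' !mulr_sumr; apply: eq_bigr => d _.
  rewrite !mulr_sumr; apply: eq_bigr => d' _.
  rewrite !mulr_sumr; apply: eq_bigr => p _.
  rewrite !mulr_sumr; apply: eq_bigr => p' _.
  rewrite !em_sandwich -mulrBr normrM exprMn ger0_norm; last by rewrite invr_ge0 exprn_ge0 // ler0n.
  rewrite [X in X * _](_ : _ = (m`!)%:R^-6); last by rewrite exprVn -exprM.
  congr (_ * `|_| ^+ 2).
  rewrite -sumrB; apply: eq_bigr => f _; rewrite -sumrB; apply: eq_bigr => a _.
  rewrite -sumrB; apply: eq_bigr => b _; rewrite !minor_ppmx /x.
  by rewrite mulrBr mulrBl.
set M := \sum_a \sum_b `|x a b| ^+ 2 in H.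
have -> : minor_dist2 m X X' = (m`!)%:R^-2 * M by [].
pose T := \sum_(f : {ffun 'I_m -> 'I_n} | injectiveb f) `|tpow (t 0) f| ^+ 2.
have M0 : 0 <= M by apply: sumr_ge0 => a _; apply: sumr_ge0 => b _; rewrite exprn_ge0.
have T0 : 0 <= T by apply: sumr_ge0 => f _; rewrite exprn_ge0.
have HT : T <= (n ^_ m)%:R * (n%:R^-1 * \sum_i `|t 0 i| ^+ 2) ^+ m.
  apply: le_trans (maclaurin (x := fun i => `|t 0 i| ^+ 2) _ mn); last by move=> i; rewrite exprn_ge0.
  by apply: ler_sum => f _; rewrite /tpow normr_prod prodrXl.
set E := (_ * _) ^+ m in HT *.
have H2 : ((n ^_ m) ^ 2)%:R * S <= ((N ^ n * n`!) ^ 2 * m`! ^ 5)%:R * (((n ^_ m)%:R * E) * M).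
  by apply: le_trans H _; rewrite ler_wpM2l ?ler0n // ler_wpM2r.
rewrite -(ler_pM2l (x := ((n ^_ m) ^ 2)%:R * (m`!)%:R ^+ 6)); last first.
  by rewrite mulr_gt0 ?exprn_gt0 ?ltr0n ?expn_gt0 ?ffact_gt0 ?mn ?fact_gt0.
move: H2; congr (_ <= _).
  by field.
(* All factorials cancel: (m!)^-6 from [em_sandwich], (m!)^5 from the averages, one m! from the
   binomial and the prefactor of [minor_dist2]. A remaining factor m! would destroy the rate t^m,
   since m goes up to n. *)
have -> : 'C(n, m)%:R = (n ^_ m)%:R / (m`!)%:R :> C by rewrite -bin_ffact natrM mulfK.
rewrite !natrM !natrX.
have := lt0r_neq0 nm0; set q := (n ^_ m)%:R => q0.
by field; rewrite m0 q0.
Qed.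

End phase_perm.

(** * Perturbations of bounded rank *)

Section hs.
Variable C : numClosedFieldType.

Definition hs p q (A : 'M[C]_(p, q)) : C := \sum_i \sum_j `|A i j| ^+ 2.

Lemma hs_ge0 p q (A : 'M[C]_(p, q)) : 0 <= hs A.
Proof. by apply: sumr_ge0 => i _; apply: sumr_ge0 => j _; rewrite exprn_ge0. Qed.

Lemma hs_tr p q (A : 'M[C]_(p, q)) : hs A = \tr (A *m A ^t*).
Proof.
apply: eq_bigr => i _; rewrite mxE; apply: eq_bigr => j _.
by rewrite !mxE normCK.
Qed.

Lemma hs_conj p q (A : 'M[C]_(p, q)) : hs (A ^t*) = hs A.
Proof.
rewrite /hs exchange_big; apply: eq_bigr => i _; apply: eq_bigr => j _.
by rewrite !mxE norm_conjC.
Qed.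

Lemma hsZ p q (c : C) (A : 'M[C]_(p, q)) : hs (c *: A) = `|c| ^+ 2 * hs A.
Proof.
rewrite /hs mulr_sumr; apply: eq_bigr => i _; rewrite mulr_sumr.
by apply: eq_bigr => j _; rewrite !mxE normrM exprMn.
Qed.

Lemma hs_sum3 p q (A B D : 'M[C]_(p, q)) : hs (A + B + D) <= 3 * (hs A + hs B + hs D).
Proof.
rewrite /hs -!big_split mulr_sumr /=; apply: ler_sum => i _.
rewrite -!big_split mulr_sumr /=; apply: ler_sum => j _; rewrite !mxE.
pose z (k : 'I_3) := tnth [tuple A i j; B i j; D i j] k.
have := sqr_norm_sum z; rewrite card_ord !big_ord_recl !big_ord0 /z.
by rewrite !(tnth_nth 0) /= !addr0 !addrA.
Qed.

Lemma hs_mul p q s (A : 'M[C]_(p, q)) (B : 'M[C]_(q, s)) : hs (A *m B) <= hs A * hs B.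
Proof.
rewrite /hs mulr_suml; apply: ler_sum => i _.
rewrite (exchange_big_dep xpredT) //= mulr_sumr; apply: ler_sum => j _.
rewrite mxE; apply: (@le_trans _ _ ((\sum_k `|A i k| * `|B k j|) ^+ 2)).
  have s0 : 0 <= \sum_k `|A i k| * `|B k j| by apply: sumr_ge0 => k _; rewrite mulr_ge0.
  rewrite lerXn2r ?nnegrE //.
  by apply: (le_trans (ler_norm_sum _ _ _)); apply: ler_sum => k _; rewrite normrM.
rewrite -subr_ge0.
(* Lagrange's identity, which makes the defect in Cauchy-Schwarz a sum of squares. *)
have -> : (\sum_j0 `|A i j0| ^+ 2) * (\sum_i0 `|B i0 j| ^+ 2) - (\sum_k `|A i k| * `|B k j|) ^+ 2 =
  2^-1 * \sum_k \sum_l (`|A i k| * `|B l j| - `|A i l| * `|B k j|) ^+ 2.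
  apply: (canRL (mulKf _)); first by rewrite pnatr_eq0.
  rewrite expr2 !mulr_suml -sumrB.
  under eq_bigr do rewrite !mulr_sumr -sumrB.
  rewrite mulr_sumr; under eq_bigr do rewrite mulr_sumr.
  pose F k l := `|A i k| ^+ 2 * `|B l j| ^+ 2 - `|A i k| * `|B k j| * (`|A i l| * `|B l j|).
  rewrite (eq_bigr (fun k => \sum_l (F k l + F k l))); last first.
    by move=> k _; apply: eq_bigr => l _; rewrite mulr_natl mulr2n.
  under eq_bigr do rewrite big_split /=.
  rewrite big_split /= [X in _ + X]exchange_big /= -big_split /=.
  apply: eq_bigr => k _; rewrite -big_split /=; apply: eq_bigr => l _.
  by rewrite /F; ring.
apply: mulr_ge0; first by rewrite invr_ge0 ler0n.
apply: sumr_ge0 => k _; apply: sumr_ge0 => l _.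
by rewrite real_exprn_even_ge0 // rpredB // rpredM // normr_real.
Qed.

Lemma hs_minor m n (A : 'M[C]_n) :
  \sum_(f : {ffun 'I_m -> 'I_n}) \sum_g `|minor A f g| ^+ 2 <= ((m`!) ^ 2)%:R * hs A ^+ m.
Proof.
have E : hs A ^+ m = \sum_(f : {ffun 'I_m -> 'I_n}) \sum_(g : {ffun 'I_m -> 'I_n}) `|tprod A f g| ^+ 2.
  rewrite -[X in _ ^+ X]card_ord -prodr_const /hs bigA_distr_bigA /=.
  apply: eq_bigr => f _; rewrite bigA_distr_bigA /=; apply: eq_bigr => g _.
  by rewrite /tprod normr_prod prodrXl.
rewrite E mulr_sumr; apply: ler_sum => f _.
apply: (@le_trans _ _ (\sum_g (m`!)%:R * \sum_(s : 'S_m) `|tprod A f (fperm g s)| ^+ 2)).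
  apply: ler_sum => g _; rewrite minorE.
  apply: le_trans (sqr_norm_sum _) _; rewrite card_Sn ler_wpM2l ?ler0n //.
  by apply: ler_sum => s _; rewrite normrM normrX normrN1 expr1n mul1r.
rewrite -mulr_sumr exchange_big /=.
rewrite (eq_bigr (fun=> \sum_g `|tprod A f g| ^+ 2)); last first.
  by move=> s _; rewrite [RHS](reindex_inj (@fperm_inj _ _ s)).
by rewrite sumr_const card_Sn -[X in _ * X]mulr_natl mulrA -natrM mulnn.
Qed.

Lemma em_mul_bound m n (A B : 'M[C]_n) : `|em m (A *m B)| <= hs A ^+ m + hs B ^+ m.
Proof.
rewrite em_mul normrM ger0_norm ?invr_ge0 ?exprn_ge0 ?ler0n //.
rewrite ler_pdivrMl ?exprn_gt0 ?ltr0n ?fact_gt0 // mulrDr -!natrX.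
apply: le_trans (lerD (hs_minor m A) (hs_minor m B)).
rewrite [X in _ + X]exchange_big -big_split /=.
apply: (le_trans (ler_norm_sum _ _ _)); apply: ler_sum => f _.
rewrite -big_split /=; apply: (le_trans (ler_norm_sum _ _ _)); apply: ler_sum => g _.
rewrite normrM; apply: (@le_trans _ _ (`|minor A f g| * `|minor B g f| *+ 2)).
  by rewrite mulr2n lerDl mulr_ge0.
by apply: (real_leif_mean_square_scaled _ _).1; rewrite normr_real.
Qed.

Lemma mxrank_mxsub m n k l (f : 'I_k -> 'I_m) (g : 'I_l -> 'I_n) (A : 'M[C]_(m, n)) :
  (\rank (mxsub f g A) <= \rank A)%N.
Proof.
rewrite mxsubrc; apply: (@leq_trans (\rank (colsub g A))).
  by rewrite rowsubE; exact: mxrankM_maxr.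
rewrite -mxrank_tr -[X in (_ <= X)%N]mxrank_tr trmx_mxsub rowsubE; exact: mxrankM_maxr.
Qed.

Lemma em_rank m n (A : 'M[C]_n) : (\rank A < m)%N -> em m A = 0.
Proof.
move=> rm; rewrite /em big1 ?mulr0 // => f _; apply/eqP; rewrite -[_ == 0]negbK.
apply: contraL rm => d0; rewrite -leqNgt.
have : mxsub f f A \in unitmx by rewrite unitmxE unitfE.
by rewrite -row_full_unit /row_full => /eqP <-; exact: mxrank_mxsub.
Qed.

(** Gram-Schmidt on a basis of the row space; [B ^t* *m B] is the orthogonal projection onto it. *)
Lemma row_basis n (A : 'M[C]_n) : exists B : 'M[C]_(\rank A, n),
  B \is unitarymx /\ A *m (B ^t* *m B) = A.
Proof.
exists (schmidt (row_base A)); have Bu := schmidt_unitarymx (row_base A) (rank_leq_col A).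
split => //; have /submxP[D AD] : (A <= schmidt (row_base A))%MS.
  by apply: submx_trans (schmidt_sub _); rewrite eq_row_base.
move: (unitarymxP Bu) AD; set S := schmidt _ => BB AD.
by rewrite {1}AD -(mulmxA D) (mulmxA S) BB mul1mx -AD.
Qed.

(** Apply [em_mul_bound] to [A] times the projection onto its row space: the squared Hilbert-Schmidt
    norm of the projection is the rank. *)
Lemma em_bound m n (A : 'M[C]_n) : `|em m A| <= hs A ^+ m + (\rank A)%:R ^+ m.
Proof.
have [B [/unitarymxP BB AB]] := row_basis A.
rewrite -{1}AB; apply: le_trans (em_mul_bound _ _ _) _.
rewrite lerD2l hs_tr trmx_mul map_mxM trmxCK mulmxA -[_ *m _ *m (_ ^t*)]mulmxA BB mulmx1.
by rewrite mxtrace_mulC BB mxtrace1 lexx.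
Qed.

(** In an orthonormal basis of the row space only [\rank A] columns remain, each the image of a unit
    vector. *)
Lemma hs_le_rank n (A : 'M[C]_n) (k : C) :
  (forall x : 'cV[C]_n, hs x <= 1 -> hs (A *m x) <= k) -> hs A <= (\rank A)%:R * k.
Proof.
move=> Ak; have [B [/unitarymxP BB AB]] := row_basis A.
have -> : hs A = hs (A *m B ^t*).
  rewrite !hs_tr -{1}AB trmx_mul map_mxM trmxCK.
  by rewrite !mulmxA.
have -> : hs (A *m B ^t*) = \sum_(j < \rank A) hs (col j (A *m B ^t*)).
  rewrite /hs exchange_big; apply: eq_bigr => j _; apply: eq_bigr => i _.
  by rewrite big_ord1 [in RHS]mxE.
rewrite mulr_natl -[X in _ *+ X]card_ord -sumr_const; apply: ler_sum => j _.
rewrite colE -mulmxA -colE; apply: Ak.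
have -> : hs (col j (B ^t*)) = (B *m B ^t*) j j; last by rewrite BB mxE eqxx.
rewrite /hs mxE; apply: eq_bigr => i _; rewrite big_ord1 !mxE normCK conjCK mulrC.
by [].
Qed.

End hs.

Section scalar_add.
Variable C : numClosedFieldType.

Lemma det_homog n (X : 'M[C]_n) (y : C) : \det (1%:M + y *: X) = \sum_(m < n.+1) y ^+ m * em m X.
Proof. by rewrite det1em; apply: eq_bigr => m _; rewrite emZ. Qed.

Lemma poly_nat_eq0 (p : {poly C}) : (forall k : nat, p.[k%:R] = 0) -> p = 0.
Proof.
move=> pk; apply/eqP; apply: contraT => p0.
have := max_poly_roots (rs := [seq k%:R | k <- iota 0 (size p)]) p0.
rewrite size_map size_iota ltnn; apply.
  by apply/allP => _ /mapP[k _ ->]; apply/rootP; exact: pk.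
rewrite map_inj_uniq ?iota_uniq // => i j /eqP; rewrite eqr_nat => /eqP //.
Qed.

(** Compare coefficients of y^m in det(1 + y(c + Q)) = u^n det(1 + (y/u) Q), where u = 1 + c y. The
    polynomial identity is verified at natural numbers y, where c >= 0 keeps u nonzero. *)
Lemma em_scalar_add n m (c : C) (Q : 'M[C]_n) : 0 <= c -> (m <= n)%N ->
  em m (c%:M + Q) = \sum_(i < m.+1) em i Q * (c ^+ (m - i) * 'C(n - i, m - i)%:R).
Proof.
move=> c0 mn.
pose p := \poly_(k < n.+1) em k (c%:M + Q).
pose q := \sum_(i < n.+1) em i Q *: ('X^i * (1 + c *: 'X) ^+ (n - i)).
have pq : p = q.
  apply/eqP; rewrite -subr_eq0; apply/eqP/poly_nat_eq0 => k.
  pose y : C := k%:R; pose u := 1 + c * y.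
  have u0 : u != 0 by rewrite gt_eqF // ltr_pwDl // mulr_ge0 // ler0n.
  rewrite hornerD hornerN -/y.
  have -> : p.[y] = \det (1%:M + y *: (c%:M + Q)).
    by rewrite det_homog horner_poly; apply: eq_bigr => i _; rewrite mulrC.
  have -> : 1%:M + y *: (c%:M + Q) = u *: (1%:M + (y / u) *: Q).
    apply/matrixP => i j; rewrite !mxE [RHS]mulrDr mulrA [u * (y / u)]mulrC divfK //.
    by rewrite /u; case: eqP => _; rewrite ?mulr1n ?mulr0n; ring.
  rewrite detZ det_homog mulr_sumr /q horner_sum -sumrB big1 // => i _.
  have iN : (i <= n)%N by rewrite -ltnS.
  rewrite hornerZ hornerM hornerXn horner_exp hornerD hornerZ hornerX hornerC -/u.
  rewrite -{1}(subnK iN) exprD expr_div_n.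
  by field; rewrite expf_neq0.
have := congr1 (fun r : {poly C} => r`_m) pq; rewrite coef_poly ltnS mn => ->.
rewrite /q coef_sum (big_ord_widen n.+1 (fun i => em i Q * (c ^+ (m - i) * 'C(n - i, m - i)%:R))) ?ltnS //.
rewrite [RHS]big_mkcond /=; apply: eq_bigr => i _.
rewrite coefZ coefXnM ltnS ltnNge; case: leqP => /= im; last by rewrite mulr0.
congr (_ * _); rewrite exprDn coef_sum.
have mi : (m - i < (n - i).+1)%N by rewrite ltnS leq_sub2r.
rewrite (bigD1 (Ordinal mi)) //= big1 ?addr0.
  rewrite expr1n mul1r coefMn exprZn coefZ coefXn /=.
  by rewrite eqxx mulr1 mulr_natr.
move=> k kmi; rewrite expr1n mul1r coefMn exprZn coefZ coefXn.
by rewrite eq_sym -[(k : nat) == _]/(k == Ordinal mi) (negPf kmi) mulr0 mul0rn.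
Qed.

Lemma em_scalar n m (c : C) : em m (c%:M : 'M[C]_n) = c ^+ m * 'C(n, m)%:R.
Proof. by rewrite -scalemx1 emZ em1. Qed.

(** The source of the decay in n of the perturbation: a term of e_m(c + Q) that contains [Q] at
    least once is smaller than 'C(n, m) by this ratio. *)
Lemma bin_ratio n m i : (0 < i)%N -> (i <= m)%N -> (m <= n)%N ->
  ('C(n - i, m - i) * n <= 'C(n, m) * m)%N.
Proof.
move=> i0 im mn; elim: i i0 im => // i IH _ im.
have [i_eq0|i0] := posnP i.
  rewrite i_eq0 !subn1 mulnC [leqRHS]mulnC.
  case: n m mn im {IH} => [|n] [|m] //= _ _; by rewrite mul_bin_diag.
apply: leq_trans (IH i0 (ltnW im)); rewrite leq_mul2r; apply/orP; right.
have [k [l [-> -> -> ->]]] : exists k l,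
    [/\ n - i = k.+1, m - i = l.+1, n - i.+1 = k & m - i.+1 = l]%N.
  by exists (n - i.+1)%N, (m - i.+1)%N; split; lia.
by rewrite binS leq_addl.
Qed.

(** In [em_scalar_add] the term of index 0 is e_m of the scalar matrix, and those of index above r
    vanish by the rank. The at most r others are bounded crudely in r, but uniformly in m apart from
    c^m and m / n. *)
Lemma em_scalar_add_bound n m r (c H : C) (Q : 'M[C]_n) :
  0 < c -> 1 <= H -> r%:R <= H -> (0 < m <= n)%N -> (\rank Q <= r)%N -> hs Q <= H ->
  `|em m (c%:M + Q) - em m (c%:M : 'M[C]_n)| <=
  r%:R * (2 * H ^+ r * (1 + c^-1) ^+ r) * (c ^+ m * (m%:R / n%:R)) * 'C(n, m)%:R.
Proof.
move=> c0 H1 rH /andP[m0 mn] rQ hQ.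
have n0 : 0 < n%:R :> C by rewrite ltr0n (leq_trans m0).
have H0 : 0 <= H by apply: le_trans H1.
have k1 : 1 <= 1 + c^-1 by rewrite lerDl invr_ge0 ltW.
rewrite em_scalar_add ?(ltW c0) // em_scalar big_ord_recl /= !subn0.
have -> : em 0 Q = 1.
  rewrite /em fact0 invr1 mul1r (eq_bigr (fun=> 1)) => [|f _]; last by rewrite /minor det_mx00.
  by rewrite sumr_const card_ffun !card_ord expn0.
rewrite mul1r addrAC subrr add0r.
set B := 2 * H ^+ r * (1 + c^-1) ^+ r; set D := c ^+ m * _.
have BD0 : 0 <= B * D * 'C(n, m)%:R.
  have H2 : 0 <= 1 + c^-1 by apply: le_trans k1.
  by rewrite !mulr_ge0 ?exprn_ge0 ?ler0n ?invr_ge0 ?ler0n // ltW.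
apply: (@le_trans _ _ (\sum_(j < m) if (j < r)%N then B * D * 'C(n, m)%:R else 0)).
  apply: (le_trans (ler_norm_sum _ _ _)); apply: ler_sum => j _.
  rewrite /bump /= add1n; case: ltnP => [jr|rj]; last first.
    by rewrite em_rank ?mul0r ?normr0 // ltnS (leq_trans rQ).
  rewrite normrM; apply: (@le_trans _ _ ((2 * H ^+ r) * ((1 + c^-1) ^+ r * D * 'C(n, m)%:R))); last first.
    by rewrite /B !mulrA.
  apply: ler_pM => //.
    apply: le_trans (em_bound _ _) _; rewrite mulr_natl mulr2n.
    have Hj : H ^+ j.+1 <= H ^+ r by rewrite ler_weXn2l.
    apply: lerD; apply: le_trans Hj; rewrite lerXn2r ?nnegrE ?hs_ge0 ?ler0n //.
    by apply: le_trans rH; rewrite ler_nat.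
  have jm : (j.+1 <= m)%N by [].
  rewrite ger0_norm; last by rewrite mulr_ge0 ?exprn_ge0 ?ler0n // ltW.
  have -> : c ^+ (m - j.+1) = c ^+ m * c^-1 ^+ j.+1.
    have -> : c ^+ m = c ^+ (m - j.+1) * c ^+ j.+1 by rewrite -exprD subnK.
    by rewrite -mulrA -exprMn divff ?expr1n ?mulr1 // gt_eqF.
  have cj : c^-1 ^+ j.+1 <= (1 + c^-1) ^+ r.
    apply: (@le_trans _ _ ((1 + c^-1) ^+ j.+1)); last by rewrite ler_weXn2l.
    by rewrite lerXn2r ?nnegrE ?invr_ge0 ?lerDr ?ler01 ?(ltW c0) // (le_trans ler01).
  have CB : 'C(n - j.+1, m - j.+1)%:R <= 'C(n, m)%:R * (m%:R / n%:R) :> C.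
    by rewrite mulrA ler_pdivlMr // -!natrM ler_nat bin_ratio.
  rewrite /D [X in _ <= X](_ : _ = (c ^+ m * (1 + c^-1) ^+ r) * ('C(n, m)%:R * (m%:R / n%:R))); last by ring.
  have cm0 : 0 <= c ^+ m by rewrite exprn_ge0 // ltW.
  apply: ler_pM => //.
    by rewrite mulr_ge0 ?exprn_ge0 ?invr_ge0 // ltW.
  by rewrite ler_wpM2l.
rewrite -big_mkcond /= sumr_const -!(mulrA r%:R) [leRHS]mulr_natl.
apply: ler_wpMn2l; first by move: BD0; rewrite !mulrA.
have [rm|/ltnW mr] := leqP r m; last first.
  by apply: leq_trans mr; rewrite -[X in (_ <= X)%N](card_ord m) max_card.
by rewrite -sum1_card (big_ord_narrow rm) /= sum1_card card_ord.
Qed.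

(** The outer 3 counts the three differences in [minor_dist2_le], and 3 r bounds the rank of P P^* -
    z^* P - z P^*. Neither m nor n occurs. *)
Definition pert_const (r : nat) (h c : C) : C :=
  3 * ((3 * r)%:R * (2 * (1 + (3 * r)%:R + 3 * (h ^+ 2 + c * h + c * h)) ^+ (3 * r) *
       (1 + c^-1) ^+ (3 * r))).

(** All four matrices in [minor_dist2E] are c plus a matrix of bounded rank. Their signs add up to
    0, so the leading terms e_m(c) cancel and only terms with the factor m / n remain. *)
Lemma minor_dist2_le n m r (h c z : C) (P : 'M[C]_n) :
  0 < c -> `|z| ^+ 2 = c -> (0 < m <= n)%N -> (\rank P <= r)%N -> hs P <= h ->
  minor_dist2 m (P - z%:M) (- z%:M) / 'C(n, m)%:R <= pert_const r h c * (c ^+ m * (m%:R / n%:R)).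
Proof.
move=> c0 zc mn rP hP.
have h0 : 0 <= h by apply: le_trans hP; exact: hs_ge0.
have c0' := ltW c0.
set H := 1 + (3 * r)%:R + 3 * (h ^+ 2 + c * h + c * h).
have ch0 : 0 <= c * h by rewrite mulr_ge0.
have s0 : 0 <= h ^+ 2 + c * h + c * h by rewrite !addr_ge0 ?exprn_ge0.
have H1 : 1 <= H by rewrite /H -addrA lerDl addr_ge0 // mulr_ge0.
have rH : (3 * r)%:R <= H by rewrite /H addrAC lerDr addr_ge0 // mulr_ge0.
have sH : 3 * (h ^+ 2 + c * h + c * h) <= H by rewrite /H lerDr addr_ge0.
have hH : c * h <= H.
  apply: le_trans sH; apply: (@le_trans _ _ (h ^+ 2 + c * h + c * h)).
    by rewrite lerDr addr_ge0 // exprn_ge0.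
  by rewrite ler_peMl // ler1n.
have C0 : 0 < 'C(n, m)%:R :> C by rewrite ltr0n bin_gt0; case/andP: mn.
rewrite ler_pdivrMr //.
have zt : (z%:M : 'M[C]_n) ^t* = (z^*)%:M by rewrite tr_scalar_mx map_scalar_mx.
have zz : z * z^* = c by rewrite -normCK.
pose Q2 := (- z^*) *: P; pose Q3 := (- z) *: P ^t*; pose Q1 := P *m P ^t* + Q2 + Q3.
have DE : minor_dist2 m (P - z%:M) (- z%:M) =
    em m (c%:M + Q1) - em m (c%:M + Q2) - em m (c%:M + Q3) + em m (c%:M : 'M[C]_n).
  rewrite minor_dist2E; congr (_ - _ - _ + _); apply: (congr1 (@em C m n)).
  - rewrite raddfB /= raddfB /= zt mulmxBl !mulmxBr !mul_scalar_mx ?mul_mx_scalar.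
    by rewrite /Q1 /Q2 /Q3 !scaleNr -zz scale_scalar_mx opprB addrCA.
  - rewrite raddfN /= raddfN /= zt mulmxN mulmxBl !mul_scalar_mx ?mul_mx_scalar.
    by rewrite /Q2 scaleNr scale_scalar_mx zz opprB.
  - rewrite raddfB /= raddfB /= zt mulNmx mulmxBr !mul_scalar_mx.
    by rewrite /Q3 scaleNr scale_scalar_mx zz opprB.
  - by rewrite raddfN /= raddfN /= zt mulmxN mulNmx opprK mul_scalar_mx scale_scalar_mx zz.
have rPt : \rank (P ^t*) = \rank P by rewrite mxrank_map mxrank_tr.
have rk2 : (\rank Q2 <= r)%N by apply: leq_trans rP; exact: mxrank_scale.
have rk3 : (\rank Q3 <= r)%N by apply: leq_trans rP; rewrite -rPt; exact: mxrank_scale.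
have rk1 : (\rank Q1 <= 3 * r)%N.
  rewrite 3!mulSn mul0n addn0 addnA.
  apply: leq_trans (mxrank_add _ _) _; apply: leq_add => //.
  apply: leq_trans (mxrank_add _ _) _; apply: leq_add => //.
  by apply: leq_trans rP; exact: mxrankM_maxl.
have h2 : hs Q2 <= c * h by rewrite hsZ normrN norm_conjC zc ler_wpM2l.
have h3 : hs Q3 <= c * h by rewrite hsZ normrN hs_conj zc ler_wpM2l.
have h1 : hs Q1 <= H.
  apply: le_trans sH; apply: le_trans (hs_sum3 _ _ _) _; rewrite ler_wpM2l //.
  rewrite !lerD //; apply: le_trans (hs_mul _ _) _; rewrite hs_conj expr2.
  by rewrite ler_pM ?hs_ge0.
have r3 : (r <= 3 * r)%N by rewrite leq_pmull.
have b1 := em_scalar_add_bound c0 H1 rH mn rk1 h1.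
have b2 := em_scalar_add_bound c0 H1 rH mn (leq_trans rk2 r3) (le_trans h2 hH).
have b3 := em_scalar_add_bound c0 H1 rH mn (leq_trans rk3 r3) (le_trans h3 hH).
set B := _ * 'C(n, m)%:R in b1 b2 b3.
set e0 := em m (c%:M : 'M[C]_n) in b1 b2 b3 *.
have D0 : 0 <= minor_dist2 m (P - z%:M) (- z%:M).
  rewrite /minor_dist2 mulr_ge0 ?invr_ge0 ?exprn_ge0 ?ler0n //.
  by apply: sumr_ge0 => a _; apply: sumr_ge0 => b _; rewrite exprn_ge0.
have -> : pert_const r h c * (c ^+ m * (m%:R / n%:R)) * 'C(n, m)%:R = B + B + B.
  by rewrite /pert_const -/H /B; ring.
have E : minor_dist2 m (P - z%:M) (- z%:M) =
    (em m (c%:M + Q1) - e0) - (em m (c%:M + Q2) - e0) - (em m (c%:M + Q3) - e0).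
  by rewrite DE -/e0; ring.
rewrite -(ger0_norm D0) E; apply: le_trans (ler_normB _ _) _; apply: lerD => //.
by apply: le_trans (ler_normB _ _) _; apply: lerD.
Qed.

End scalar_add.

(** * Second moments of traces of powers *)

Section trace_power.
Variables (C : numClosedFieldType) (n : nat) (X : 'M[C]_n).

Fixpoint walk (a : 'I_n) (s : seq 'I_n) (b : 'I_n) : C :=
  if s is c :: s' then X a c * walk c s' b else X a b.

Lemma walkE a s b : walk a s b = \prod_(i < (size s).+1) X (nth a (a :: s) i) (nth b (rcons s b) i).
Proof.
elim: s a => [|c s IH] a /=; first by rewrite big_ord_recl big_ord0 mulr1.
rewrite big_ord_recl /= IH; congr (_ * _); apply: eq_bigr => i _.
by congr (X _ _); apply: set_nth_default; rewrite /= ltn_ord.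
Qed.

Definition mxpow k : 'M[C]_n := iter k (mulmx X) 1%:M.

Lemma sum_tuple_cons k (F : seq 'I_n -> C) :
  \sum_(s : k.+1.-tuple 'I_n) F s = \sum_c \sum_(s : k.-tuple 'I_n) F (c :: s).
Proof.
rewrite pair_big /= (reindex (fun p : 'I_n * k.-tuple 'I_n => [tuple of p.1 :: p.2])) //=.
exists (fun s => (thead s, [tuple of behead s])) => [[c s] _|s _] /=.
  by congr (_, _); apply: val_inj.
by apply: val_inj; rewrite /= [RHS](congr1 val (tuple_eta s)).
Qed.

Lemma mxpow_walk k a b : mxpow k.+1 a b = \sum_(s : k.-tuple 'I_n) walk a s b.
Proof.
elim: k a => [|k IH] a.
  rewrite /mxpow /= mulmx1 (eq_bigr (fun=> X a b)) => [|s _]; last by rewrite tuple0.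
  by rewrite sumr_const card_tuple expn0.
rewrite (sum_tuple_cons k (fun s => walk a s b)) /= mxE; apply: eq_bigr => c _.
by rewrite -mulr_sumr IH.
Qed.

Definition cyc k : 'S_k := perm (@ordS_inj k).

Lemma tr_mxpow k : \tr (mxpow k.+1) =
  \sum_(f : {ffun 'I_k.+1 -> 'I_n}) tprod X f (fperm f (cyc k.+1)).
Proof.
pose W (s : seq 'I_n) := if s is a :: s' then walk a s' a else 0.
transitivity (\sum_(s : k.+1.-tuple 'I_n) W s).
  rewrite sum_tuple_cons; apply: eq_bigr => a _; exact: mxpow_walk.
rewrite (reindex (fun f : {ffun 'I_k.+1 -> 'I_n} => [tuple f i | i < k.+1])) /=; last first.
  exists (fun s : k.+1.-tuple 'I_n => [ffun i => tnth s i]) => [f _|s _].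
    by apply/ffunP => i; rewrite ffunE tnth_mktuple.
  by apply: eq_from_tnth => i; rewrite tnth_mktuple ffunE.
apply: eq_bigr => f _.
have WE (u : seq 'I_n) : size u = k.+1 -> (forall (d : 'I_n) (i : 'I_k.+1), nth d u i = f i) ->
    W u = tprod X f (fperm f (cyc k.+1)); last first.
  apply: WE => [|d i]; first by rewrite size_map size_enum_ord.
  by rewrite (nth_map i) ?size_enum_ord // nth_ord_enum.
rewrite /W; case: u => [//|a s] /= [Hs] nf.
rewrite walkE Hs; apply: eq_bigr => i _; rewrite (nf a i) ffunE permE; congr (X _ _).
rewrite nth_rcons Hs -(nf a (ordS i)) /=.
have := ltn_ord i; rewrite ltnS leq_eqVlt => /orP[/eqP ik|ik].
  by rewrite ik ltnn eqxx modnn.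
by rewrite ik modn_small ?ltnS.
Qed.

End trace_power.

Lemma ordS_iter k (l : 'I_k.+1) : iter l (@ordS k.+1) ord0 = l.
Proof.
have H i : (i < k.+1)%N -> val (iter i (@ordS k.+1) ord0) = i.
  by elim: i => //= i IH il; rewrite IH ?modn_small // ltnW.
exact/val_inj/H.
Qed.

(** A permutation commuting with a full cycle is determined by the image of one point. This count
    becomes the factor m in the second moment of the trace of an m-th power. *)
Lemma card_cyc_centralizer k :
  (#|[set s : 'S_k.+1 | (cyc k.+1 * s == s * cyc k.+1)%g]%SET| <= k.+1)%N.
Proof.
rewrite -[X in (_ <= X)%N]card_ord.
rewrite -(card_in_imset (f := fun s : 'S_k.+1 => s ord0)) ?max_card //.
move=> s t; rewrite !inE => /eqP sc /eqP tc st; apply/permP => l.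
have H (u : 'S_k.+1) : (cyc k.+1 * u = u * cyc k.+1)%g ->
    forall i, u (iter i (@ordS k.+1) ord0) = iter i (@ordS k.+1) (u ord0).
  move=> uc; elim=> //= i <-; have /permP := uc => /(_ (iter i (@ordS k.+1) ord0)).
  by rewrite !permM !permE.
by rewrite -(ordS_iter l) H // H // st.
Qed.

Lemma ffact_le_expn n k : (n ^_ k <= n ^ k)%N.
Proof.
elim: k => [|k IH]; first by rewrite ffactn0.
by rewrite ffactnSr expnSr leq_mul // leq_subr.
Qed.

(** Non-injective maps number at most k^2 n^(k-1); both sides are multiplied by n to avoid the
    exponent k - 1. *)
Lemma expn_ffact_gap n k : (n ^ k * n <= n ^_ k * n + k ^ 2 * n ^ k)%N.
Proof.
elim: k => [|k IH]; first by rewrite ffactn0 expn0 !mul1n leq_addr.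
rewrite ffactnSr !expnS expn0 muln1.
have F := ffact_le_expn n k.
have E : (n <= (n - k) + k)%N by lia.
have H : (n ^_ k * n <= n ^_ k * (n - k) + k * n ^ k)%N.
  apply: leq_trans (leq_mul (leqnn _) E) _; rewrite mulnDr leq_add2l mulnC.
  by rewrite leq_mul2l F orbT.
move: IH H; set a := (n ^ k)%N; set b := (n ^_ k)%N; set c := (n - k)%N => IH H; nia.
Qed.

(** The normalised discrete Fourier matrix. *)
Lemma flat_unitary_ex (C : numClosedFieldType) n : (0 < n)%N ->
  exists F : 'M[C]_n, F \is unitarymx /\ forall i j, `|F i j| ^+ 2 = n%:R^-1.
Proof.
move=> n0; have [v vP] := prim_root_ex C n0.
have nn : n%:R != 0 :> C by rewrite pnatr_eq0 -lt0n.
have s0 : 0 <= sqrtC (n%:R : C) by rewrite sqrtC_ge0 ler0n.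
have s2 : (sqrtC (n%:R : C))^-1 * (sqrtC n%:R)^-1 = n%:R^-1 by rewrite -invfM -expr2 sqrtCK.
exists (\matrix_(i, j) ((v ^+ j) ^+ i / sqrtC n%:R)); split; last first.
  move=> i j; rewrite mxE normrM exprMn !normrX (prim_norm vP) !expr1n mul1r.
  by rewrite normrV ?unitfE ?sqrtC_eq0 // ger0_norm // exprVn sqrtCK.
apply/unitarymxP/matrixP => i j; rewrite !mxE.
rewrite (eq_bigr (fun l : 'I_n => n%:R^-1 * ((v ^+ l) ^+ i * ((v ^+ l) ^+ j)^*))); last first.
  move=> l _; rewrite !mxE rmorphM /= rmorphV ?unitfE ?sqrtC_eq0 //=.
  by rewrite (geC0_conj s0) mulrACA s2 mulrC.
rewrite -mulr_sumr (prim_sum vP) //; case: (i == j :> nat) / eqP => [/val_inj ->|ij].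
  by rewrite eqxx mulVf.
by rewrite mulr0; case: eqP => // ij'; case: ij; rewrite ij'.
Qed.

Section trace_moment.
Variables (C : numClosedFieldType) (N : nat) (w : C).
Hypothesis wP : N.-primitive_root w.
Variables (n m : nat).
Hypotheses (n0 : (0 < n)%N) (m0 : (0 < m)%N) (mN : (m < N)%N).
Variable F : 'M[C]_n.
Hypotheses (Fu : F \is unitarymx) (Fflat : forall i j, `|F i j| ^+ 2 = n%:R^-1).
Implicit Types (f g : {ffun 'I_m -> 'I_n}) (d : {ffun 'I_n -> 'I_N}).

Definition phmx d : 'M[C]_n := diag_mx (\row_j w ^+ d j).

Lemma phmx_unitary d : phmx d \is unitarymx.
Proof.
apply/unitarymxP; rewrite tr_diag_mx map_diag_mx mulmx_diag -diag_const_mx; congr diag_mx.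
apply/rowP => j; rewrite !mxE -normCK normrX (prim_norm wP) !expr1n //.
Qed.

(** Every entry is a sum of Z i l * F l j with independent phases over l, hence has mean square 1/n
    whatever the unitary matrix [Z] is. *)
Definition spread (Z : 'M[C]_n) d : 'M[C]_n := Z *m phmx d *m F.

Lemma spread_unitary Z d : Z \is unitarymx -> spread Z d \is unitarymx.
Proof. by move=> Zu; rewrite !mul_unitarymx // phmx_unitary. Qed.

Lemma unitary_row_norm (Z : 'M[C]_n) i : Z \is unitarymx -> \sum_j `|Z i j| ^+ 2 = 1.
Proof.
move=> /unitarymxP ZZ; transitivity ((1%:M : 'M[C]_n) i i); last by rewrite mxE eqxx.
rewrite -ZZ mxE.
by apply: eq_bigr => j _; rewrite !mxE normCK.
Qed.

(** A Khinchine-type bound: the m-th power of the entry is itself a phase sum over multi-indices, to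
    which [phase_avg] applies. *)
Lemma spread_entry Z i j : Z \is unitarymx ->
  \sum_d `|spread Z d i j| ^+ (2 * m) <= (N ^ n * m`!)%:R * (n%:R^-1) ^+ m.
Proof.
move=> Zu; pose a l := Z i l * F l j.
have E d : `|spread Z d i j| ^+ (2 * m) =
      `|\sum_(f : {ffun 'I_m -> 'I_n}) wt w d f * \prod_l a (f l)| ^+ 2.
  rewrite mulnC exprM -normrX; congr (`|_| ^+ 2).
  have -> : spread Z d i j = \sum_l w ^+ d l * a l.
    rewrite mxE; apply: eq_bigr => l _.
    by rewrite mul_mx_diag !mxE /a mulrAC mulrC mulrA.
  transitivity (\prod_(k < m) \sum_l w ^+ d l * a l); first by rewrite prodr_const card_ord.
  by rewrite bigA_distr_bigA /=; apply: eq_bigr => f _; rewrite /wt -big_split.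
rewrite (eq_bigr _ (fun d _ => E d)); apply: le_trans (phase_avg wP mN _) _.
rewrite ler_wpM2l ?ler0n //.
rewrite (eq_bigr (fun f : {ffun 'I_m -> 'I_n} => \prod_l `|a (f l)| ^+ 2)); last first.
  by move=> f _; rewrite normr_prod prodrXl.
rewrite -(bigA_distr_bigA (fun _ l => `|a l| ^+ 2)) /= prodr_const card_ord.
rewrite (eq_bigr (fun l => `|Z i l| ^+ 2 * n%:R^-1)); last first.
  by move=> l _; rewrite normrM exprMn Fflat.
by rewrite -mulr_suml unitary_row_norm // mul1r.
Qed.

(** The inequality of arithmetic and geometric means reduces a product of m entries to the 2m-th
    moments of single entries. *)
Lemma spread_tprod Z f g : Z \is unitarymx ->
  \sum_d `|tprod (spread Z d) f g| ^+ 2 <= (N ^ n * m`!)%:R * (n%:R^-1) ^+ m.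
Proof.
move=> Zu; set B := _ * _.
have m00 : 0 < m%:R :> C by rewrite ltr0n.
have AGM d : `|tprod (spread Z d) f g| ^+ 2 <=
    m%:R^-1 * \sum_l `|spread Z d (f l) (g l)| ^+ (2 * m).
  have := @leif_AGM _ _ 'I_m (fun l => `|spread Z d (f l) (g l)| ^+ (2 * m)).
  case=> [l _ | + _]; first by rewrite exprn_ge0.
  rewrite card_ord => H; rewrite mulrC -(@ler_pXn2r _ m) ?nnegrE ?exprn_ge0 //; last first.
    by rewrite divr_ge0 ?ler0n // sumr_ge0 // => l _; rewrite exprn_ge0.
  apply: le_trans H; rewrite normr_prod -exprM -prodrXl; apply: ler_prod => l _.
  by rewrite exprn_ge0 //= lexx.
apply: (@le_trans _ _ (\sum_d m%:R^-1 * \sum_l `|spread Z d (f l) (g l)| ^+ (2 * m))).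
  by apply: ler_sum => d _; exact: AGM.
rewrite -mulr_sumr exchange_big /= ler_pdivrMl //.
rewrite mulr_natl -[X in _ *+ X](card_ord m) -sumr_const; apply: ler_sum => l _.
exact: spread_entry.
Qed.

(** The mass of row [f] of the tensor power on columns with a repeated index. It measures how far
    the rows are from orthonormal when only injective columns are kept, as the permutation average
    forces. *)
Definition collision (Y : 'M[C]_n) f : C :=
  \sum_(g : {ffun 'I_m -> 'I_n} | ~~ injectiveb g) `|tprod Y f g| ^+ 2.

Lemma card_noninj : (#|[set f : {ffun 'I_m -> 'I_n} | ~~ injectiveb f]%SET| * n <= m ^ 2 * n ^ m)%N.
Proof.
have := @card_inj_ffuns 'I_m 'I_n; rewrite !card_ord => E.
have := cardsC [set f : {ffun 'I_m -> 'I_n} | injectiveb f]%SET.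
rewrite E card_ffun !card_ord.
have -> : ~: [set f : {ffun 'I_m -> 'I_n} | injectiveb f]%SET =
    [set f : {ffun 'I_m -> 'I_n} | ~~ injectiveb f]%SET by apply/setP => f; rewrite !inE.
move=> H; have := expn_ffact_gap n m.
by rewrite -{1}H mulnDl leq_add2l.
Qed.

Lemma sum_noninj_le (G : {ffun 'I_m -> 'I_n} -> C) (B : C) : 0 <= B ->
  (forall f, G f <= B * (n%:R^-1) ^+ m) ->
  \sum_(f : {ffun 'I_m -> 'I_n} | ~~ injectiveb f) G f <= B * (m%:R ^+ 2 / n%:R).
Proof.
move=> B0 GB; have n00 : 0 < n%:R :> C by rewrite ltr0n.
apply: (@le_trans _ _ (\sum_(f : {ffun 'I_m -> 'I_n} | ~~ injectiveb f) B * (n%:R^-1) ^+ m)).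
  exact: ler_sum.
rewrite sumr_const -mulrnAr ler_wpM2l // -[leLHS]mulr_natr exprVn ler_pdivrMl ?exprn_gt0 //.
rewrite mulrA ler_pdivlMr // -!natrX -!natrM ler_nat [X in (_ <= X)%N]mulnC.
by apply: leq_trans card_noninj; rewrite cardsE.
Qed.

Lemma spread_collision Z f : Z \is unitarymx ->
  \sum_d collision (spread Z d) f <= (N ^ n * m`!)%:R * (m%:R ^+ 2 / n%:R).
Proof.
move=> Zu; rewrite /collision exchange_big /=; apply: sum_noninj_le; first exact: ler0n.
by move=> g; exact: spread_tprod.
Qed.

Lemma fperm_eq f s t : injectiveb f -> (fperm f s == fperm f t) = (s == t).
Proof.
move=> /injectiveP fi; apply/eqP/eqP => [/ffunP st|-> //].
by apply/permP => l; apply: fi; have := st l; rewrite !ffunE.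
Qed.

(** Over all columns the sum is exactly (s == t): permuting columns by [s] is permuting the row by
    its inverse, and the tensor power is unitary. The columns left out contribute at most
    [collision]. *)
Lemma tprod_correlation (Y : 'M[C]_n) f (s t : 'S_m) : injectiveb f -> Y \is unitarymx ->
  `|\sum_(g : {ffun 'I_m -> 'I_n} | injectiveb g) tprod Y f (fperm g s) * (tprod Y f (fperm g t))^*| <=
  (s == t)%:R + collision Y f.
Proof.
move=> fi /unitarymxP YY.
pose h g := tprod Y f (fperm g s) * (tprod Y f (fperm g t))^*.
have tY u g : tprod Y f (fperm g u) = tprod Y (fperm f u^-1%g) g.
  by rewrite -[RHS](tprod_perm _ _ _ u) fpermM mulgV fperm1.
have tot : \sum_g h g = (s == t)%:R.
  rewrite -(inj_eq invg_inj) -(fperm_eq _ _ fi) -tprod1 -YY -tprod_mul.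
  by apply: eq_bigr => g _; rewrite /h !tY tprod_conj.
have -> : \sum_(g : {ffun 'I_m -> 'I_n} | injectiveb g) h g =
    (s == t)%:R - \sum_(g : {ffun 'I_m -> 'I_n} | ~~ injectiveb g) h g.
  by rewrite -tot [X in _ = X - _](bigID (fun g : {ffun 'I_m -> 'I_n} => injectiveb g)) /= addrK.
apply: le_trans (ler_normB _ _) _; rewrite normr_nat lerD2l.
apply: le_trans (ler_norm_sum _ _ _) _.
have ni u : \sum_(g : {ffun 'I_m -> 'I_n} | ~~ injectiveb g) `|tprod Y f (fperm g u)| ^+ 2 = collision Y f.
  rewrite /collision [RHS](reindex_inj (@fperm_inj _ _ u)) /=.
  by apply: eq_bigl => g; rewrite (sim_injective (sim_fperm g u)).
apply: (@le_trans _ _ (\sum_(g : {ffun 'I_m -> 'I_n} | ~~ injectiveb g)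
    (`|tprod Y f (fperm g s)| ^+ 2 + `|tprod Y f (fperm g t)| ^+ 2) / 2)).
  apply: ler_sum => g _; rewrite normrM norm_conjC ler_pdivlMr ?ltr0n // mulr_natr.
  by apply: (real_leif_mean_square_scaled _ _).1; rewrite normr_real.
by rewrite -mulr_suml big_split /= !ni -mulr2n -[X in X / _]mulr_natr mulfK ?pnatr_eq0.
Qed.

Variables (t : 'rV[C]_n) (M2 : C).
Hypothesis tM : forall i, `|t 0 i| ^+ 2 <= M2.
Variable c : 'S_m.
Hypothesis centr : (#|[set s : 'S_m | (c * s == s * c)%g]%SET| <= m)%N.

Let G (Y : 'M[C]_n) (p : 'S_n) f := tpow (t 0) f * tprod Y f (pcomp p (fperm f c)).

(** The phase belongs to the shifted map, which has the same values as [f]; so the phases can be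
    averaged with [f] itself as index. *)
Lemma tprod_rot (Y : 'M[C]_n) (d : {ffun 'I_n -> 'I_N}) p f :
  tprod (diag_mx t *m (Y *m ppmx w d p)) f (fperm f c) = wt w d f * G Y p f.
Proof.
have -> : wt w d f = wt w d (fperm f c).
  by rewrite /wt [LHS](reindex_inj (@perm_inj _ c)); apply: eq_bigr => l _; rewrite ffunE.
rewrite /G /tprod /tpow /wt -!big_split /=; apply: eq_bigr => l _.
by rewrite mul_diag_mx mxE mul_ppmx !ffunE; ring.
Qed.

(** Passing from f to its rearrangement by s conjugates the cycle. In the second moment this pair of
    maps therefore correlates the column shifts c and s^-1 c s, which coincide exactly when s
    centralises c. *)
Lemma G_fperm Y p f (s : 'S_m) : G Y p (fperm f s) =
  tpow (t 0) f * tprod Y f (fperm (pcomp p f) (s^-1 * c * s)%g).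
Proof.
rewrite /G; congr (_ * _).
  by rewrite /tpow [RHS](reindex_inj (@perm_inj _ s)); apply: eq_bigr => l _; rewrite ffunE.
rewrite -[RHS](tprod_perm _ _ _ s) !fpermM pcomp_perm; congr tprod.
by congr fperm; rewrite !mulgA mulgV mul1g.
Qed.

(** The phases leave only the partners that rearrange [f], and the permutation average, through
    [tprod_correlation], leaves among these the centraliser of [c], up to collisions. This reflects
    E |tr U^m|^2 = m for a Haar unitary matrix and m <= n. *)
Lemma inj_part Y : (m <= n)%N -> Y \is unitarymx ->
  (n ^_ m)%:R * \sum_(p : 'S_n) \sum_(d : {ffun 'I_n -> 'I_N}) `|\sum_(f : {ffun 'I_m -> 'I_n}) wt w d f * (if injectiveb f then G Y p f else 0)| ^+ 2 <=
  (N ^ n * n`!)%:R * \sum_(f : {ffun 'I_m -> 'I_n} | injectiveb f)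
     `|tpow (t 0) f| ^+ 2 * (m%:R + (m`!)%:R * collision Y f).
Proof.
move=> mn Yu.
have E p : \sum_(d : {ffun 'I_n -> 'I_N}) `|\sum_(f : {ffun 'I_m -> 'I_n}) wt w d f * (if injectiveb f then G Y p f else 0)| ^+ 2 =
    (N ^ n)%:R * \sum_(f : {ffun 'I_m -> 'I_n} | injectiveb f)
      \sum_(s : 'S_m) G Y p f * (G Y p (fperm f s))^*.
  rewrite (phase_sq wP mN); congr (_ * _); rewrite [RHS]big_mkcond /=.
  apply: eq_bigr => f _; case: ifP => fi; last by rewrite big1 // => g _; rewrite mul0r.
  rewrite -(sim_inj fi (fun g => G Y p f * (G Y p g)^*)).
  by apply: eq_bigr => g fg; rewrite -(sim_injective fg) fi.
rewrite (eq_bigr _ (fun p _ => E p)) -mulr_sumr mulrCA natrM -mulrA ler_wpM2l ?ler0n //.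
rewrite exchange_big /= !mulr_sumr.
(* The triangle inequality bounds only the modulus of the correlation sum; being proportional to a
   sum of squares, it equals its modulus. *)
set S := \sum_(f | _) _; have S0 : 0 <= S.
  have -> : S = (n ^_ m)%:R * ((N ^ n)%:R^-1 * \sum_(p : 'S_n) \sum_(d : {ffun 'I_n -> 'I_N}) `|\sum_(f : {ffun 'I_m -> 'I_n}) wt w d f * (if injectiveb f then G Y p f else 0)| ^+ 2).
    have N0 : (N ^ n)%:R != 0 :> C.
      by rewrite pnatr_eq0 -lt0n expn_gt0 (leq_ltn_trans _ mN).
    by rewrite (eq_bigr _ (fun p _ => E p)) -mulr_sumr mulKf // exchange_big /= mulr_sumr.
  by rewrite !mulr_ge0 ?invr_ge0 ?ler0n // sumr_ge0 // => p _; rewrite sumr_ge0 // => d _; rewrite exprn_ge0.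
rewrite -(ger0_norm S0) /S; apply: le_trans (ler_norm_sum _ _ _) _; apply: ler_sum => f fi.
rewrite exchange_big /= mulr_sumr.
pose K := [set s : 'S_m | (c * s == s * c)%g]%SET.
apply: (@le_trans _ _ (\sum_(s : 'S_m) (n`!)%:R * (`|tpow (t 0) f| ^+ 2 * ((s \in K)%:R + collision Y f)))).
  apply: le_trans (ler_norm_sum _ _ _) _; apply: ler_sum => s _.
  pose h g := tprod Y f (fperm g c) * (tprod Y f (fperm g (s^-1 * c * s)%g))^*.
  have -> : \sum_(p : 'S_n) G Y p f * (G Y p (fperm f s))^* =
      `|tpow (t 0) f| ^+ 2 * \sum_(p : 'S_n) h (pcomp p f).
    rewrite mulr_sumr; apply: eq_bigr => p _.
    rewrite G_fperm /G pcomp_perm rmorphM /= mulrACA -normCK.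
    by [].
  have -> : `|(n ^_ m)%:R * (`|tpow (t 0) f| ^+ 2 * \sum_(p : 'S_n) h (pcomp p f))| =
      `|tpow (t 0) f| ^+ 2 * `|(n ^_ m)%:R * \sum_(p : 'S_n) h (pcomp p f)|.
    by rewrite mulrCA normrM ger0_norm ?exprn_ge0.
  rewrite [leRHS]mulrCA ler_wpM2l ?exprn_ge0 //.
  rewrite mulr_natl perm_avg // -[X in `|X|]mulr_natl normrM normr_nat ler_wpM2l ?ler0n //.
  have -> : (s \in K) = (c == s^-1 * c * s)%g.
    by rewrite inE -[RHS](inj_eq (mulgI s)) !mulgA mulgV mul1g eq_sym.
  exact: tprod_correlation.
rewrite -!mulr_sumr ler_wpM2l ?ler0n // ler_wpM2l ?exprn_ge0 //.
rewrite big_split /= sumr_const card_Sn -[X in _ + X <= _]mulr_natl lerD2r.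
by rewrite -natr_sum ler_nat -(big_mkcond (mem K)) /= sum1_card.
Qed.

(** No cancellation between permutations is used: a fraction of at most m^2 / n of all maps is
    non-injective, and each product of entries has mean square of order n^-m. *)
Lemma noninj_part Z : Z \is unitarymx ->
  \sum_(d1 : {ffun 'I_n -> 'I_N}) \sum_(p : 'S_n) \sum_(d : {ffun 'I_n -> 'I_N})
    `|\sum_(f : {ffun 'I_m -> 'I_n}) wt w d f * (if injectiveb f then 0 else G (spread Z d1) p f)| ^+ 2 <=
  ((N ^ n) ^ 2 * n`!)%:R * ((m`!)%:R ^+ 2 * M2 ^+ m * (m%:R ^+ 2 / n%:R)).
Proof.
move=> Zu.
have M20 : 0 <= M2 by apply: le_trans (tM (Ordinal n0)); rewrite exprn_ge0.
have tf f : `|tpow (t 0) f| ^+ 2 <= M2 ^+ m.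
  rewrite /tpow normr_prod -prodrXl -[X in _ ^+ X](card_ord m) -prodr_const.
  by apply: ler_prod => l _; rewrite exprn_ge0 //=.
apply: (@le_trans _ _ (\sum_(d1 : {ffun 'I_n -> 'I_N}) \sum_(p : 'S_n) (N ^ n * m`!)%:R *
    \sum_(f : {ffun 'I_m -> 'I_n} | ~~ injectiveb f) M2 ^+ m * `|tprod (spread Z d1) f (pcomp p (fperm f c))| ^+ 2)).
  apply: ler_sum => d1 _; apply: ler_sum => p _.
  apply: le_trans (phase_avg wP mN _) _; rewrite ler_wpM2l ?ler0n //.
  rewrite [leRHS]big_mkcond /=; apply: ler_sum => f _; case: injectiveb => /=.
    by rewrite normr0 expr0n.
  by rewrite /G normrM exprMn ler_wpM2r // exprn_ge0.
under eq_bigr do rewrite -mulr_sumr.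
rewrite -mulr_sumr exchange_big /=.
apply: (@le_trans _ _ ((N ^ n * m`!)%:R * \sum_(p : 'S_n) (M2 ^+ m * (N ^ n * m`!)%:R) * (m%:R ^+ 2 / n%:R))).
  rewrite ler_wpM2l ?ler0n //; apply: ler_sum => p _.
  rewrite exchange_big /=; apply: sum_noninj_le; first by rewrite mulr_ge0 ?exprn_ge0 ?ler0n.
  move=> f; rewrite -mulr_sumr -mulrA ler_wpM2l ?exprn_ge0 //.
  exact: spread_tprod.
rewrite sumr_const card_Sn -mulr_natl le_eqVlt; apply/orP; left; apply/eqP.
rewrite !natrM; ring.
Qed.

(** The error may keep [M2 ^+ m] and factorials, because it carries 1/n and is applied to degrees
    below a fixed bound; the main term has the exact rate. One error comes from collisions in the
    injective part, the other from the non-injective part. *)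
Lemma trace_second_moment Z : (m <= n)%N -> Z \is unitarymx ->
  \sum_(d1 : {ffun 'I_n -> 'I_N}) \sum_(p : 'S_n) \sum_(d : {ffun 'I_n -> 'I_N})
    `|\sum_(f : {ffun 'I_m -> 'I_n}) tprod (diag_mx t *m (spread Z d1 *m ppmx w d p)) f (fperm f c)| ^+ 2 <=
  ((N ^ n) ^ 2 * n`!)%:R * (2 * (m%:R * (n%:R^-1 * \sum_i `|t 0 i| ^+ 2) ^+ m +
    2 * (m`!)%:R ^+ 2 * M2 ^+ m * (m%:R ^+ 2 / n%:R))).
Proof.
move=> mn Zu.
have M20 : 0 <= M2 by apply: le_trans (tM (Ordinal n0)); rewrite exprn_ge0.
have nm0 : 0 < (n ^_ m)%:R :> C by rewrite ltr0n ffact_gt0.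
set tau := n%:R^-1 * _.
have tau0 : 0 <= tau by rewrite mulr_ge0 ?invr_ge0 ?ler0n // sumr_ge0 // => i _; rewrite exprn_ge0.
have tauM : tau <= M2.
  rewrite /tau ler_pdivrMl ?ltr0n // mulr_natl -[X in _ *+ X](card_ord n) -sumr_const.
  exact: ler_sum.
pose T := \sum_(f : {ffun 'I_m -> 'I_n} | injectiveb f) `|tpow (t 0) f| ^+ 2.
have T0 : 0 <= T by apply: sumr_ge0 => f _; rewrite exprn_ge0.
have HT : T <= (n ^_ m)%:R * tau ^+ m.
  apply: le_trans (maclaurin (x := fun i => `|t 0 i| ^+ 2) _ mn); last by move=> i; rewrite exprn_ge0.
  by apply: ler_sum => f _; rewrite /tpow normr_prod prodrXl.
have HI : \sum_(d1 : {ffun 'I_n -> 'I_N}) \sum_(p : 'S_n) \sum_(d : {ffun 'I_n -> 'I_N})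
    `|\sum_(f : {ffun 'I_m -> 'I_n}) wt w d f * (if injectiveb f then G (spread Z d1) p f else 0)| ^+ 2 <=
  ((N ^ n) ^ 2 * n`!)%:R * (m%:R * tau ^+ m + (m`!)%:R ^+ 2 * M2 ^+ m * (m%:R ^+ 2 / n%:R)).
  rewrite -(ler_pM2l nm0) mulr_sumr.
  apply: (@le_trans _ _ (\sum_(d1 : {ffun 'I_n -> 'I_N}) (N ^ n * n`!)%:R *
     \sum_(f : {ffun 'I_m -> 'I_n} | injectiveb f)
     `|tpow (t 0) f| ^+ 2 * (m%:R + (m`!)%:R * collision (spread Z d1) f))).
    by apply: ler_sum => d1 _; apply: inj_part => //; exact: spread_unitary.
  rewrite -mulr_sumr exchange_big /=.
  apply: (@le_trans _ _ ((N ^ n * n`!)%:R * \sum_(f : {ffun 'I_m -> 'I_n} | injectiveb f)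
     `|tpow (t 0) f| ^+ 2 * ((N ^ n)%:R * (m%:R + (m`!)%:R ^+ 2 * (m%:R ^+ 2 / n%:R))))).
    rewrite ler_wpM2l ?ler0n //; apply: ler_sum => f _.
    rewrite -mulr_sumr ler_wpM2l ?exprn_ge0 // big_split /= sumr_const card_ffun !card_ord.
    rewrite [X in X + _ <= _](_ : _ = (N ^ n)%:R * m%:R); last by rewrite mulr_natl.
    rewrite mulrDr lerD2l -mulr_sumr.
    apply: le_trans (ler_wpM2l (ler0n _ _) (spread_collision f Zu)) _.
    rewrite le_eqVlt; apply/orP; left; apply/eqP; rewrite natrM; ring.
  rewrite -mulr_suml -/T.
  set b := m%:R ^+ 2 / n%:R; have b0 : 0 <= b by rewrite mulr_ge0 ?exprn_ge0 ?invr_ge0 ?ler0n.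
  apply: (@le_trans _ _ ((N ^ n * n`!)%:R * (((n ^_ m)%:R * tau ^+ m) * ((N ^ n)%:R * (m%:R + (m`!)%:R ^+ 2 * b))))).
    rewrite ler_wpM2l ?ler0n // ler_wpM2r // mulr_ge0 ?ler0n // addr_ge0 ?ler0n //.
    by rewrite mulr_ge0 ?exprn_ge0 ?ler0n.
  have -> : (N ^ n * n`!)%:R * ((n ^_ m)%:R * tau ^+ m * ((N ^ n)%:R * (m%:R + m`!%:R ^+ 2 * b))) =
    (n ^_ m)%:R * (((N ^ n) ^ 2 * n`!)%:R * (m%:R * tau ^+ m + m`!%:R ^+ 2 * tau ^+ m * b)).
    by rewrite -mulnn !natrM; ring.
  rewrite ler_wpM2l ?ler0n // ler_wpM2l ?ler0n // lerD2l ler_wpM2r //.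
  by rewrite ler_wpM2l ?exprn_ge0 ?ler0n // lerXn2r ?nnegrE.
have split d1 p d : `|\sum_(f : {ffun 'I_m -> 'I_n}) tprod (diag_mx t *m (spread Z d1 *m ppmx w d p)) f (fperm f c)| ^+ 2 <=
    2 * (`|\sum_(f : {ffun 'I_m -> 'I_n}) wt w d f * (if injectiveb f then G (spread Z d1) p f else 0)| ^+ 2 +
    `|\sum_(f : {ffun 'I_m -> 'I_n}) wt w d f * (if injectiveb f then 0 else G (spread Z d1) p f)| ^+ 2).
  set A := \sum_(f : {ffun 'I_m -> 'I_n}) _ * (if _ then G _ _ _ else 0); set B := \sum_(f : {ffun 'I_m -> 'I_n}) _ * (if _ then 0 else _).
  have -> : \sum_(f : {ffun 'I_m -> 'I_n}) tprod (diag_mx t *m (spread Z d1 *m ppmx w d p)) f (fperm f c) = A + B.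
    rewrite /A /B -big_split /=; apply: eq_bigr => f _; rewrite tprod_rot.
    by case: ifP; rewrite mulr0 ?addr0 ?add0r.
  have := @sqr_norm_sum C bool (fun b => if b then A else B).
  by rewrite card_bool !big_bool /=.
apply: (@le_trans _ _ (\sum_(d1 : {ffun 'I_n -> 'I_N}) \sum_(p : 'S_n) \sum_(d : {ffun 'I_n -> 'I_N}) 2 *
    (`|\sum_(f : {ffun 'I_m -> 'I_n}) wt w d f * (if injectiveb f then G (spread Z d1) p f else 0)| ^+ 2 +
    `|\sum_(f : {ffun 'I_m -> 'I_n}) wt w d f * (if injectiveb f then 0 else G (spread Z d1) p f)| ^+ 2))).
  by apply: ler_sum => d1 _; apply: ler_sum => p _; apply: ler_sum => d _; exact: split.
under eq_bigr do under eq_bigr do rewrite -mulr_sumr big_split.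
under eq_bigr do rewrite -mulr_sumr big_split.
rewrite -mulr_sumr big_split mulrCA ler_wpM2l ?ler0n //=.
apply: le_trans (lerD HI (noninj_part Zu)) _.
rewrite -mulrDr ler_wpM2l ?ler0n // -addrA lerD2l.
rewrite le_eqVlt; apply/orP; left; apply/eqP; ring.
Qed.

End trace_moment.

(** * Newton's identities and a lower bound for the determinant *)

Section newton.
Variable C : numClosedFieldType.
Implicit Types (s : seq C) (f g r : {poly C}).

Let psum s j : C := \sum_(a <- s) a ^+ j.
Let fpoly s : {poly C} := \prod_(a <- s) (1 - a *: 'X).
Let ppoly s M : {poly C} := \poly_(j < M) psum s j.+1.
Let geo (a : C) M : {poly C} := \poly_(j < M) a ^+ j.

Lemma geo_mul (a : C) M : (1 - a *: 'X) * geo a M = 1 - a ^+ M *: 'X^M.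
Proof.
have -> : geo a M = \sum_(j < M) (a *: 'X) ^+ j.
  by rewrite /geo poly_def; apply: eq_bigr => j _; rewrite exprZn.
have E := subrX1 (a *: 'X) M.
by rewrite -[1 - a *: 'X]opprB mulNr -E opprB exprZn.
Qed.

Let deriv1 : (1 : {poly C})^`() = 0.
Proof. by rewrite -polyC1 derivC. Qed.

(** The logarithmic derivative of the product is minus the generating series of the power sums. The
    identity is taken modulo X^M with an explicit remainder, so that polynomials suffice. *)
Lemma newton_deriv s M : exists r, (fpoly s)^`() = - (fpoly s * ppoly s M) + 'X^M * r.
Proof.
elim: s => [|a s [r IH]].
  exists 0; rewrite /fpoly /ppoly big_nil deriv1 mul1r mulr0 addr0.
  rewrite [\poly_(_ < _) _](_ : _ = 0) ?oppr0 //.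
  by apply/polyP => j; rewrite coef_poly coef0 /psum big_nil if_same.
exists ((1 - a *: 'X) * r - a ^+ M.+1 *: fpoly s).
have -> : ppoly (a :: s) M = a *: geo a M + ppoly s M.
  apply/polyP => j; rewrite coefD coefZ !coef_poly; case: ifP => _; last by rewrite mulr0 addr0.
  by rewrite /psum big_cons exprS.
rewrite /fpoly big_cons -/(fpoly s) derivM IH derivB derivZ derivX deriv1 sub0r.
have G := geo_mul a M.
have -> : (1 - a *: 'X) * fpoly s * (a *: geo a M + ppoly s M) =
   a *: fpoly s * ((1 - a *: 'X) * geo a M) + (1 - a *: 'X) * fpoly s * ppoly s M.
  by rewrite -!mul_polyC; ring.
rewrite G exprSr -!mul_polyC polyCM !polyC_exp; ring.
Qed.

Lemma inv_trunc s M : exists g r, fpoly s * g = 1 + 'X^M * r.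
Proof.
elim: s => [|a s [g [r IH]]].
  by exists 1, 0; rewrite /fpoly big_nil mulr0 addr0 mulr1.
exists (g * geo a M), ((1 - a ^+ M *: 'X^M) * r - (a ^+ M)%:P).
rewrite /fpoly big_cons -/(fpoly s).
have -> : (1 - a *: 'X) * fpoly s * (g * geo a M) = fpoly s * g * ((1 - a *: 'X) * geo a M) by ring.
by rewrite IH geo_mul -!mul_polyC; ring.
Qed.

Lemma coefXnM_lt M r k : (k < M)%N -> ('X^M * r)`_k = 0.
Proof. by move=> kM; rewrite coefXnM kM. Qed.

Lemma low_coef_eq0 f r M : f`_0 = 1 -> (forall k, (k < M)%N -> (f * r)`_k = 0) ->
  forall k, (k < M)%N -> r`_k = 0.
Proof.
move=> f0 fr; elim/ltn_ind => k IH kM; have := fr k kM.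
rewrite coefM big_ord_recl /= f0 mul1r subn0 big1 ?addr0 // => j _.
have kj : (k - bump 0 j < k)%N by rewrite /bump leq0n /=; have := ltn_ord j; lia.
by rewrite IH ?mulr0 // (ltn_trans kj).
Qed.

Lemma fpoly0 s : (fpoly s)`_0 = 1.
Proof.
rewrite -horner_coef0 /fpoly horner_prod big1 // => a _.
by rewrite hornerD hornerN hornerZ hornerX hornerC mulr0 subr0.
Qed.

(** Differentiating f g = 1 modulo X^M and inserting [newton_deriv] gives g' = p g modulo X^(M-1),
    with p the series of power sums; the recursion reads off the coefficients. *)
Lemma inv_newton s M : exists g, (forall k, (k < M)%N -> (fpoly s * g)`_k = (k == 0)%:R) /\
  (forall k, (k.+1 < M)%N -> g`_k.+1 *+ k.+1 = \sum_(j < k.+1) psum s j.+1 * g`_(k - j)).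
Proof.
have [g [r fg]] := inv_trunc s M; exists g; split.
  by move=> k kM; rewrite fg coefD coefXnM_lt // addr0 coef1.
move=> k kM; have [q fq] := newton_deriv s M.
have M0 : (0 < M)%N by apply: leq_trans kM.
have D : (fpoly s * (g^`() - ppoly s M * g)) = 'X^(M.-1) * (M%:R * r + 'X * (r^`() - q * g)).
  have := congr1 (@deriv _) fg; rewrite derivM fq derivD derivM derivXn deriv1 add0r => H.
  rewrite mulrBr mulrA.
  have -> : fpoly s * g^`() = 'X^(M.-1) *+ M * r + 'X^M * r^`() - (- (fpoly s * ppoly s M) + 'X^M * q) * g.
    by rewrite -H addrAC subrr add0r.
  have -> : 'X^M = 'X^(M.-1) * 'X :> {poly C} by rewrite -exprSr prednK.
  by rewrite -mulr_natl; ring.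
have : (g^`() - ppoly s M * g)`_k = 0.
  apply: (low_coef_eq0 (M := M.-1) (fpoly0 s)) => [i iM|]; last by rewrite -ltnS prednK.
  by rewrite D coefXnM_lt.
move=> /eqP; rewrite coefB subr_eq0 coef_deriv => /eqP ->.
rewrite coefM; apply: eq_bigr => j _; rewrite coef_poly.
by rewrite (leq_trans _ kM) // ltnS ltnW.
Qed.
End newton.

Lemma sum_bin_diag B k : (\sum_(i < k.+1) 'C(B + i, i) = 'C(B + k.+1, k))%N.
Proof.
elim: k => [|k IH]; first by rewrite big_ord_recr big_ord0 /= !bin0.
by rewrite big_ord_recr /= IH !addnS binS addnC.
Qed.

Section charpoly.
Variable C : numClosedFieldType.

Lemma mxpow_conj n (P L : 'M[C]_n) k : P \in unitmx ->
  mxpow (invmx P *m L *m P) k = invmx P *m mxpow L k *m P.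
Proof.
move=> Pu; elim: k => [|k IH]; first by rewrite /mxpow /= mulmx1 mulVmx.
rewrite /mxpow /= -/(mxpow _ _) IH -/(mxpow L k) !mulmxA.
by rewrite -[X in X *m _ *m _ = _]mulmxA mulmxV // mulmx1.
Qed.

Lemma mxpow_trig n (L : 'M[C]_n) k : is_trig_mx L ->
  is_trig_mx (mxpow L k) /\ forall i, mxpow L k i i = L i i ^+ k.
Proof.
move=> Lt; elim: k => [|k [T D]].
  by split=> [|i]; rewrite /mxpow /= ?scalar_mx_is_trig // mxE eqxx.
split=> [|i]; last by rewrite /mxpow /= -/(mxpow L k) mulmx_trig_diag // D exprS.
apply/is_trig_mxP => i j ij; rewrite /mxpow /= -/(mxpow L k) mxE big1 // => l _.
have [il|li] := ltnP i l; first by rewrite (is_trig_mxP Lt) // mul0r.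
by rewrite (is_trig_mxP T) ?mulr0 // (leq_ltn_trans li).
Qed.

Lemma eigen_data n (S : 'M[C]_n) : exists s : seq C,
  \poly_(m < n.+1) ((-1) ^+ m * em m S) = \prod_(a <- s) (1 - a *: 'X) /\
  forall k, \tr (mxpow S k) = \sum_(a <- s) a ^+ k.
Proof.
have [P [L [Pu Lt ->]]] := unitary_trig S.
exists [seq L i i | i <- enum 'I_n]; split; last first.
  move=> k; rewrite mxpow_conj // mxtrace_mulC mulmxA mulmxV // mul1mx big_map big_enum /=.
  by apply: eq_bigr => i _; have [_ ->] := mxpow_trig k Lt.
apply/eqP; rewrite -subr_eq0; apply/eqP/poly_nat_eq0 => k; set y : C := k%:R.
rewrite hornerD hornerN horner_poly horner_prod big_map big_enum /=.
transitivity (\det (1%:M + (- y) *: (invmx P *m L *m P)) - \prod_i (1 + ((- y) *: L) i i)).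
  rewrite det_homog; congr (_ - _).
    by apply: eq_bigr => i _; rewrite mulrAC -[- y]mulN1r exprMn.
  apply: eq_bigr => i _; rewrite hornerD hornerN hornerZ hornerX hornerC !mxE.
  by rewrite mulNr mulrC.
have -> : 1%:M + (- y) *: (invmx P *m L *m P) = invmx P *m (1%:M + (- y) *: L) *m P.
  by rewrite mulmxDr mulmx1 mulmxDl mulVmx // -scalemxAr -scalemxAl.
rewrite !det_mulmx mulrAC -det_mulmx mulVmx // det1 mul1r det_trig1 ?subrr //.
by apply/is_trig_mxP => i j ij; rewrite mxE (is_trig_mxP Lt) // mulr0.
Qed.

(** Comparison with the inverse of (1 - y X)^(B+1): its roots have power sums (B+1) y^j, and the
    inverse has coefficients 'C(B+k, k) y^k. *)
Lemma inv_coef_bound (p g : nat -> C) (y : C) B m0 : 0 <= y -> `|g 0| <= 1 ->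
  (forall j, (0 < j < m0)%N -> `|p j| <= B.+1%:R * y ^+ j) ->
  (forall k, (k.+1 < m0)%N -> g k.+1 *+ k.+1 = \sum_(j < k.+1) p j.+1 * g (k - j)%N) ->
  forall k, (k < m0)%N -> `|g k| <= 'C(B + k, k)%:R * y ^+ k.
Proof.
move=> y0 g0 pB rec; elim/ltn_ind => [[|k]] IH km.
  by rewrite addn0 bin0 mul1r expr0.
have k0 : 0 < k.+1%:R :> C by rewrite ltr0n.
rewrite -(ler_pM2l k0) -{1}(normr_nat _ k.+1) -normrM mulr_natl rec //.
apply: le_trans (ler_norm_sum _ _ _) _.
apply: (@le_trans _ _ (\sum_(j < k.+1) B.+1%:R * y ^+ k.+1 * 'C(B + (k - j), k - j)%:R)).
  apply: ler_sum => j _; rewrite normrM.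
  have jk : (j <= k)%N by rewrite -ltnS.
  have -> : y ^+ k.+1 = y ^+ j.+1 * y ^+ (k - j) by rewrite -exprD addSn subnKC.
  rewrite [leRHS](_ : _ = (B.+1%:R * y ^+ j.+1) * ('C(B + (k - j), k - j)%:R * y ^+ (k - j))); last by ring.
  apply: ler_pM => //; first by apply: pB; rewrite (leq_ltn_trans _ km) // ltnS.
  by apply: IH; [rewrite ltnS leq_subr | apply: leq_ltn_trans km; rewrite leqW // leq_subr].
rewrite -mulr_sumr (reindex_inj rev_ord_inj) /=.
rewrite (eq_bigr (fun j : 'I_k.+1 => 'C(B + j, j)%:R)); last first.
  by move=> j _; rewrite subSS subKn // -ltnS.
rewrite -natr_sum sum_bin_diag mulrAC mulrA -!natrM.
rewrite (_ : B.+1 * 'C(B + k.+1, k) = k.+1 * 'C(B + k.+1, k.+1))%N //.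
have := mul_bin_left (B + k.+1) k; rewrite (_ : B + k.+1 - k = B.+1)%N; last lia.
by move=> ->.
Qed.

(* [\det (1 - z S)] times the truncation of its formal inverse is 1 up to a small tail; the
   coefficients of the inverse are controlled by the traces through Newton's identities. *)
Lemma det_lower_bound n (S : 'M[C]_n) (B m0 : nat) (x y z : C) :
  0 <= y -> 0 <= x -> x < 1 -> `|z| * y <= x -> (0 < m0)%N ->
  (forall j, `|em j S| <= B.+1%:R * y ^+ j) ->
  (forall j, (0 < j < m0)%N -> `|\tr (mxpow S j)| <= B.+1%:R * y ^+ j) ->
  B.+1%:R * 'C(B + m0, m0.-1)%:R * x ^+ m0 <= (1 - x) / 2 ->
  (2 * 'C(B + m0, m0.-1)%:R)^-1 <= `|\det (1%:M - z *: S)|.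
Proof.
move=> y0 x0 x1 zy m00 eB pB small.
have [s [fs ps]] := eigen_data S.
set f := \poly_(m < n.+1) _ in fs.
have [g [fg rec]] := inv_newton s m0; rewrite -fs in fg.
have f0 : f`_0 = 1.
  rewrite fs -horner_coef0 horner_prod big1 // => a _.
  by rewrite hornerD hornerN hornerZ hornerX hornerC mulr0 subr0.
have g0 : `|g`_0| <= 1.
  by have := fg 0 m00; rewrite coef0M f0 mul1r => ->; rewrite normr1.
have gB : forall k, (k < m0)%N -> `|g`_k| <= 'C(B + k, k)%:R * y ^+ k.
  apply: (@inv_coef_bound (fun j => \tr (mxpow S j)) (fun k => g`_k)) => //.
  by move=> k km; rewrite rec //; apply: eq_bigr => j _; rewrite ps.
have fB j : `|f`_j| <= B.+1%:R * y ^+ j.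
  rewrite coef_poly; case: ltnP => _; last by rewrite normr0 mulr_ge0 ?exprn_ge0.
  by rewrite normrM normrX normrN1 expr1n mul1r.
set Q := 'C(B + m0, m0.-1) in small *.
(* [Q] is the sum of the majorants of the m0 coefficients of the truncated inverse [G], hence a
   bound for |G| wherever |z| y <= 1. *)
have sumQ : (\sum_(i < m0) 'C(B + i, i) = Q)%N by rewrite /Q -[in LHS](prednK m00) sum_bin_diag prednK.
have Q0 : (0 < Q)%N by rewrite bin_gt0; lia.
pose G : {poly C} := \poly_(k < m0) g`_k.
have Gz : `|G.[z]| <= Q%:R.
  rewrite /G horner_poly; apply: le_trans (ler_norm_sum _ _ _) _.
  rewrite -sumQ natr_sum; apply: ler_sum => i _; rewrite normrM normrX.
  apply: (@le_trans _ _ ('C(B + i, i)%:R * y ^+ i * `|z| ^+ i)).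
    by rewrite ler_wpM2r ?exprn_ge0 // gB.
  rewrite -mulrA -exprMn ler_piMr // mulrC exprn_ile1 ?mulr_ge0 //.
  by apply: le_trans zy (ltW x1).
have zx k : `|z| ^+ k * y ^+ k <= x ^+ k.
  by rewrite -exprMn lerXn2r ?nnegrE ?mulr_ge0.
have GE k : (k < m0)%N -> (f * G)`_k = (k == 0)%:R.
  move=> km; rewrite -fg // !coefM; apply: eq_bigr => j _.
  by rewrite [G`__]coef_poly (leq_ltn_trans (leq_subr _ _) km).
have hB k : (m0 <= k)%N -> `|(f * G)`_k| <= B.+1%:R * Q%:R * y ^+ k.
  move=> mk; rewrite coefMr; apply: le_trans (ler_norm_sum _ _ _) _.
  apply: (@le_trans _ _ (\sum_(i < k.+1 | (i < m0)%N) B.+1%:R * y ^+ k * 'C(B + i, i)%:R)).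
    rewrite [leRHS]big_mkcond /=; apply: ler_sum => i _; rewrite [G`__]coef_poly.
    case: ltnP => im; last by rewrite mulr0 normr0.
    have ik : (i <= k)%N by rewrite -ltnS.
    have -> : y ^+ k = y ^+ (k - i) * y ^+ i by rewrite -exprD subnK.
    rewrite normrM [leRHS](_ : _ = (B.+1%:R * y ^+ (k - i)) * ('C(B + i, i)%:R * y ^+ i)); last by ring.
    by apply: ler_pM => //; exact: gB.
  by rewrite (big_ord_narrow (leqW mk)) /= -mulr_sumr -natr_sum sumQ mulrAC.
(* The product f G has no coefficients in degrees 1 to m0 - 1; the others are summed as a geometric
   series, which [small] bounds by 1/2. *)
have tail : `|(f * G).[z] - 1| <= 1 / 2.
  rewrite (horner_coef_wide z (leq_addl m0 (size (f * G)))) big_split_ord /=.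
  have -> : \sum_(i < m0) (f * G)`_i * z ^+ i = 1.
    rewrite -[m0 in LHS](prednK m00) big_ord_recl /= GE // mul1r big1 ?addr0 // => i _.
    by rewrite GE ?mul0r // /bump leq0n add1n; have := ltn_ord i; lia.
  rewrite addrAC subrr add0r; apply: le_trans (ler_norm_sum _ _ _) _.
  apply: (@le_trans _ _ (\sum_(i < size (f * G)) B.+1%:R * Q%:R * x ^+ m0 * x ^+ i)).
    apply: ler_sum => i _; rewrite -mulrA -exprD normrM normrX.
    apply: (@le_trans _ _ (B.+1%:R * Q%:R * y ^+ (m0 + i) * `|z| ^+ (m0 + i))).
      by rewrite ler_wpM2r ?exprn_ge0 // hB // leq_addr.
    by rewrite -mulrA ler_wpM2l ?mulr_ge0 ?ler0n // mulrC.
  rewrite -mulr_sumr; have x1' : 0 < 1 - x by rewrite subr_gt0.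
  apply: (@le_trans _ _ ((1 - x) / 2 * \sum_(i < size (f * G)) x ^+ i)).
    by rewrite ler_wpM2r // sumr_ge0 // => i _; rewrite exprn_ge0.
  rewrite mulrAC ler_wpM2r ?invr_ge0 ?ler0n //.
  rewrite -[1 - x]opprB mulNr -subrX1 opprB gerBl exprn_ge0 //.
have lb : 1 / 2 <= `|(f * G).[z]|.
  have := lerB_normD 1 ((f * G).[z] - 1); rewrite addrCA subrr addr0 normr1.
  apply: le_trans; rewrite lerBrDr; apply: (@le_trans _ _ (1 / 2 + 1 / 2)); first by rewrite lerD2l.
  by rewrite -splitr.
have -> : \det (1%:M - z *: S) = f.[z].
  rewrite -scaleNr det_homog horner_poly; apply: eq_bigr => i _.
  by rewrite -[- z]mulN1r exprMn mulrAC.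
rewrite invfM ler_pdivrMr ?ltr0n //.
apply: (@le_trans _ _ (1 / 2)); first by rewrite mul1r.
by apply: le_trans lb _; rewrite hornerM normrM ler_wpM2l.
Qed.

End charpoly.

(** * Zeros in the disc for most members of the family *)

Section family.
Variables (C : numClosedFieldType) (n N : nat) (w : C) (F : 'M[C]_n).
Hypotheses (n0 : (0 < n)%N) (nN : (n < N)%N) (wP : N.-primitive_root w).
Hypotheses (Fu : F \is unitarymx) (Fflat : forall i j, `|F i j| ^+ 2 = n%:R^-1).

Definition fam := ({ffun 'I_n -> 'I_N} * {ffun 'I_n -> 'I_N} * 'S_n)%type.

Definition qmx (i : fam) : 'M[C]_n := phmx w i.1.1 *m F *m ppmx w i.1.2 i.2.

Lemma qmx_unitary i : qmx i \is unitarymx.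
Proof. by rewrite /qmx !mul_unitarymx ?(phmx_unitary wP) ?(ppmx_unitary wP). Qed.

Lemma card_fam : #|{: fam}| = ((N ^ n) ^ 2 * n`!)%N.
Proof. by rewrite !card_prod card_Sn !card_ffun !card_ord mulnn. Qed.

Lemma sum_fam (G : fam -> C) :
  \sum_i G i = \sum_(d1 : {ffun 'I_n -> 'I_N}) \sum_(p : 'S_n) \sum_(d : {ffun 'I_n -> 'I_N}) G (d1, d, p).
Proof.
transitivity (\sum_(a : {ffun 'I_n -> 'I_N} * {ffun 'I_n -> 'I_N}) \sum_(p : 'S_n) G (a, p)).
  by rewrite pair_bigA; apply: eq_bigr => -[a p].
transitivity (\sum_(d1 : {ffun 'I_n -> 'I_N}) \sum_(d : {ffun 'I_n -> 'I_N}) \sum_(p : 'S_n) G (d1, d, p)).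
  by rewrite [RHS]pair_bigA; apply: eq_bigr => -[d1 d].
by apply: eq_bigr => d1 _; rewrite exchange_big.
Qed.

Variables (x y : 'M[C]_n) (t : 'rV[C]_n).
Hypotheses (xu : x \is unitarymx) (yu : y \is unitarymx).

Let tau : C := n%:R^-1 * \sum_i `|t 0 i| ^+ 2.

Let tau0 : 0 <= tau.
Proof. by rewrite mulr_ge0 ?invr_ge0 ?ler0n // sumr_ge0 // => i _; rewrite exprn_ge0. Qed.

(** For t = s^-1, x = u^*, y = v^* and X = P - z this is s^-1 U^-1 (P - z) V^-1, with U = q^* u and
    V = q'^* v for the members q, q' of the family. *)
Definition sandwich (X : 'M[C]_n) (i i' : fam) : 'M[C]_n :=
  diag_mx t *m (x *m qmx i *m X *m (y *m qmx i')).

(** The first diagonal matrices d1 and d1' stay fixed: together with [F] they are absorbed into the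
    arbitrary unitary factors of [em_second_moment]. *)
Lemma sandwich_avg m X X' : (m <= n)%N ->
  \sum_i \sum_i' `|em m (sandwich X i i') - em m (sandwich X' i i')| ^+ 2 <=
  (#|{: fam}| ^ 2)%:R * (tau ^+ m * (minor_dist2 m X X' / 'C(n, m)%:R)).
Proof.
move=> mn.
have sE d1 d p d1' d' p' Z : sandwich Z (d1, d, p) (d1', d', p') =
    diag_mx t *m (spread w F x d1 *m ppmx w d p *m Z *m (spread w F y d1' *m ppmx w d' p')).
  by rewrite /sandwich /qmx /spread /= !mulmxA.
set E := tau ^+ m * _.
pose T d1 d p d1' d' p' := `|em m (sandwich X (d1, d, p) (d1', d', p')) -
    em m (sandwich X' (d1, d, p) (d1', d', p'))| ^+ 2.
have -> : \sum_i \sum_i' `|em m (sandwich X i i') - em m (sandwich X' i i')| ^+ 2 =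
  \sum_d1 \sum_d1' \sum_d \sum_d' \sum_p \sum_p' T d1 d p d1' d' p'.
  rewrite sum_fam; apply: eq_bigr => d1 _.
  transitivity (\sum_(p : 'S_n) \sum_(d : {ffun 'I_n -> 'I_N}) \sum_d1' \sum_p' \sum_d' T d1 d p d1' d' p').
    by apply: eq_bigr => p _; apply: eq_bigr => d _; rewrite sum_fam.
  rewrite exchange_big /=.
  transitivity (\sum_(d : {ffun 'I_n -> 'I_N}) \sum_d1' \sum_d' \sum_p \sum_p' T d1 d p d1' d' p').
    apply: eq_bigr => d _; rewrite exchange_big /=; apply: eq_bigr => d1' _.
    rewrite [RHS]exchange_big /=; apply: eq_bigr => p _.
    by rewrite exchange_big.
  by rewrite exchange_big.
apply: (@le_trans _ _ (\sum_(d1 : {ffun 'I_n -> 'I_N}) \sum_(d1' : {ffun 'I_n -> 'I_N}) ((N ^ n * n`!) ^ 2)%:R * E)).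
  apply: ler_sum => d1 _; apply: ler_sum => d1' _.
  have := em_second_moment wP t X X' mn (leq_ltn_trans mn nN)
    (spread_unitary wP Fu d1 xu) (spread_unitary wP Fu d1' yu).
  apply: le_trans; apply: ler_sum => d _; apply: ler_sum => d' _.
  by apply: ler_sum => p _; apply: ler_sum => p' _; rewrite /T !sE.
rewrite !sumr_const card_ffun !card_ord -mulrnA -[leLHS]mulr_natl mulrA -natrM card_fam.
by rewrite le_eqVlt (_ : (_ * _ = ((N ^ n) ^ 2 * n`!) ^ 2)%N) ?eqxx //; ring.
Qed.

Lemma em_avg m : (m <= n)%N ->
  \sum_i \sum_i' `|em m (sandwich 1%:M i i')| ^+ 2 <= (#|{: fam}| ^ 2)%:R * tau ^+ m.
Proof.
move=> mn; have C0 : 'C(n, m)%:R != 0 :> C by rewrite pnatr_eq0 -lt0n bin_gt0.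
(* The comparison with X' = 0 needs m > 0, as e_0 is 1 for every matrix. *)
have [m0|m0] := posnP m.
  rewrite m0 expr0 mulr1.
  rewrite (eq_bigr (fun=> #|{: fam}|%:R)) => [|i _].
    by rewrite sumr_const -mulnn natrM mulr_natl.
  rewrite (eq_bigr (fun=> 1)) ?sumr_const // => i' _.
  rewrite /em fact0 invr1 mul1r (eq_bigr (fun=> 1)) => [|f _]; last by rewrite /minor det_mx00.
  by rewrite sumr_const card_ffun !card_ord expn0 normr1 expr1n.
have em0 (A : 'M[C]_n) : em m (0 *: A) = 0 by rewrite emZ expr0n eqn0Ngt m0 mul0r.
have := sandwich_avg 1%:M 0 mn.
rewrite (eq_bigr (fun i => \sum_i' `|em m (sandwich 1%:M i i')| ^+ 2)); last first.
  move=> i _; apply: eq_bigr => i' _.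
  by rewrite {2}/sandwich mulmx0 mul0mx mulmx0 -(scale0r 1%:M) em0 subr0.
move/le_trans; apply; rewrite minor_dist2E trmx1 map_mx1 trmx0 map_mx0.
rewrite !mul0mx !mulmx0 mulmx1 -!(scale0r (1%:M : 'M[C]_n)) em0 em1 !subr0 addr0.
by rewrite divff // mulr1.
Qed.

Lemma pert_avg m r (h c z : C) (P : 'M[C]_n) : 0 < c -> `|z| ^+ 2 = c ->
  (0 < m <= n)%N -> (\rank P <= r)%N -> hs P <= h ->
  \sum_i \sum_i' `|em m (sandwich (P - z%:M) i i') - em m (sandwich (- z%:M) i i')| ^+ 2 <=
  (#|{: fam}| ^ 2)%:R * ((tau * c) ^+ m * (m%:R / n%:R) * pert_const r h c).
Proof.
move=> c0 zc mn rP hP; apply: le_trans (sandwich_avg _ _ _) _; first by case/andP: mn.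
rewrite ler_wpM2l ?ler0n // [(tau * c) ^+ m]exprMn.
have -> : tau ^+ m * c ^+ m * (m%:R / n%:R) * pert_const r h c =
  tau ^+ m * (pert_const r h c * (c ^+ m * (m%:R / n%:R))) by ring.
by rewrite ler_wpM2l ?exprn_ge0 // (minor_dist2_le c0 zc mn rP hP).
Qed.

(** Averaging over the second member suffices: since X = 1, the product of [x], the first member and
    [y] is a single unitary matrix. *)
Lemma tr_avg k (M2 : C) : (0 < k <= n)%N -> (forall i, `|t 0 i| ^+ 2 <= M2) ->
  \sum_i \sum_i' `|\tr (mxpow (sandwich 1%:M i i') k)| ^+ 2 <=
  (#|{: fam}| ^ 2)%:R * (2 * (k%:R * tau ^+ k + 2 * (k`!)%:R ^+ 2 * M2 ^+ k * (k%:R ^+ 2 / n%:R))).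
Proof.
case: k => // k /andP[k0 kn] tM.
set E := 2 * _.
have H i : \sum_i' `|\tr (mxpow (sandwich 1%:M i i') k.+1)| ^+ 2 <= #|{: fam}|%:R * E.
  rewrite sum_fam card_fam.
  have Zu : x *m qmx i *m y \is unitarymx by rewrite (mul_unitarymx (mul_unitarymx xu (qmx_unitary i)) yu).
  have := trace_second_moment wP n0 k0 (leq_ltn_trans kn nN) Fu Fflat tM (card_cyc_centralizer k) kn Zu.
  apply: le_trans; apply: ler_sum => d1 _; apply: ler_sum => p _; apply: ler_sum => d _.
  by rewrite tr_mxpow /sandwich /qmx /spread /= mulmx1 !mulmxA.
apply: (@le_trans _ _ (\sum_(i : fam) #|{: fam}|%:R * E)); first exact: ler_sum.
by rewrite sumr_const -[leLHS]mulr_natl mulrA -natrM mulnn.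
Qed.

End family.

Lemma geo_le (C : numFieldType) (e : C) K : 0 <= e -> e < 1 -> \sum_(k < K) e ^+ k <= (1 - e)^-1.
Proof.
move=> e0 e1; have e1' : 0 < 1 - e by rewrite subr_gt0.
rewrite -[leRHS]mul1r ler_pdivlMr // mulrC -[1 - e]opprB mulNr -subrX1 opprB.
by rewrite gerBl exprn_ge0.
Qed.

Lemma geo2_le (C : numFieldType) (e : C) K : 0 <= e -> e < 1 -> \sum_(k < K) k%:R * e ^+ k <= (1 - e)^-2.
Proof.
move=> e0 e1; have e1' : 0 < 1 - e by rewrite subr_gt0.
have e1i : 0 <= (1 - e)^-1 by rewrite invr_ge0 ltW.
elim: K => [|K IH]; first by rewrite big_ord0 invr_ge0 exprn_ge0 // ltW.
rewrite big_ord_recl mul0r add0r.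
rewrite (eq_bigr (fun k : 'I_K => e * (k%:R * e ^+ k) + e * e ^+ k)); last first.
  by move=> k _; rewrite /= /bump /= add1n exprS -natr1; ring.
rewrite big_split /= -!mulr_sumr.
apply: (@le_trans _ _ (e * (1 - e)^-2 + e * (1 - e)^-1)).
  by apply: lerD; rewrite ler_wpM2l // geo_le.
have -> : e * (1 - e)^-2 + e * (1 - e)^-1 = (1 - e)^-2 - 1.
  by field; rewrite gt_eqF.
by rewrite gerBl ler01.
Qed.

Section analytic.
Variable C : numClosedFieldType.

Lemma parseval N (w : C) (p : {poly C}) (rho : C) : N.-primitive_root w -> 0 <= rho ->
  (size p <= N)%N ->
  \sum_(j < N) `|p.[rho * w ^+ j]| ^+ 2 = N%:R * \sum_(k < N) `|p`_k| ^+ 2 * (rho ^+ 2) ^+ k.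
Proof.
move=> wP rho0 pN; pose a k := p`_k * rho ^+ k.
have E (j : 'I_N) : `|p.[rho * w ^+ j]| ^+ 2 =
    \sum_(k < N) \sum_(l < N) a k * (a l)^* * ((w ^+ j) ^+ k * ((w ^+ j) ^+ l)^*).
  have Ek k : p`_k * (rho * w ^+ j) ^+ k = a k * (w ^+ j) ^+ k by rewrite /a exprMn mulrA.
  rewrite normCK (horner_coef_wide _ pN) rmorph_sum /= mulr_suml; apply: eq_bigr => k _.
  rewrite mulr_sumr; apply: eq_bigr => l _.
  by rewrite !Ek rmorphM /= mulrACA.
rewrite (eq_bigr _ (fun j _ => E j)) exchange_big mulr_sumr /=; apply: eq_bigr => k _.
rewrite exchange_big (bigD1 k) //= [X in _ + X]big1 ?addr0 => [|l lk]; rewrite -mulr_sumr (prim_sum wP) //.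
  by rewrite eqxx mulrC /a rmorphM /= mulrACA -!normCK [`|rho ^+ k|]ger0_norm ?exprn_ge0 // -!exprM mulnC.
by rewrite eq_sym -[(l : nat) == k]/(l == k) (negPf lk) mulr0.
Qed.

Lemma cauchy_schwarz K (a b : 'I_K -> C) :
  `|\sum_k a k * b k| ^+ 2 <= (\sum_k `|a k| ^+ 2) * (\sum_k `|b k| ^+ 2).
Proof.
have := hs_mul (\row_k a k) (\col_k b k).
rewrite /hs !big_ord1; congr (_ <= _ * _).
- by rewrite mxE; congr (`|_| ^+ 2); apply: eq_bigr => k _; rewrite !mxE.
- by apply: eq_bigr => k _; rewrite mxE.
- by apply: eq_bigr => k _; rewrite big_ord1 mxE.
Qed.

(** Parseval at N equispaced points of the circle of radius [rho], then Cauchy-Schwarz against the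
    powers of x. Bounds at N points thus become uniform on a smaller disc. *)
Lemma poly_sup N (w : C) (p : {poly C}) (rho x z : C) : N.-primitive_root w ->
  0 <= rho -> 0 <= x -> x < 1 -> (size p <= N)%N -> `|z| <= x * rho ->
  N%:R * (1 - x) * `|p.[z]| ^+ 2 <= \sum_(j < N) `|p.[rho * w ^+ j]| ^+ 2.
Proof.
move=> wP rho0 x0 x1 pN zr; have x1' : 0 < 1 - x by rewrite subr_gt0.
rewrite (parseval wP rho0 pN) -mulrA ler_wpM2l ?ler0n // mulrC -ler_pdivlMr //.
have pz : `|p.[z]| <= `|\sum_(k < N) (`|p`_k| * rho ^+ k) * x ^+ k|.
  rewrite [leRHS]ger0_norm; last by apply: sumr_ge0 => k _; rewrite !mulr_ge0 ?exprn_ge0.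
  rewrite (horner_coef_wide _ pN); apply: le_trans (ler_norm_sum _ _ _) _.
  apply: ler_sum => k _; rewrite normrM normrX -mulrA ler_wpM2l // -exprMn.
  by rewrite lerXn2r ?nnegrE ?mulr_ge0 // mulrC.
apply: (@le_trans _ _ (`|\sum_(k < N) (`|p`_k| * rho ^+ k) * x ^+ k| ^+ 2)).
  by rewrite lerXn2r ?nnegrE.
apply: le_trans (cauchy_schwarz _ _) _; apply: ler_pM => //.
- by apply: sumr_ge0 => k _; rewrite exprn_ge0.
- by apply: sumr_ge0 => k _; rewrite exprn_ge0.
- apply: ler_sum => k _; rewrite ger0_norm ?mulr_ge0 ?exprn_ge0 // exprMn.
  by rewrite -!exprM mulnC.
- apply: le_trans (geo_le N x0 x1); apply: ler_sum => k _.
  rewrite ger0_norm ?exprn_ge0 // -exprM ler_wiXn2l // ?(ltW x1) //.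
  by rewrite leq_pmulr.
Qed.

Lemma det_poly n (A B : 'M[C]_n) : exists p : {poly C},
  (size p <= n.+1)%N /\ forall z, p.[z] = \det (A + z *: B).
Proof.
pose M : 'M[{poly C}]_n := \matrix_(i, j) ((A i j)%:P + B i j *: 'X).
exists (\det M); split; last first.
  move=> z; rewrite -horner_evalE -det_map_mx; congr (\det _).
  apply/matrixP => i j; rewrite !mxE /= horner_evalE hornerD hornerC hornerZ hornerX.
  by rewrite mulrC.
rewrite /determinant; apply: (big_ind (fun p : {poly C} => (size p <= n.+1)%N)).
- by rewrite size_poly0.
- by move=> p q pn qn; rewrite (leq_trans (size_polyD _ _)) // geq_max pn.
move=> s _; rewrite -signr_odd; case: (odd _); rewrite ?expr0 ?expr1 ?mul1r ?mulN1r ?size_polyN.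
all: apply: leq_trans (size_poly_prod_leq _ _) _.
all: rewrite -[X in (_ - X)%N]/#|_| ?card_ord.
all: have H : (\sum_i size (M i (s i)) <= \sum_(i < n) 2)%N by
  apply: leq_sum => i _; rewrite mxE; apply: leq_trans (size_polyD _ _) _;
  rewrite geq_max (leq_trans (size_polyC_leq1 _)) //=;
  apply: leq_trans (size_scale_leq _ _) _; rewrite size_polyX.
all: move: H; rewrite sum_nat_const card_ord; move: (\sum_i _)%N => Z; lia.
Qed.

Lemma markov_count (J : finType) (G : J -> C) (K A : C) : 0 < K -> (forall j, 0 <= G j) ->
  \sum_j G j <= A -> #|[set j | K <= G j]%SET|%:R <= A / K.
Proof.
move=> K0 G0 GA; rewrite ler_pdivlMr //; apply: le_trans GA.
rewrite (bigID (fun j => K <= G j)) /= -[leLHS]addr0; apply: lerD; last exact: sumr_ge0.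
rewrite mulr_natl -sumr_const big_mkcond [leRHS]big_mkcond /=; apply: ler_sum => j _.
by rewrite inE; case: ifP.
Qed.

End analytic.

Section count.
Variables (C : numClosedFieldType) (n N : nat) (w : C) (F : 'M[C]_n).
Hypotheses (n0 : (0 < n)%N) (nN : (n < N)%N) (wP : N.-primitive_root w).
Hypotheses (Fu : F \is unitarymx) (Fflat : forall i j, `|F i j| ^+ 2 = n%:R^-1).
Variables (x y : 'M[C]_n) (t : 'rV[C]_n).
Hypotheses (xu : x \is unitarymx) (yu : y \is unitarymx).
Variables (P : 'M[C]_n) (r : nat) (h : C).
Hypotheses (rP : (\rank P <= r)%N) (hP : hs P <= h).
Variables (M2 eta rho q : C) (B m0 : nat).
Hypotheses (tM : forall i, `|t 0 i| ^+ 2 <= M2).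
Hypotheses (eta0 : 0 < eta) (eta1 : eta < 1) (rho0 : 0 < rho) (q0 : 0 <= q) (q1 : q < 1).
Hypothesis tau_eta : n%:R^-1 * (\sum_i `|t 0 i| ^+ 2) * rho ^+ 2 <= eta ^+ 3.
Hypotheses (m0_gt0 : (0 < m0)%N) (m0n : (m0 <= n.+1)%N).
Hypothesis small : B.+1%:R * 'C(B + m0, m0.-1)%:R * q ^+ m0 <= (1 - q) / 2.

Let tau : C := n%:R^-1 * \sum_i `|t 0 i| ^+ 2.
Let c : C := rho ^+ 2.
Let Q : C := 'C(B + m0, m0.-1)%:R.
Let e1 : C := (1 - eta)^-1.
Let J := (fam n N * fam n N)%type.
Let sw X (j : J) := sandwich w F x y t X j.1 j.2.
Let s : C := (#|{: fam n N}| ^ 2)%:R.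

Let sum_J (G : J -> C) : \sum_(j : J) G j = \sum_i \sum_i' G (i, i').
Proof. by rewrite pair_bigA; apply: eq_bigr => -[]. Qed.

Let c0 : 0 < c. Proof. exact: exprn_gt0. Qed.

Let cX k : 0 <= c ^+ k. Proof. exact: exprn_ge0 (ltW c0). Qed.

Let etaX k : 0 <= eta ^+ k. Proof. exact: exprn_ge0 (ltW eta0). Qed.

Let tau0 : 0 <= tau.
Proof. by rewrite mulr_ge0 ?invr_ge0 ?ler0n // sumr_ge0 // => i _; rewrite exprn_ge0. Qed.

Let tc k : (tau * c) ^+ k <= (eta ^+ 3) ^+ k.
Proof.
have e30 : 0 <= eta ^+ 3 by rewrite exprn_ge0 // ltW.
by apply: lerXn2r tau_eta; rewrite nnegrE // (mulr_ge0 tau0 (ltW c0)).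
Qed.

Let tc1 k : (tau * c) ^+ k <= eta ^+ k.
Proof.
apply: le_trans (tc k) _; rewrite -exprM ler_wiXn2l // ?ltW //.
by rewrite leq_pmull.
Qed.

Let e10 : 0 < e1. Proof. by rewrite invr_gt0 subr_gt0. Qed.

(** Three quantities with controlled means: [G1] carries the coefficients of [f], [G2] the traces of
    powers, and [G3] the values of [F - f], here [H], at N points of the circle of radius [rho]. *)
Let G1 (j : J) : C := \sum_(m < n.+1) `|em m (sw 1%:M j)| ^+ 2 * c ^+ m.

Let G1_sum : \sum_j G1 j <= s * e1.
Proof.
rewrite exchange_big /=; apply: le_trans (_ : \sum_(m < n.+1) s * eta ^+ m <= _).
  apply: ler_sum => m _; rewrite -mulr_suml sum_J.
  have mn : (m <= n)%N by rewrite -ltnS.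
  apply: (@le_trans _ _ (s * tau ^+ m * c ^+ m)).
    rewrite ler_wpM2r ?cX //.
    exact: em_avg.
  by rewrite -mulrA -exprMn ler_wpM2l ?ler0n // tc1.
by rewrite -mulr_sumr ler_wpM2l ?ler0n // geo_le // ltW.
Qed.

(** The error terms of the trace moments. For fixed [m0], [M2] and [rho] it does not depend on n, so
    R / n tends to 0. *)
Let R : C := \sum_(k < m0) 4 * (k`!)%:R ^+ 2 * (M2 * c) ^+ k * k%:R ^+ 2.

Let G2 (j : J) : C := \sum_(k < m0 | (0 < k)%N) `|\tr (mxpow (sw 1%:M j) k)| ^+ 2 * c ^+ k.

Let M20 : 0 <= M2. Proof. by apply: le_trans (tM (Ordinal n0)); rewrite exprn_ge0. Qed.

Let G2_sum : \sum_j G2 j <= s * (2 * e1 ^+ 2 + R / n%:R).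
Proof.
have s0 : 0 <= s by rewrite ler0n.
rewrite exchange_big /=.
apply: (@le_trans _ _ (\sum_(k < m0) s * (2 * (k%:R * eta ^+ k) +
    4 * (k`!)%:R ^+ 2 * (M2 * c) ^+ k * k%:R ^+ 2 / n%:R))).
  rewrite [leLHS]big_mkcond /=; apply: ler_sum => k _; case: posnP => [k0|k0].
    by rewrite k0 mul0r mulr0 add0r expr0n /= mulr0 mul0r mulr0.
  have kn : (0 < k <= n)%N by rewrite k0 -ltnS (leq_trans (ltn_ord k)).
  rewrite -mulr_suml sum_J.
  apply: (@le_trans _ _ (s * (2 * (k%:R * tau ^+ k + 2 * (k`!)%:R ^+ 2 * M2 ^+ k * (k%:R ^+ 2 / n%:R))) * c ^+ k)).
    rewrite ler_wpM2r ?cX //.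
    exact: (tr_avg n0 nN wP Fu Fflat xu yu kn tM).
  rewrite -mulrA ler_wpM2l //.
  have -> : 2 * (k%:R * tau ^+ k + 2 * k`!%:R ^+ 2 * M2 ^+ k * (k%:R ^+ 2 / n%:R)) * c ^+ k =
    2 * (k%:R * (tau * c) ^+ k) + 4 * k`!%:R ^+ 2 * (M2 * c) ^+ k * k%:R ^+ 2 / n%:R.
    by rewrite [(tau * c) ^+ k]exprMn [(M2 * c) ^+ k]exprMn; ring.
  by rewrite lerD2r ler_wpM2l // ler_wpM2l.
rewrite -mulr_sumr big_split /= -mulr_sumr -mulr_suml ler_wpM2l // lerD2r ler_wpM2l //.
by rewrite exprVn geo2_le // ltW.
Qed.

Let a m (j : J) (z : C) := em m (sw (P - z%:M) j) - em m (sw (- z%:M) j).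

Let H (j : J) z : C := \sum_(m < n.+1) a m j z.

Let pert := pert_const r h c.

Let G3 (j : J) : C := \sum_(k < N) `|H j (rho * w ^+ k)| ^+ 2.

Let h0 : 0 <= h. Proof. by apply: le_trans hP; exact: hs_ge0. Qed.

Let pert0 : 0 <= pert.
Proof.
have ch : 0 <= c * h by apply: mulr_ge0 h0; exact: ltW.
have A : 0 <= 1 + (3 * r)%:R + 3 * (h ^+ 2 + c * h + c * h).
  apply: addr_ge0; first by rewrite addr_ge0 ?ler01 ?ler0n.
  by rewrite mulr_ge0 ?ler0n // !addr_ge0 // exprn_ge0.
have D : 0 <= 1 + c^-1 by rewrite addr_ge0 ?ler01 // invr_ge0 ltW.
apply: mulr_ge0; first exact: ler0n.
apply: mulr_ge0; first exact: ler0n.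
apply: mulr_ge0; last exact: exprn_ge0.
by apply: mulr_ge0; [exact: ler0n | exact: exprn_ge0].
Qed.

Let G3_sum : \sum_j G3 j <= s * (N%:R * (e1 ^+ 3 * pert / n%:R)).
Proof.
have s0 : 0 <= s by rewrite ler0n.
have n00 : 0 <= n%:R^-1 :> C by rewrite invr_ge0 ler0n.
rewrite exchange_big /= mulrCA mulr_natl -[X in _ *+ X](card_ord N) -sumr_const.
apply: ler_sum => k _; set z := rho * w ^+ k.
have zc : `|z| ^+ 2 = c.
  by rewrite normrM normrX (prim_norm wP) expr1n mulr1 ger0_norm // ltW.
(* Cauchy-Schwarz with weights eta^m costs eta^(-2m). The cube in [tau_eta] pays for this loss and
   leaves m eta^m, which is summable. *)
have HH j : `|H j z| ^+ 2 <= e1 * \sum_(m < n.+1) (eta ^- 2) ^+ m * `|a m j z| ^+ 2.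
  have -> : H j z = \sum_(m < n.+1) eta ^+ m * (eta ^- m * a m j z).
    by apply: eq_bigr => m _; rewrite mulVKf // expf_neq0 // gt_eqF.
  apply: le_trans (cauchy_schwarz _ _) _; apply: ler_pM.
  - by apply: sumr_ge0 => m _; rewrite exprn_ge0.
  - by apply: sumr_ge0 => m _; rewrite exprn_ge0.
  - apply: le_trans (geo_le n.+1 (ltW eta0) eta1); apply: ler_sum => m _.
    rewrite ger0_norm ?etaX // -exprM ler_wiXn2l // ?(ltW eta1) ?(ltW eta0) //.
    by rewrite leq_pmulr.
  - apply: ler_sum => m _; rewrite normrM exprMn ger0_norm ?invr_ge0 ?etaX //.
    by rewrite -!exprVn -!exprM mulnC.
apply: (@le_trans _ _ (\sum_j e1 * \sum_(m < n.+1) (eta ^- 2) ^+ m * `|a m j z| ^+ 2)).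
  by apply: ler_sum => j _; exact: HH.
rewrite -mulr_sumr exchange_big /=.
apply: (@le_trans _ _ (e1 * \sum_(m < n.+1) s * (pert / n%:R) * (m%:R * eta ^+ m))).
  rewrite ler_wpM2l ?(ltW e10) //; apply: ler_sum => m _; rewrite -mulr_sumr.
  have [m0'|m0'] := posnP m.
    rewrite big1 ?mulr0 => [|j _]; last first.
      have em0' (A : 'M[C]_n) : em 0 A = 1.
        rewrite /em fact0 invr1 mul1r (eq_bigr (fun=> 1)) => [|f _]; last by rewrite /minor det_mx00.
        by rewrite sumr_const card_ffun !card_ord expn0.
      by rewrite /a m0' !em0' subrr normr0 expr0n.
    by rewrite m0' mul0r mulr0.
  have mn : (0 < m <= n)%N by rewrite m0' -ltnS ltn_ord.
  rewrite sum_J.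
  apply: (@le_trans _ _ ((eta ^- 2) ^+ m * (s * ((eta ^+ 3) ^+ m * (m%:R / n%:R) * pert)))).
    rewrite ler_wpM2l ?exprn_ge0 ?invr_ge0 ?etaX //.
    apply: le_trans (pert_avg nN wP Fu t xu yu c0 zc mn rP hP) _.
    apply: (ler_wpM2l s0); apply: (ler_wpM2r pert0).
    by apply: ler_wpM2r; [rewrite mulr_ge0 ?ler0n | exact: tc].
  rewrite (_ : (eta ^+ 3) ^+ m = (eta ^+ 2) ^+ m * eta ^+ m); last by rewrite -exprMn -exprSr.
  have e2 : (eta ^- 2) ^+ m * (eta ^+ 2) ^+ m = 1.
    by rewrite -exprMn mulVf ?expr1n // expf_neq0 // gt_eqF.
  rewrite [leLHS](_ : _ = (eta ^- 2) ^+ m * (eta ^+ 2) ^+ m * (s * (pert / n%:R) * (m%:R * eta ^+ m))); last by ring.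
  by rewrite e2 mul1r.
rewrite -mulr_sumr [leRHS](_ : _ = e1 * (s * (pert / n%:R) * e1 ^+ 2)); last by ring.
apply: (ler_wpM2l (ltW e10)); apply: ler_wpM2l; first exact: mulr_ge0 s0 (mulr_ge0 pert0 n00).
rewrite [e1 ^+ 2]exprVn; apply: geo2_le eta1; exact: ltW.
Qed.

Definition bad_pairs : {set J} :=
  [set j | `[< exists z, `|z| <= q * rho /\ \det (1%:M + sw (P - z%:M) j) = 0 >]]%SET.

(** Thresholds for Markov's inequality: below [K1] the coefficients and traces satisfy the bounds
    (B+1) rho^-k required by [det_lower_bound], and below [K3] the function [F - f] stays under 1 /
    (2 Q) on the disc by [poly_sup]. *)
Let K1 : C := B.+1%:R ^+ 2.
Let K3 : C := N%:R * (1 - q) * (2 * Q) ^- 2.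

Let Q0 : 0 < Q.
Proof. by rewrite ltr0n bin_gt0 (leq_trans (leq_pred _)) // leq_addl. Qed.

Let K10 : 0 < K1. Proof. by rewrite exprn_gt0 // ltr0n. Qed.

Let q1' : 0 < 1 - q. Proof. by rewrite subr_gt0. Qed.

Let N0 : 0 < N%:R :> C. Proof. by rewrite ltr0n (leq_ltn_trans _ nN). Qed.

Let K30 : 0 < K3.
Proof.
apply: mulr_gt0; first exact: mulr_gt0 N0 q1'.
by rewrite invr_gt0 exprn_gt0 // (mulr_gt0 _ Q0) // ltr0n.
Qed.

Let sandwichN z j : sw (- z%:M) j = (- z) *: sw 1%:M j.
Proof.
rewrite /sw /sandwich (_ : - z%:M = (- z) *: 1%:M); last by rewrite scaleNr scalemx1.
by rewrite -scalemxAr -scalemxAl -scalemxAr.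
Qed.

Let coef_le (A : C) k : 0 <= A -> A ^+ 2 * c ^+ k < K1 -> A <= B.+1%:R * rho^-1 ^+ k.
Proof.
move=> A0 H1; rewrite exprVn ler_pdivlMr ?exprn_gt0 //.
rewrite -(@ler_pXn2r _ 2) ?nnegrE ?ler0n ?mulr_ge0 ?exprn_ge0 ?(ltW rho0) //.
by apply: ltW; apply: le_lt_trans H1; rewrite exprMn -exprM mulnC exprM.
Qed.

(** On the disc |F - f| < 1 / (2 Q) <= |f|, the second inequality being [det_lower_bound]. *)
Lemma good_no_zero j z : ~~ (K1 <= G1 j) -> ~~ (K1 <= G2 j) -> ~~ (K3 <= G3 j) ->
  `|z| <= q * rho -> \det (1%:M + sw (P - z%:M) j) != 0.
Proof.
have tm (A : C) k : 0 <= `|A| ^+ 2 * c ^+ k := mulr_ge0 (exprn_ge0 2 (normr_ge0 A)) (cX k).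
have G1r : 0 <= G1 j by apply: sumr_ge0 => m _; exact: tm.
have G2r : 0 <= G2 j by apply: sumr_ge0 => m _; exact: tm.
have G3r : 0 <= G3 j by apply: sumr_ge0 => m _; rewrite exprn_ge0.
have K1r : K1 \is Num.real by apply/ger0_real/ltW.
have K3r : K3 \is Num.real by apply/ger0_real/ltW.
rewrite -(real_ltNge (ger0_real G1r) K1r) -(real_ltNge (ger0_real G2r) K1r).
rewrite -(real_ltNge (ger0_real G3r) K3r) => H1 H2 H3 zq.
have rv0 : 0 <= rho^-1 by rewrite invr_ge0 ltW.
have emB k : `|em k (sw 1%:M j)| <= B.+1%:R * rho^-1 ^+ k.
  have [kn|nk] := leqP k n; last first.
    rewrite em_rank ?(leq_ltn_trans (rank_leq_row _)) // normr0.
    by rewrite mulr_ge0 ?ler0n ?exprn_ge0.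
  apply: coef_le => //; apply: le_lt_trans H1; have kn' : (k < n.+1)%N by [].
  by rewrite /G1 (bigD1 (Ordinal kn')) //= lerDl sumr_ge0 // => i _; exact: tm.
have trB k : (0 < k < m0)%N -> `|\tr (mxpow (sw 1%:M j) k)| <= B.+1%:R * rho^-1 ^+ k.
  move=> /andP[k0 km]; apply: coef_le => //; apply: le_lt_trans H2.
  by rewrite /G2 (bigD1 (Ordinal km)) //= lerDl sumr_ge0 // => i _; exact: tm.
have zq' : `|z| * rho^-1 <= q by rewrite ler_pdivrMr.
have := det_lower_bound rv0 q0 q1 zq' m0_gt0 emB trB small; rewrite -/Q => lb.
have [p [psz pE]] : exists p : {poly C}, (size p <= N)%N /\ forall z, p.[z] = H j z.
  pose A0 := 1%:M + sw P j.
  have [p1 [s1 E1]] := det_poly (1%:M + sw P j) (- sw 1%:M j).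
  have [p2 [s2 E2]] := det_poly 1%:M (- sw 1%:M j).
  exists (p1 - p2); split.
    apply: leq_trans nN; apply: leq_trans (size_polyD _ _) _.
    by rewrite size_polyN geq_max s1 s2.
  move=> v; rewrite hornerD hornerN E1 E2 /H sumrB.
  rewrite scalerN -scaleNr -sandwichN -!det1em; congr (\det _ - _).
  rewrite -addrA; congr (_ + _).
  by rewrite /sw /sandwich mulmxBr mulmxBl mulmxBr mulmxN mulNmx mulmxN.
have ps : N%:R * (1 - q) * `|H j z| ^+ 2 <= G3 j.
  rewrite -pE; apply: le_trans (poly_sup wP (ltW rho0) q0 q1 psz zq) _.
  by apply: ler_sum => k _; rewrite pE.
have {ps}Hlt : `|H j z| < (2 * Q)^-1.
  rewrite -(@ltr_pXn2r _ 2) ?nnegrE ?invr_ge0 ?mulr_ge0 ?ler0n ?(ltW Q0) //.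
  have := le_lt_trans ps H3; rewrite /K3 ltr_pM2l ?mulr_gt0 //.
  by rewrite exprVn.
have DE : \det (1%:M + sw (P - z%:M) j) = \det (1%:M - z *: sw 1%:M j) + H j z.
  rewrite -scaleNr -sandwichN !det1em /H /a -big_split /=; apply: eq_bigr => m _.
  by rewrite addrCA subrr addr0.
rewrite DE addr_eq0; apply: contraTneq Hlt => E.
by rewrite -normrN -E -real_leNgt ?normr_real // realV ger0_real // mulr_ge0 ?ler0n ?(ltW Q0).
Qed.

Lemma bad_count : #|bad_pairs|%:R <=
  s * ((e1 + (2 * e1 ^+ 2 + R / n%:R)) / K1 +
       e1 ^+ 3 * pert / n%:R * (2 * Q) ^+ 2 / (1 - q)).
Proof.
have tm (A : C) k : 0 <= `|A| ^+ 2 * c ^+ k := mulr_ge0 (exprn_ge0 2 (normr_ge0 A)) (cX k).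
have c1 := markov_count K10 (fun j => sumr_ge0 _ (fun m _ => tm _ _)) G1_sum.
have c2 := markov_count K10 (fun j => sumr_ge0 _ (fun m _ => tm _ _)) G2_sum.
have c3 := markov_count K30 (fun j => sumr_ge0 _ (fun m _ => exprn_ge0 2 (normr_ge0 _))) G3_sum.
set S1 := [set _ | _]%SET in c1; set S2 := [set _ | _]%SET in c2; set S3 := [set _ | _]%SET in c3.
have sub : bad_pairs \subset S1 :|: (S2 :|: S3).
  apply/fintype.subsetP => j; rewrite [_ \in bad_pairs]inE => /asboolP[z [zq D0]]; rewrite !inE.
  apply/negPn/negP; rewrite !negb_or; case/and3P => H1 H2 H3.
  by have := good_no_zero H1 H2 H3 zq; rewrite D0 eqxx.
apply: (@le_trans _ _ (#|S1|%:R + (#|S2|%:R + #|S3|%:R))).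
  rewrite -!natrD ler_nat; apply: leq_trans (subset_leq_card sub) _.
  apply: leq_trans (leq_card_setU _ _) _; rewrite leq_add2l; exact: leq_card_setU.
apply: le_trans (lerD c1 (lerD c2 c3)) _.
rewrite le_eqVlt; apply/orP; left; apply/eqP; rewrite /K3; field.
by rewrite (gt_eqF Q0) (gt_eqF N0) (gt_eqF K10) (gt_eqF q1') pnatr_eq0 -lt0n n0.
Qed.

End count.

(** * Passage to matrices over R[i] and choice of the constants *)

Local Open Scope complex_scope.

(** Truncated negative binomial series: multiplication by 1 - p lowers B by one, up to a boundary
    term of favourable sign. *)
Lemma sum_bin_geo (C : numFieldType) (p : C) B m : 0 < p -> p < 1 ->
  \sum_(i < m) 'C(B + i, i)%:R * p ^+ i <= (1 - p)^-1 ^+ B.+1.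
Proof.
move=> p0 p1; have p1' : 0 < 1 - p by rewrite subr_gt0.
elim: B => [|B IH].
  rewrite expr1; apply: le_trans (geo_le m (ltW p0) p1).
  by apply: ler_sum => i _; rewrite add0n binn mul1r.
rewrite exprS ler_pdivlMl //; apply: le_trans IH.
suff -> : (1 - p) * \sum_(i < m) 'C(B.+1 + i, i)%:R * p ^+ i =
    \sum_(i < m) 'C(B + i, i)%:R * p ^+ i - (if m is m'.+1 then 'C(B + m, m')%:R * p ^+ m else 0).
  by case: m => [|m]; rewrite ?subr0 // gerBl mulr_ge0 ?ler0n ?exprn_ge0 // ltW.
elim: m => [|m IHm]; first by rewrite !big_ord0 mulr0 subr0.
rewrite !big_ord_recr /= mulrDr IHm.
case: m {IHm} => [|m].
  by rewrite !big_ord0 addn0 !bin0 expr0 expr1; ring.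
rewrite addSn (_ : (B + m.+2 = (B + m.+1).+1)%N); last by rewrite addnS.
rewrite binS natrD !exprS; ring.
Qed.

Lemma unitary_conj (C : numClosedFieldType) n (A : 'M[C]_n) : A \is unitarymx -> A ^t* \is unitarymx.
Proof. by rewrite trmxC_unitary. Qed.

Section real.
Variable R : realType.
Local Notation C := R[i].

Lemma cabsE (z : C) : `|z| = (cabs z)%:C.
Proof. by []. Qed.

(** Adjoints of [q] and [q'] multiply [u] and [v], so that the inverses are [u ^t* *m q] and
    [v ^t* *m q'], as in [sandwich]. The other factors taken out of the determinant are
    invertible. *)
Lemma det_perturb n (u v q q' P : 'M[C]_n) (s : 'rV[R]_n) (z : C) :
  u \is unitarymx -> v \is unitarymx -> q \is unitarymx -> q' \is unitarymx ->
  (forall i, s 0 i != 0) ->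
  \det (q ^t* *m u *m diagC s *m (q' ^t* *m v) + P - z%:M) = 0 ->
  \det (1%:M + diag_mx (map_mx (fun a => (a^-1)%:C) s) *m
        (u ^t* *m q *m (P - z%:M) *m (v ^t* *m q'))) = 0.
Proof.
move=> uu vu qu qu' s0.
set t := map_mx _ s; set A := q ^t* *m u; set B := q' ^t* *m v.
have tD : diagC s *m diag_mx t = 1%:M.
  rewrite /diagC mulmx_diag; apply/matrixP => i j; rewrite !mxE.
  case: eqP => [->|_]; last by rewrite !mulr0n.
  by rewrite -rmorphM /= divff // rmorph1.
have AA : A *m (u ^t* *m q) = 1%:M.
  rewrite /A mulmxA -(mulmxA (q ^t*)) (unitarymxP uu) mulmx1.
  by have /unitarymxP := unitary_conj qu; rewrite trmxCK.
have BB : (v ^t* *m q') *m B = 1%:M.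
  rewrite /B mulmxA -(mulmxA (v ^t*)) (unitarymxP qu') mulmx1.
  by have /unitarymxP := unitary_conj vu; rewrite trmxCK.
set g := u ^t* *m q in AA *; set k := v ^t* *m q' in BB *.
clearbody A B g k.
have E : A *m diagC s *m B + P - z%:M =
   (A *m diagC s) *m (1%:M + diag_mx t *m (g *m (P - z%:M) *m k)) *m B.
  rewrite mulmxDr mulmx1 mulmxDl -addrA; congr (_ + _).
  rewrite -!mulmxA BB mulmx1 (mulmxA (diagC s)) tD mul1mx.
  by rewrite mulmxA AA mul1mx.
rewrite E !det_mulmx => /eqP; rewrite !mulf_eq0 -!orbA => /or4P[].
- move=> /eqP dA; have := congr1 determinant AA; rewrite det_mulmx det1 dA mul0r.
  by move=> /esym /eqP; rewrite oner_eq0.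
- move=> /eqP dA; have := congr1 determinant tD; rewrite det_mulmx det1 dA mul0r.
  by move=> /esym /eqP; rewrite oner_eq0.
- by move=> /eqP.
- move=> /eqP dA; have := congr1 determinant BB; rewrite det_mulmx det1 dA mulr0.
  by move=> /esym /eqP; rewrite oner_eq0.
Qed.

Lemma hs_col n (x : 'cV[C]_n) : hs x = ((l2norm x) ^+ 2)%:C.
Proof.
rewrite /l2norm sqr_sqrtr; last by apply: sumr_ge0 => i _; exact: sqr_ge0.
rewrite /hs rmorph_sum; apply: eq_bigr => i _.
by rewrite big_ord1 rmorphXn.
Qed.

Lemma opnorm_ub n (A : 'M[C]_n) (x : 'cV[C]_n) : l2norm x <= 1 -> l2norm (A *m x) <= opnorm A.
Proof.
move=> x1; apply: ub_le_sup; last by exists x.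
(* A supremum is an upper bound only of a bounded set; the Hilbert-Schmidt norm supplies the
   bound. *)
exists (Num.sqrt (cabs (hs A))) => _ [y y1 <-].
have yn : 0 <= l2norm y by exact: sqrtr_ge0.
rewrite -[leLHS]ger0_norm ?sqrtr_ge0 // -sqrtr_sqr ler_wsqrtr //.
rewrite -lecR -hs_col -cabsE ger0_norm ?hs_ge0 //.
apply: le_trans (hs_mul _ _) _; rewrite ler_piMr ?hs_ge0 // hs_col lecR.
by rewrite exprn_ile1.
Qed.

Lemma hs_opnorm n (A : 'M[C]_n) r (K : R) : (\rank A <= r)%N -> opnorm A <= K ->
  hs A <= (r%:R * K ^+ 2)%:C.
Proof.
move=> rA AK; have K0 : 0 <= K.
  apply: le_trans AK; apply: le_trans (opnorm_ub A (x := 0) _); first exact: sqrtr_ge0.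
  rewrite /l2norm big1 ?sqrtr0 // => i _.
  by rewrite mxE ComplexField.Normc.normc0 expr0n.
apply: (@le_trans _ _ ((\rank A)%:R * (K ^+ 2)%:C)).
  apply: hs_le_rank => x; rewrite !hs_col lecR => x1; rewrite lecR.
  have x1' : l2norm x <= 1.
    by rewrite -[leLHS]ger0_norm ?sqrtr_ge0 // -[1 : R]sqrtr1 -sqrtr_sqr ler_wsqrtr.
  by rewrite lerXn2r ?nnegrE ?sqrtr_ge0 // (le_trans (opnorm_ub _ x1')).
rewrite [leRHS]rmorphM rmorph_nat; apply: ler_wpM2r; last by rewrite ler_nat.
by rewrite ler0c exprn_ge0.
Qed.

End real.

Section constants.
Variable R : realType.
Local Notation C := R[i].

Lemma expr_small_ex (x e : R) : 0 <= x -> x < 1 -> 0 < e -> exists k, x ^+ k.+1 <= e.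
Proof.
move=> x0 x1 e0; have x1' : 0 < 1 - x by rewrite subr_gt0.
have d0 : 0 <= (1 - x)^-2 by rewrite invr_ge0 exprn_ge0 // ltW.
exists (Num.bound ((1 - x)^-2 / e)); set k := Num.bound _.
have := archi_boundP (divr_ge0 d0 (ltW e0)); rewrite -/k ltr_pdivrMr // => kb.
have := geo2_le k.+2 x0 x1; rewrite big_ord_recr /= => H.
have H2 : k.+1%:R * x ^+ k.+1 <= (1 - x)^-2.
  by apply: le_trans H; rewrite lerDr sumr_ge0 // => i _; rewrite mulr_ge0 ?exprn_ge0.
rewrite -(@ler_pM2l _ k.+1%:R) ?ltr0n //; apply: (le_trans H2); apply: (le_trans (ltW kb)).
by rewrite ler_wpM2r ?ler_nat // ltW.
Qed.

Lemma small_tail_ex (q : R) B : 0 <= q -> q < 1 -> exists m0, (0 < m0)%N /\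
  B.+1%:R * 'C(B + m0, m0.-1)%:R * q ^+ m0 <= (1 - q) / 2.
Proof.
(* With p between q and 1, the binomial times p^m0 is bounded by [sum_bin_geo], and the factor
   (q/p)^m0 makes the product small. *)
move=> q0 q1; pose p : R := (1 + q) / 2.
have p0 : 0 < p by rewrite /p; lra.
have p1 : p < 1 by rewrite /p; lra.
have qp : q / p < 1 by rewrite ltr_pdivrMr // /p; lra.
have qp0 : 0 <= q / p by rewrite divr_ge0 // ltW.
pose D : R := B.+1%:R * (1 - p)^-1 ^+ B.+1.
have D0 : 0 < D by rewrite mulr_gt0 ?ltr0n // exprn_gt0 // invr_gt0; lra.
have e0 : 0 < (1 - q) / 2 / D by rewrite divr_gt0 // divr_gt0 // subr_gt0.
have [k H] := expr_small_ex qp0 qp e0.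
exists k.+1; split=> //=.
have S : 'C(B + k.+1, k)%:R * p ^+ k.+1 <= (1 - p)^-1 ^+ B.+1.
  apply: le_trans (sum_bin_geo B k.+1 p0 p1).
  rewrite -sum_bin_diag natr_sum mulr_suml; apply: ler_sum => i _.
  by rewrite ler_wpM2l ?ler0n // ler_wiXn2l // ?ltW // ltnW.
rewrite ler_pdivlMr // in H.
have pk : 0 < p ^+ k.+1 by rewrite exprn_gt0.
have -> : q ^+ k.+1 = p ^+ k.+1 * (q / p) ^+ k.+1.
  by rewrite -exprMn mulrC divfK // gt_eqF.
apply: le_trans H; move: S; set X := (q / p) ^+ k.+1; set Y := p ^+ k.+1; set Z := 'C(_, _)%:R => S.
have -> : B.+1%:R * Z * (Y * X) = X * (B.+1%:R * (Z * Y)) by ring.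
by rewrite /D !ler_wpM2l ?ler0n ?exprn_ge0.
Qed.

Lemma sqr_norm_real (x : R) : `|x%:C| ^+ 2 = (x ^+ 2)%:C :> C.
Proof. by rewrite -add_Re2_Im2 /= expr0n addr0. Qed.

End constants.

Lemma card_set_le (J : finType) (p q : pred J) : (forall j, p j -> q j) ->
  (#|[set j | p j]%SET| <= #|[set j | q j]%SET|)%N.
Proof.
move=> pq; apply/subset_leq_card/fintype.subsetP => j.
by rewrite !inE; exact: pq.
Qed.

Lemma family_bound (R : realType) (r : nat) (K M' a rad eps : R) :
  0 < rad -> rad < a -> 0 < eps ->
  exists (eta' : R) (n1 : nat), 0 < eta' /\ forall n, (n1 <= n)%N ->
  exists (J : finType) (q q' : J -> 'M[R[i]]_n),
  [/\ (0 < #|J|)%N, forall j, q j \is unitarymx, forall j, q' j \is unitarymx &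
  forall (u v P : 'M[R[i]]_n) (s : 'rV[R]_n),
    u \is unitarymx -> v \is unitarymx ->
    (forall i, s 0 i != 0) -> (forall i, `|(s 0 i)^-1| <= M') ->
    n%:R^-1 * \sum_i (s 0 i) ^- 2 <= a ^- 2 + eta' ->
    (\rank P <= r)%N -> opnorm P <= K ->
    #|[set j | `[< exists z, cabs z < rad /\
        \det (q j *m u *m diagC s *m (q' j *m v) + P - z%:M) = 0 >]]%SET|%:R <= eps * #|J|%:R].
Proof.
move=> rad0 rada eps0; have a0 : 0 < a by apply: lt_trans rada.
pose rhoR : R := (rad + a) / 2.
have rho0 : 0 < rhoR by rewrite /rhoR; lra.
have rhoa : rhoR < a by rewrite /rhoR; lra.
have radrho : rad < rhoR by rewrite /rhoR; lra.
pose qR : R := rad / rhoR.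
have qR0 : 0 <= qR by rewrite divr_ge0 // ltW.
have qR1 : qR < 1 by rewrite ltr_pdivrMr // mul1r.
(* This puts a^-2 + eta' halfway between a^-2 and rho^-2, so that its product [theta] with rho^2 is
   below 1. *)
pose eta' : R := (rhoR ^- 2 - a ^- 2) / 2.
have eta'0 : 0 < eta'.
  rewrite divr_gt0 // subr_gt0 ltf_pV2 ?posrE ?exprn_gt0 //.
  by rewrite ltrXn2r // ?nnegrE ltW.
pose theta : R := (a ^- 2 + eta') * rhoR ^+ 2.
have theta0 : 0 < theta.
  by rewrite mulr_gt0 ?exprn_gt0 // addr_gt0 // invr_gt0 exprn_gt0.
have theta1 : theta < 1.
  have r2 : 0 < rhoR ^+ 2 by rewrite exprn_gt0.
  rewrite -(@ltr_pM2r _ (rhoR ^- 2)) ?invr_gt0 // /theta mulfK ?gt_eqF // mul1r /eta'.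
  by move: eta'0; rewrite /eta'; lra.
(* The arithmetic mean of theta, 1 and 1 is still below 1 and dominates their geometric mean, the
   cube root of theta. *)
pose etaR : R := (theta + 2) / 3.
have etaR0 : 0 < etaR by rewrite /etaR; lra.
have etaR1 : etaR < 1 by rewrite /etaR; lra.
have eta3 : theta <= etaR ^+ 3.
  rewrite -subr_ge0 (_ : _ - _ = (1 - theta) ^+ 2 * (theta + 8) / 27); last by rewrite /etaR; field.
  by rewrite divr_ge0 // mulr_ge0 ?sqr_ge0 // addr_ge0 // ltW.
have qrho : qR * rhoR = rad by rewrite /qR divfK // gt_eqF.
clearbody qR etaR.
pose e1 : R[i] := (1 - etaR%:C)^-1.
pose A1 : R[i] := e1 + 2 * e1 ^+ 2.
(* [A1] collects the terms of [bad_count] without 1/n; only the threshold (B+1)^2 makes them small.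
   Hence B is chosen from eps, then m0 from B and q, and n last. *)
pose B := Num.bound (2 * cabs A1 / eps).
have cge0 (z : R[i]) : 0 <= cabs z by rewrite -ler0c -cabsE normr_ge0.
have HB : cabs A1 / B.+1%:R ^+ 2 <= eps / 2.
  have := archi_boundP (x := 2 * cabs A1 / eps); rewrite divr_ge0 ?mulr_ge0 ?ler0n ?(ltW eps0) //.
  move=> /(_ isT); rewrite -/B ltr_pdivrMr // => HB.
  rewrite ler_pdivrMr ?exprn_gt0 ?ltr0n //.
  have B1 : B%:R <= B.+1%:R ^+ 2 :> R.
    by rewrite -natrX ler_nat -mulnn (leq_trans (leqnSn B)) // leq_pmulr.
  have : B%:R * eps <= B.+1%:R ^+ 2 * eps by rewrite ler_wpM2r // ltW.
  lra.
have [m0 [m00 small]] := small_tail_ex B qR0 qR1.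
pose c : R[i] := rhoR%:C ^+ 2.
pose Rr : R[i] := \sum_(k < m0) 4 * (k`!)%:R ^+ 2 * ((M' ^+ 2)%:C * c) ^+ k * k%:R ^+ 2.
pose pert := pert_const r ((r%:R * K ^+ 2)%:C : R[i]) c.
pose Q : R[i] := 'C(B + m0, m0.-1)%:R.
(* The terms of [bad_count] that carry 1/n, with this factor removed; nothing here depends on n. *)
pose Y : R[i] := Rr / B.+1%:R ^+ 2 + e1 ^+ 3 * pert * (2 * Q) ^+ 2 / (1 - qR%:C).
pose n2 := Num.bound (2 * cabs Y / eps).
exists eta', (maxn m0 n2).+1; split => // n nn.
have n0 : (0 < n)%N by apply: leq_trans nn.
have mn : (m0 <= n)%N by apply: leq_trans nn; rewrite leqW // leq_maxl.
have n2n : (n2 <= n)%N by apply: leq_trans nn; rewrite leqW // leq_maxr.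
have HY : cabs Y / n%:R <= eps / 2.
  have := archi_boundP (x := 2 * cabs Y / eps); rewrite divr_ge0 ?mulr_ge0 ?ler0n ?(ltW eps0) //.
  move=> /(_ isT); rewrite -/n2 ltr_pdivrMr // => HY.
  rewrite ler_pdivrMr ?ltr0n //.
  have : n2%:R * eps <= n%:R * eps by rewrite ler_wpM2r ?ler_nat // ltW.
  lra.
have [w wP] := prim_root_ex R[i] (ltn0Sn n).
have [F [Fu Fflat]] := flat_unitary_ex R[i] n0.
have wu := qmx_unitary wP Fu.
exists (fam n n.+1 * fam n n.+1)%type, (fun j => (qmx w F j.1) ^t*), (fun j => (qmx w F j.2) ^t*).
split.
- rewrite card_prod !card_fam.
  by rewrite muln_gt0 !muln_gt0 !expn_gt0 fact_gt0.
- by move=> j; exact: unitary_conj (wu _).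
- by move=> j; exact: unitary_conj (wu _).
move=> u v P s uu vu s0 sM sa rP PK.
pose t : 'rV[R[i]]_n := map_mx (fun a => (a^-1)%:C) s.
have tE i : `|t 0 i| ^+ 2 = ((s 0 i) ^- 2)%:C by rewrite mxE sqr_norm_real exprVn.
have tM i : `|t 0 i| ^+ 2 <= (M' ^+ 2)%:C.
  rewrite tE lecR -exprVn -[leLHS]ger0_norm ?sqr_ge0 // normrX lerXn2r ?nnegrE //.
  exact: le_trans (sM i).
have rho0C : 0 < rhoR%:C :> R[i] by rewrite ltcR.
have tau_eta : n%:R^-1 * (\sum_i `|t 0 i| ^+ 2) * rhoR%:C ^+ 2 <= etaR%:C ^+ 3.
  rewrite (eq_bigr _ (fun i _ => tE i)) -rmorph_sum -!rmorphXn -(rmorph_nat (real_complex R)) -fmorphV -!rmorphM lecR.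
  apply: le_trans eta3; rewrite /theta ler_wpM2r ?exprn_ge0 ?(ltW rho0) //.
have smallC : B.+1%:R * 'C(B + m0, m0.-1)%:R * qR%:C ^+ m0 <= (1 - qR%:C) / 2.
  have := small; rewrite -lecR !rmorphM /= fmorphV rmorphB !rmorph_nat rmorph1 rmorphXn; apply.
have etaC0 : 0 < etaR%:C :> R[i] by rewrite ltcR.
have etaC1 : etaR%:C < 1 :> R[i] by rewrite -(rmorph1 (real_complex R)) ltcR.
have qC0 : 0 <= qR%:C :> R[i] by rewrite lecR.
have qC1 : qR%:C < 1 :> R[i] by rewrite -(rmorph1 (real_complex R)) ltcR.
have := bad_count n0 (ltnSn n) wP Fu Fflat (unitary_conj uu) (unitary_conj vu) rP
  (hs_opnorm rP PK) tM etaC0 etaC1 rho0C qC0 qC1 tau_eta m00 (leqW mn) smallC.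
rewrite /bad_pairs => bc; set T := (X in X <= _) in bc.
rewrite -lecR rmorphM /= !rmorph_nat card_prod mulnn.
suff TX : T <= eps%:C * (#|{: fam n n.+1}| ^ 2)%:R.
  apply: le_trans TX; rewrite /T ler_nat; apply: card_set_le => j /asboolP[z [zr D0]].
  apply/asboolP; exists z; split; last exact: (det_perturb uu vu (wu _) (wu _) s0 D0).
  by rewrite -rmorphM /= qrho cabsE lecR ltW.
have q1C : 1 - qR%:C != 0 by rewrite subr_eq0 eq_sym lt_eqF.
have nC : n%:R != 0 :> R[i] by rewrite pnatr_eq0 -lt0n.
have BC : B.+1%:R != 0 :> R[i] by rewrite pnatr_eq0.
set X := (X in _ <= _ * X) in bc.
have XE : X = A1 / B.+1%:R ^+ 2 + Y / n%:R.
  rewrite /X /A1 /Y /Rr /pert /Q -/c -/e1; set Z := \sum_(k < m0) _.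
  set pc := pert_const _ _ _; set Q' := 'C(_, _)%:R.
  by clear -q1C nC BC; field; rewrite q1C nC BC.
have bX : 0 <= (#|{: fam n n.+1}| ^ 2)%:R * X by apply: le_trans bc; rewrite /T ler0n.
apply: (le_trans bc); rewrite -(ger0_norm bX) normrM normr_nat mulrC ler_wpM2r ?ler0n //.
rewrite XE; apply: le_trans (ler_normD _ _) _.
rewrite !normrM !normfV normrX !normr_nat !cabsE.
rewrite (_ : eps%:C = (eps / 2)%:C + (eps / 2)%:C); last by rewrite -rmorphD -splitr.
have lift (x y : R) (k : R[i]) (k' : R) : k = k'%:C -> x / k' <= y -> x%:C / k <= y%:C.
  by move=> -> H; rewrite -fmorphV -rmorphM lecR.
apply: lerD; first by apply: lift HB; rewrite rmorphXn rmorph_nat.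
by apply: lift HY; rewrite rmorph_nat.
Qed.

(** * Measurability, laws and probabilities *)

Local Close Scope sesquilinear_scope.
Local Open Scope classical_set_scope.
Local Open Scope ring_scope.

Section complex_measurable_functions.
Variable R : realType.
Context d (T : measurableType d).

Definition cmeas (f : T -> R[i]) : Prop :=
  measurable_fun setT (fun w => complex.Re (f w)) /\ measurable_fun setT (fun w => complex.Im (f w)).

Lemma measurable_Re : measurable_fun setT (@complex.Re R : R[i] -> R).
Proof.
move=> _ B mB; apply: sub_sigma_algebra; left; exists B => //.
Qed.

Lemma measurable_Im : measurable_fun setT (@complex.Im R : R[i] -> R).
Proof.
move=> _ B mB; apply: sub_sigma_algebra; right; exists B => //.
Qed.

Lemma cmeasP (f : T -> R[i]) : measurable_fun setT f <-> cmeas f.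
Proof.
split=> [mf|[mr mi]].
  by split; [apply: measurableT_comp measurable_Re mf | apply: measurableT_comp measurable_Im mf].
apply: (measurability (preimage_set_system setT (@complex.Re R) measurable `|`
   preimage_set_system setT (@complex.Im R) measurable)) => //.
move=> _ [_ [[B mB <-]|[B mB <-]] <-]; rewrite !setTI.
  by rewrite -[X in measurable X]setTI; exact: mr.
by rewrite -[X in measurable X]setTI; exact: mi.
Qed.

Lemma cmeas_cst (z : R[i]) : cmeas (fun=> z).
Proof. by split; exact: measurable_cst. Qed.

Lemma cmeasD f g : cmeas f -> cmeas g -> cmeas (fun w => f w + g w).
Proof.
move=> [fr fi] [gr gi]; split.
- rewrite (_ : (fun w => _) = (fun w => complex.Re (f w) + complex.Re (g w))).
    exact: measurable_funD.
  by apply/funext => w; case: (f w) (g w) => [? ?] [? ?].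
- rewrite (_ : (fun w => _) = (fun w => complex.Im (f w) + complex.Im (g w))).
    exact: measurable_funD.
  by apply/funext => w; case: (f w) (g w) => [? ?] [? ?].
Qed.

Lemma cmeasM f g : cmeas f -> cmeas g -> cmeas (fun w => f w * g w).
Proof.
move=> [fr fi] [gr gi]; split.
- rewrite (_ : (fun w => _) = (fun w => complex.Re (f w) * complex.Re (g w) - complex.Im (f w) * complex.Im (g w))).
    by apply: measurable_funB; exact: measurable_funM.
  by apply/funext => w; case: (f w) (g w) => [? ?] [? ?].
- rewrite (_ : (fun w => _) = (fun w => complex.Re (f w) * complex.Im (g w) + complex.Im (f w) * complex.Re (g w))).
    by apply: measurable_funD; exact: measurable_funM.
  by apply/funext => w; case: (f w) (g w) => [? ?] [? ?].
Qed.

Lemma cmeas_sum I (s : seq I) (P : pred I) (f : I -> T -> R[i]) :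
  (forall k, cmeas (f k)) -> cmeas (fun w => \sum_(k <- s | P k) f k w).
Proof.
move=> mf; elim: s => [|k s IH].
  by rewrite (_ : (fun w => _) = (fun=> 0)); [exact: cmeas_cst | apply/funext => w; rewrite big_nil].
rewrite (_ : (fun w => _) = (fun w => if P k then f k w + \sum_(j <- s | P j) f j w else \sum_(j <- s | P j) f j w)).
  by case: (P k) => //; exact: cmeasD.
by apply/funext => w; rewrite big_cons.
Qed.

Lemma cmeas_prod I (s : seq I) (P : pred I) (f : I -> T -> R[i]) :
  (forall k, cmeas (f k)) -> cmeas (fun w => \prod_(k <- s | P k) f k w).
Proof.
move=> mf; elim: s => [|k s IH].
  by rewrite (_ : (fun w => _) = (fun=> 1)); [exact: cmeas_cst | apply/funext => w; rewrite big_nil].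
rewrite (_ : (fun w => _) = (fun w => if P k then f k w * \prod_(j <- s | P j) f j w else \prod_(j <- s | P j) f j w)).
  by case: (P k) => //; exact: cmeasM.
by apply/funext => w; rewrite big_cons.
Qed.

Lemma cmeas_real (f : T -> R) : measurable_fun setT f -> cmeas (fun w => real_complex R (f w)).
Proof. by move=> mf; split => //=; exact: measurable_cst. Qed.

Lemma cmeas_mulmx m n p (A : T -> 'M[R[i]]_(m, n)) (B : T -> 'M[R[i]]_(n, p)) :
  (forall i j, cmeas (fun w => A w i j)) -> (forall i j, cmeas (fun w => B w i j)) ->
  forall i j, cmeas (fun w => (A w *m B w) i j).
Proof.
move=> mA mB i j; rewrite (_ : (fun w => _) = (fun w => \sum_k A w i k * B w k j)).
  by apply: cmeas_sum => k; exact: cmeasM.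
by apply/funext => w; rewrite mxE.
Qed.

Lemma cmeas_det n (A : T -> 'M[R[i]]_n) :
  (forall i j, cmeas (fun w => A w i j)) -> cmeas (fun w => \det (A w)).
Proof.
move=> mA; apply: cmeas_sum => s; apply: cmeasM; first exact: cmeas_cst.
exact: cmeas_prod.
Qed.

End complex_measurable_functions.

Section matrix_measurable_functions.
Context d d' (T : measurableType d) (T' : measurableType d') (m n : nat).

Lemma measurable_entry i j : measurable_fun setT (fun A : 'M[T']_(m, n) => A i j).
Proof.
move=> _ B mB; apply: sub_sigma_algebra; exists (i, j) => //; exists B => //.
Qed.

Lemma measurable_matrixP (f : T -> 'M[T']_(m, n)) :
  measurable_fun setT f <-> forall i j, measurable_fun setT (fun w => f w i j).
Proof.
split=> [mf i j|mf]; first exact: measurableT_comp (measurable_entry i j) mf.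
apply: (measurability (\bigcup_(ij in [set: 'I_m * 'I_n])
        preimage_set_system setT (fun A : 'M[T']_(m, n) => A ij.1 ij.2) measurable)) => //.
move=> _ [_ [[i j] _ [B mB <-]] <-]; rewrite !setTI /=.
by rewrite -[X in measurable X]setTI; exact: mf.
Qed.

End matrix_measurable_functions.

Lemma measurable_mulmxl (R : realType) n (W : 'M[R[i]]_n) : measurable_fun setT (mulmx W : 'M[R[i]]_n -> 'M[R[i]]_n).
Proof.
apply/measurable_matrixP => i j; apply/cmeasP.
apply: (cmeas_mulmx (A := fun=> W) (B := id)) => [k l|k l]; first exact: cmeas_cst.
by apply/cmeasP; exact: measurable_entry.
Qed.

Section small_eigenvalue.
Variable R : realType.

Lemma cabs_ge0 (z : R[i]) : 0 <= cabs z.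
Proof. by rewrite -ler0c; exact: (normr_ge0 z). Qed.

Lemma cabs_sqr (z : R[i]) : cabs z ^+ 2 = complex.Re z ^+ 2 + complex.Im z ^+ 2.
Proof. by case: z => x y; rewrite /= sqr_sqrtr // addr_ge0 // sqr_ge0. Qed.

Lemma cabs_triangle (z v : R[i]) : cabs (z + v) <= cabs z + cabs v.
Proof. by have := ler_normD z v; rewrite -[`|z|]/((cabs z)%:C) -[`|v|]/((cabs v)%:C) -rmorphD lecR. Qed.

Lemma cabsN (z : R[i]) : cabs (- z) = cabs z.
Proof. by case: z => x y; rewrite /= !sqrrN. Qed.

Lemma cabs_prod (s : seq R[i]) (f : R[i] -> R[i]) :
  cabs (\prod_(l <- s) f l) = \prod_(l <- s) cabs (f l).
Proof.
elim: s => [|l s IH]; first by rewrite !big_nil ComplexField.Normc.normc1.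
by rewrite !big_cons ComplexField.Normc.normcM IH.
Qed.

Lemma char_poly_eigenvalues n (A : 'M[R[i]]_n) :
  char_poly A = \prod_(l <- eigenvalues A) ('X - l%:P).
Proof.
rewrite /eigenvalues; case: closed_field_poly_normal => s /= {1}->.
by rewrite (monicP (char_poly_monic A)) scale1r.
Qed.

Lemma size_eigenvalues n (A : 'M[R[i]]_n) : size (eigenvalues A) = n.
Proof.
have := size_char_poly A; rewrite char_poly_eigenvalues size_prod_XsubC.
by case.
Qed.

Lemma horner_char_poly n (A : 'M[R[i]]_n) z : (char_poly A).[z] = \det (z%:M - A).
Proof.
rewrite /char_poly -horner_evalE -det_map_mx; congr (\det _).
apply/matrixP => i j; rewrite !mxE /= horner_evalE hornerD hornerN hornerC.
by case: eqP => _; rewrite ?hornerX ?horner0 ?hornerMn ?hornerX.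
Qed.

Lemma cabs_det n (A : 'M[R[i]]_n) z :
  cabs (\det (A - z%:M)) = \prod_(l <- eigenvalues A) cabs (z - l).
Proof.
rewrite -opprB -scaleN1r detZ ComplexField.Normc.normcM -horner_char_poly.
rewrite char_poly_eigenvalues horner_prod cabs_prod.
have -> : cabs ((-1) ^+ n : R[i]) = 1.
  elim: n {A} => [|n IH]; first by rewrite expr0 ComplexField.Normc.normc1.
  by rewrite exprS ComplexField.Normc.normcM IH cabsN ComplexField.Normc.normc1 mulr1.
by rewrite mul1r; apply: eq_bigr => l _; rewrite hornerXsubC.
Qed.

Lemma det_eigenvalue n (A : 'M[R[i]]_n) z : (\det (A - z%:M) == 0) = (z \in eigenvalues A).
Proof.
rewrite -root_prod_XsubC -char_poly_eigenvalues rootE horner_char_poly.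
by rewrite -opprB -scaleN1r detZ mulf_eq0 expf_eq0 oppr_eq0 oner_eq0 andbF.
Qed.

Lemma rat_dense (z : R[i]) (e : R) : 0 < e ->
  exists p q : rat, cabs (Complex (ratr p) (ratr q) - z) < e.
Proof.
move=> e0; have e2 : 0 < e / 2 by rewrite divr_gt0.
have H (x : R) : exists p : rat, `|ratr p - x| < e / 2.
  have [|p] := @rat_in_itvoo R (x - e / 2) (x + e / 2); first by lra.
  rewrite in_itv /= => /andP[p1 p2]; exists p; rewrite ltr_norml; lra.
have [p Hp] := H (complex.Re z); have [q Hq] := H (complex.Im z); exists p, q.
case: z Hp Hq => x y /= Hp Hq.
apply: le_lt_trans (_ : cabs (Complex (ratr p - x) 0 + Complex 0 (ratr q - y)) < _).
  by rewrite -[X in _ <= cabs X]/(Complex (_ + 0) (0 + _)) addr0 add0r.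
apply: le_lt_trans (cabs_triangle _ _) _.
by rewrite /= !expr0n /= addr0 add0r !sqrtr_sqr; lra.
Qed.

Definition smallev n (rad : R) (A : 'M[R[i]]_n) : Prop :=
  exists z, cabs z < rad /\ \det (A - z%:M) = 0.

(* A determinant without zeros in the disc is bounded below on smaller discs, so zeros are
   detected by its values at rational points. *)
Lemma smallev_rat n (rad : R) (A : 'M[R[i]]_n) : smallev rad A <->
  exists m : nat, forall l : nat, exists p q : rat,
    cabs (Complex (ratr p) (ratr q)) < rad - m.+1%:R^-1 /\
    cabs (\det (A - (Complex (ratr p) (ratr q))%:M)) ^+ 2 < l.+1%:R^-1.
Proof.
split=> [[z [zr /eqP D0]]|[m Hm]]; last first.
  apply: contrapT => nz.
  have far l : l \in eigenvalues A -> rad <= cabs l.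
    move=> lA; rewrite leNgt; apply/negP => lr; apply: nz; exists l; split=> //.
    by apply/eqP; rewrite det_eigenvalue.
  (* Every eigenvalue is at distance at least 1/(m+1) from the rational point, so the determinant
     has modulus at least (m+1)^-n; this index makes 1/(l+1) the square of that bound. *)
  have [p [q [Hr]]] := Hm ((m.+1 ^ n) ^ 2).-1.
  rewrite prednK ?expn_gt0 //; apply/negP; rewrite -leNgt cabs_det.
  set z := Complex _ _ in Hr *.
  have m0 : 0 < m.+1%:R^-1 :> R by rewrite invr_gt0 ltr0n.
  have H : m.+1%:R^-1 ^+ n <= \prod_(l <- eigenvalues A) cabs (z - l).
    rewrite -[in leLHS](size_eigenvalues A).
    elim: (eigenvalues A) far => [|l s IH] far; first by rewrite big_nil expr0.
    rewrite big_cons [size _]/= exprS; apply: ler_pM => //.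
    - have := cabs_triangle (l - z) z; rewrite subrK -[cabs (l - z)]cabsN opprB.
      have := far l (mem_head _ _); move: Hr; clearbody z.
      move: (cabs l) (cabs z) (cabs (z - l)) (m.+1%:R^-1) => x1 x2 x3 x4 h1 h2 h3; lra.
    - by apply: IH => k ks; apply: far; rewrite in_cons ks orbT.
  by rewrite !natrX -!exprVn lerXn2r // nnegrE ?exprn_ge0 ?(ltW m0) // (le_trans _ H) // exprn_ge0 // ltW.
have [m Hm'] : exists m : nat, m.+1%:R^-1 < (rad - cabs z) / 2.
  have c0 : 0 < (rad - cabs z) / 2 by lra.
  exists (Num.bound ((rad - cabs z) / 2)^-1); rewrite invf_plt ?posrE ?ltr0n //.
  apply: lt_le_trans (archi_boundP _) _; first by rewrite invr_ge0 ltW.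
  by rewrite ler_nat.
exists m => l; set E := \prod_(k <- eigenvalues A) (1 + cabs z + cabs k).
have E1 : 1 <= E.
  rewrite /E; elim: (eigenvalues A) => [|k s IH]; first by rewrite big_nil.
  rewrite big_cons -[leLHS]mul1r; apply: ler_pM => //.
  by rewrite -addrA lerDl addr_ge0 // cabs_ge0.
have E0 : 0 < E by exact: lt_le_trans E1.
have l0 : 0 < l.+1%:R^-1 :> R by rewrite invr_gt0 ltr0n.
have l1 : l.+1%:R^-1 <= 1 :> R by rewrite invf_le1 ?ltr0n // ler1n.
(* The rational point is close enough to stay in the smaller disc, and close enough to [z] that the
   factor of the eigenvalue [z], times the bound [E] for the other factors, is below 1/(l+1). *)
pose e : R := Num.min ((rad - cabs z) / 2) (l.+1%:R^-1 / E).
have zr2 : 0 < (rad - cabs z) / 2 by rewrite divr_gt0 // subr_gt0.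
have e0 : 0 < e by rewrite lt_min zr2 divr_gt0.
have [p [q]] := rat_dense z e0; set v := Complex _ _; rewrite lt_min => /andP[v1 v2].
have v3 : cabs v <= cabs (v - z) + cabs z by have := cabs_triangle (v - z) z; rewrite subrK.
have vz1 : cabs (v - z) <= 1.
  apply: le_trans (ltW v2) _; rewrite ler_pdivrMr // mul1r; exact: le_trans E1.
exists p, q; rewrite -/v; split.
  clear -v1 v3 Hm'; clearbody v; move: v1 v3 Hm'.
  by move: (cabs v) (cabs z) (cabs (v - z)) (m.+1%:R^-1) => x1 x2 x3 x4 *; lra.
suff D : cabs (\det (A - v%:M)) < l.+1%:R^-1.
  apply: (le_lt_trans _ D); rewrite expr2 -[leRHS]mul1r ler_wpM2r ?cabs_ge0 //.
  exact: le_trans (ltW D) l1.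
rewrite cabs_det.
apply: le_lt_trans (_ : cabs (v - z) * E < _); last by rewrite -ltr_pdivlMr.
have : z \in eigenvalues A by rewrite -det_eigenvalue.
rewrite /E; move=> zA.
rewrite (big_rem z zA) /= [leRHS]mulrC (big_rem z zA) /= [leRHS]mulrC.
apply: ler_wpM2l; first exact: cabs_ge0.
set s := rem z _; apply: le_trans (_ : \prod_(k <- s) (1 + cabs z + cabs k) <= _).
  elim: s => [|k s IH]; first by rewrite !big_nil.
  rewrite !big_cons; apply: ler_pM => //; first exact: cabs_ge0.
    by elim: (s) => [|? ? ?]; rewrite ?big_nil ?ler01 // big_cons mulr_ge0 // cabs_ge0.
  have := cabs_triangle v (- k); rewrite cabsN => H; lra.
rewrite ler_peMl //; last by have := cabs_ge0 z; lra.
by apply: prodr_ge0 => k _; have := cabs_ge0 z; have := cabs_ge0 k; lra.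
Qed.

End small_eigenvalue.

Lemma measurable_inv (R : realType) : measurable_fun setT (GRing.inv : R -> R).
Proof.
have -> : [set: R] = [set 0] `|` [set x | x != 0].
  by apply/seteqP; split=> x //= _; case: (eqVneq x 0) => [->|?]; [left|right].
have E : [set x : R | x != 0] = ~` [set 0].
  by apply/seteqP; split=> x /=; [move/eqP | move=> ?; apply/eqP].
have mN : measurable [set x : R | x != 0] by rewrite E; apply: measurableC.
apply/measurable_funU => //; split; first exact: measurable_fun_set1.
apply: open_continuous_measurable_fun.
  by rewrite E; apply: closed_openC; exact: closed_eq.
by move=> x; rewrite inE /= => x0; exact: inv_continuous.
Qed.

Lemma measurable_lt_set d (T : measurableType d) (R : realType) (f : T -> R) (c : R) :
  measurable_fun setT f -> measurable [set w | f w < c].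
Proof.
move=> mf; have := mf measurableT _ (measurable_itv `]-oo, c[).
by rewrite setTI (_ : _ @^-1` _ = [set w | f w < c]) //; apply/seteqP; split=> w /=; rewrite in_itv.
Qed.

Lemma measurable_gt_set d (T : measurableType d) (R : realType) (f : T -> R) (c : R) :
  measurable_fun setT f -> measurable [set w | c < f w].
Proof.
move=> mf; have := mf measurableT _ (measurable_itv `]c, +oo[).
by rewrite setTI (_ : _ @^-1` _ = [set w | c < f w]) //; apply/seteqP; split=> w /=; rewrite in_itv /= andbT.
Qed.

Section smallev_measurable.
Variable R : realType.
Context d (T : measurableType d).

Lemma measurable_cabs_sqr (f : T -> R[i]) : cmeas f -> measurable_fun setT (fun w => cabs (f w) ^+ 2).
Proof.
move=> [fr fi]; rewrite (_ : (fun w => _) = (fun w => complex.Re (f w) ^+ 2 + complex.Im (f w) ^+ 2)).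
  by apply: measurable_funD; exact: measurable_funX.
by apply/funext => w; rewrite cabs_sqr.
Qed.

Lemma measurable_smallev n rad (A : T -> 'M[R[i]]_n) :
  (forall i j, cmeas (fun w => A w i j)) -> measurable [set w | smallev rad (A w)].
Proof.
move=> mA.
pose F (m l : nat) (p q : rat) := [set w | cabs (Complex (ratr p) (ratr q) : R[i]) < rad - m.+1%:R^-1 /\
    cabs (\det (A w - (Complex (ratr p) (ratr q))%:M)) ^+ 2 < l.+1%:R^-1].
rewrite (_ : [set w | _] = \bigcup_m \bigcap_l \bigcup_p \bigcup_q F m l p q); last first.
  apply/seteqP; split=> w /=.
    move/smallev_rat => [m Hm]; exists m => // l _; have [p [q H]] := Hm l.
    by exists p => //; exists q.
  move=> [m _ Hm]; apply/smallev_rat; exists m => l; have [p _ [q _ H]] := Hm l I.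
  by exists p, q.
apply: bigcupT_measurable => m; apply: bigcapT_measurable => l.
apply: bigcupT_measurable_rat => p; apply: bigcupT_measurable_rat => q.
rewrite /F; set v := Complex _ _.
have [vr|vr] := boolP (cabs v < rad - m.+1%:R^-1); last first.
  by rewrite (_ : [set w | _] = set0) //; apply/seteqP; split=> w //= -[].
rewrite (_ : [set w | _] = [set w | cabs (\det (A w - v%:M)) ^+ 2 < l.+1%:R^-1]); last first.
  by apply/seteqP; split=> w /= => [[]|].
apply/measurable_lt_set/measurable_cabs_sqr/cmeas_det => i j.
rewrite (_ : (fun w => _) = (fun w => A w i j + (- v%:M) i j)); last by apply/funext => w; rewrite mxE.
by apply: cmeasD => //; exact: cmeas_cst.
Qed.

End smallev_measurable.

Section law.
Context (R : realType) d (Omega : measurableType d) (P : probability Omega R).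

(* The pi-lambda theorem for the pi-system of measurable rectangles. *)
Lemma prod_law_ext d1 d2 (T1 : measurableType d1) (T2 : measurableType d2)
    (f f' : Omega -> T1) (g g' : Omega -> T2) (D D' : set Omega) :
  measurable_fun setT f -> measurable_fun setT f' -> measurable_fun setT g -> measurable_fun setT g' ->
  measurable D -> measurable D' ->
  (forall A B, measurable A -> measurable B ->
    P (D `&` (f @^-1` A `&` g @^-1` B)) = P (D' `&` (f' @^-1` A `&` g' @^-1` B))) ->
  forall C : set (T1 * T2), measurable C ->
  P (D `&` (fun w => (f w, g w)) @^-1` C) = P (D' `&` (fun w => (f' w, g' w)) @^-1` C).
Proof.
move=> mf mf' mg mg' mD mD' H C mC.
have mp := measurable_fun_pair mf mg; have mp' := measurable_fun_pair mf' mg'.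
pose m1 := measure_function_pushforward__canonical__measure_function_Measure (mrestr P mD) mp.
pose m2 := measure_function_pushforward__canonical__measure_function_Measure (mrestr P mD') mp'.
have E1 X : m1 X = P (D `&` (fun w => (f w, g w)) @^-1` X) by rewrite setIC.
have E2 X : m2 X = P (D' `&` (fun w => (f' w, g' w)) @^-1` X) by rewrite setIC.
rewrite -E1 -E2.
apply: (measure_unique [set A `*` B | A in measurable & B in measurable] (fun=> setT)) => //.
- exact: measurable_prod_measurableType.
- move=> _ _ [A mA [B mB <-]] [A' mA' [B' mB' <-]]; rewrite -setXI.
  by exists (A `&` A'); [exact: measurableI | exists (B `&` B'); [exact: measurableI|]].
- by move=> _; exists setT => //; exists setT => //; rewrite setXTT.
- by rewrite bigcup_const.
- by move=> _ [A mA [B mB <-]]; rewrite E1 E2; exact: H.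
- move=> _; rewrite E1; apply: le_lt_trans (probability_le1 _ _) (ltry 1).
  by rewrite preimage_setT setIT.
Qed.

(** The coordinates are split off one at a time. The conditions on those already split off are
    carried in the sets [D] and [D'] of [prod_law_ext]. *)
Lemma law_ext4 d1 d2 d3 d4 (T1 : measurableType d1) (T2 : measurableType d2)
    (T3 : measurableType d3) (T4 : measurableType d4)
    (X1 Y1 : Omega -> T1) (X2 Y2 : Omega -> T2) (X3 Y3 : Omega -> T3) (X4 Y4 : Omega -> T4) :
  measurable_fun setT X1 -> measurable_fun setT X2 -> measurable_fun setT X3 -> measurable_fun setT X4 ->
  measurable_fun setT Y1 -> measurable_fun setT Y2 -> measurable_fun setT Y3 -> measurable_fun setT Y4 ->
  (forall B1 B2 B3 B4, measurable B1 -> measurable B2 -> measurable B3 -> measurable B4 ->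
    P (X1 @^-1` B1 `&` X2 @^-1` B2 `&` X3 @^-1` B3 `&` X4 @^-1` B4) =
    P (Y1 @^-1` B1 `&` Y2 @^-1` B2 `&` Y3 @^-1` B3 `&` Y4 @^-1` B4)) ->
  forall C : set (T1 * (T2 * (T3 * T4))), measurable C ->
  P ((fun w => (X1 w, (X2 w, (X3 w, X4 w)))) @^-1` C) =
  P ((fun w => (Y1 w, (Y2 w, (Y3 w, Y4 w)))) @^-1` C).
Proof.
move=> mX1 mX2 mX3 mX4 mY1 mY2 mY3 mY4 H C mC.
have mpre d' (T' : measurableType d') (f : Omega -> T') B :
  measurable_fun setT f -> measurable B -> measurable (f @^-1` B).
  by move=> mf mB; rewrite -[X in measurable X]setTI; exact: mf.
have mX34 := measurable_fun_pair mX3 mX4; have mY34 := measurable_fun_pair mY3 mY4.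
rewrite -[X in P X]setTI -[X in _ = P X]setTI.
apply: prod_law_ext => //; [exact: measurable_fun_pair | exact: measurable_fun_pair |].
move=> B1 B mB1 mB; rewrite !setTI.
apply: prod_law_ext => //; [exact: mpre | exact: mpre |] => B2 B34 mB2 mB34.
rewrite !setIA.
apply: prod_law_ext => //; [by apply: measurableI; exact: mpre | by apply: measurableI; exact: mpre |].
by move=> B3 B4 mB3 mB4; rewrite !setIA; exact: H.
Qed.

End law.

Section linear_facts.
Variable R : realType.

Lemma esd_disc0 n (A : 'M[R[i]]_n) rad : (0 < n)%N ->
  esd A [set z : R[i] | cabs z < rad] = 0%E <-> ~ smallev rad A.
Proof.
move=> n0; have E : esd A [set z : R[i] | cabs z < rad] =
    (n%:R^-1 * \sum_(k < n) (cabs (eigenvalues A)`_k < rad)%R%:R)%:E.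
  rewrite /esd /mscale /= /msum /= EFinM -sumEFin; congr (_ * _)%E.
  apply: eq_bigr => k _; move: (_`_k) => x; transitivity ((\1_[set z : R[i] | cabs z < rad] x)%:E : \bar R) => //.
  rewrite indicE; have [xr|/negP xr] := boolP (cabs x < rad); first by rewrite mem_set.
  by rewrite memNset.
rewrite E; split.
  move=> [] /eqP; rewrite mulf_eq0 invr_eq0 pnatr_eq0 eqn0Ngt n0 /=.
  rewrite psumr_eq0 // => /allP H [z [zr /eqP]]; rewrite det_eigenvalue => zA.
  have zn : (index z (eigenvalues A) < n)%N by rewrite -[ltnRHS](size_eigenvalues A) index_mem.
  by have := H (Ordinal zn) (mem_index_enum (Ordinal zn)); rewrite -[nat_of_ord _]/(index z _) nth_index // zr oner_eq0.
move=> H; rewrite big1 ?mulr0 // => k _; apply/eqP; rewrite pnatr_eq0 eqb0; apply/negP => kr; case: H.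
exists (eigenvalues A)`_k; split=> //; apply/eqP; rewrite det_eigenvalue mem_nth //.
by rewrite size_eigenvalues.
Qed.

Lemma opnorm_diag_le n (t : 'rV[R]_n) (M : R) : 0 <= M ->
  opnorm (diagC t) <= M <-> forall i, `|t 0 i| <= M.
Proof.
move=> M0; have DE (x : 'cV[R[i]]_n) i : cabs ((diagC t *m x) i 0) = `|t 0 i| * cabs (x i 0).
  by rewrite mul_diag_mx !mxE ComplexField.Normc.normcM /= expr0n /= addr0 sqrtr_sqr.
split=> [tM i|tM].
  pose e : 'cV[R[i]]_n := delta_mx i 0.
  have e1 : l2norm e = 1.
    rewrite /l2norm (bigD1 i) //= big1 => [|k ki].
      by rewrite mxE !eqxx ComplexField.Normc.normc1 expr1n addr0 sqrtr1.
    by rewrite mxE (negPf ki) ComplexField.Normc.normc0 expr0n.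
  apply: le_trans tM; apply: le_trans (opnorm_ub (diagC t) (x := e) _); last by rewrite e1.
  rewrite /l2norm -[leLHS]ger0_norm // -sqrtr_sqr ler_wsqrtr // (bigD1 i) //=.
  rewrite DE mxE !eqxx ComplexField.Normc.normc1 mulr1 lerDl sumr_ge0 // => k _.
  exact: sqr_ge0.
apply: ge_sup.
  exists (l2norm (diagC t *m 0)); exists 0 => //.
  by rewrite /= /l2norm big1 ?sqrtr0 // => k _; rewrite mxE ComplexField.Normc.normc0 expr0n.
move=> _ [x x1 <-]; apply: le_trans (_ : M * l2norm x <= _); last by rewrite ler_piMr.
rewrite -[M]ger0_norm // -sqrtr_sqr /l2norm -sqrtrM ?sqr_ge0 // ler_wsqrtr // mulr_sumr.
apply: ler_sum => k _; rewrite DE exprMn ler_wpM2r ?sqr_ge0 // lerXn2r ?nnegrE //.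
Qed.

(** The first alternative covers singular matrices, where the value is infinite. The event becomes a
    finite union of conditions on single entries, hence measurable. *)
Lemma opnorm_inv_diag n (s : 'rV[R]_n) (M : R) : 0 <= M ->
  (M%:E < opnorm_inv (diagC s))%E <-> exists i, s 0 i = 0 \/ M < `|(s 0 i)^-1|.
Proof.
move=> M0; have unitE : (diagC s \in unitmx) = [forall i, s 0 i != 0].
  rewrite unitmxE det_diag unitfE; apply/prodf_neq0/forallP => s0 i.
    by have := s0 i isT; rewrite mxE /= fmorph_eq0.
  by move=> _; rewrite mxE /= fmorph_eq0.
rewrite /opnorm_inv unitE; case: ifPn => [/forallP s0|/forallPn [i /negPn/eqP si]]; last first.
  by split=> [_|_]; [exists i; left | exact: ltry].
have -> : invmx (diagC s) = diagC (\row_i (s 0 i)^-1).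
  have DD : diagC s *m diagC (\row_i (s 0 i)^-1) = 1%:M.
    rewrite mulmx_diag; apply/matrixP => i j; rewrite !mxE; case: eqP => // _.
    by rewrite -rmorphM mulfV.
  have DU : diagC s \in unitmx by rewrite unitE; apply/forallP.
  by rewrite -[RHS](mulKmx DU) DD mulmx1.
rewrite lte_fin ltNge; split=> [/negP H|[i [si|iM]]].
- apply: contrapT => nE; apply: H; apply/(opnorm_diag_le _ M0) => i; rewrite mxE leNgt.
  by apply/negP => iM; apply: nE; exists i; right.
- by have := s0 i; rewrite si eqxx.
- by apply/negP => /(opnorm_diag_le _ M0) /(_ i); rewrite mxE leNgt iM.
Qed.

End linear_facts.

Section probability_facts.
Context (R : realType) d (Omega : measurableType d) (P : probability Omega R).

(** By [law_ext4] rectangles suffice; there independence factors the probability, and left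
    invariance applies to the factors of [U] and [V] separately. *)
Lemma haar_law n (U V A : {RV P >-> 'M[R[i]]_n}) (s : {RV P >-> 'rV[R]_n}) (q q' : 'M[R[i]]_n) :
  haar_unitary (distribution P U) -> haar_unitary (distribution P V) ->
  independent4 U s V A -> q \is unitarymx -> q' \is unitarymx ->
  forall C : set ('M[R[i]]_n * ('rV[R]_n * ('M[R[i]]_n * 'M[R[i]]_n))), measurable C ->
  P ((fun w => (q *m U w, (s w, (q' *m V w, A w)))) @^-1` C) =
  P ((fun w => (U w, (s w, (V w, A w)))) @^-1` C).
Proof.
move=> [_ hU] [_ hV] ind qu qu'; apply: law_ext4 => //.
- exact: measurableT_comp (measurable_mulmxl q) _.
- exact: measurableT_comp (measurable_mulmxl q') _.
move=> B1 B2 B3 B4 mB1 mB2 mB3 mB4.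
have mm (W : 'M[R[i]]_n) (B : set 'M[R[i]]_n) : measurable B -> measurable ((mulmx W : 'M[R[i]]_n -> 'M[R[i]]_n) @^-1` B).
  by move=> mB; rewrite -[X in measurable X]setTI; exact: (measurable_mulmxl W measurableT mB).
rewrite (ind B1 B2 B3 B4) //.
have EU : P (U @^-1` (mulmx q @^-1` B1)) = P (U @^-1` B1) := hU q qu B1 mB1.
have EV : P (V @^-1` (mulmx q' @^-1` B3)) = P (V @^-1` B3) := hV q' qu' B3 mB3.
by rewrite -EU -EV -(ind _ B2 _ B4) //; exact: mm.
Qed.

(** The left side is the mean number of indices whose event occurs; this number is at most [c] off
    [B] and at most [#|J|] on [B]. The counting bound for fixed matrices thus becomes a bound on
    probabilities. *)
Lemma count_events_le (J : finType) (E : J -> set Omega) (B : set Omega) (c : R) :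
  0 <= c -> (forall j, measurable (E j)) -> measurable B ->
  (forall w, ~ B w -> #|[set j | `[< E j w >]]%SET|%:R <= c) ->
  (\sum_j P (E j) <= c%:E + #|J|%:R%:E * P B)%E.
Proof.
move=> c0 mE mB H.
have -> : (\sum_j P (E j) = \int[P]_w (\sum_j (\1_(E j) w)%:E))%E.
  rewrite ge0_integral_sum //.
  - by apply: eq_bigr => j _; rewrite integral_indic // setIT.
  - by move=> j; apply/measurable_EFinP; exact: measurable_indic.
have -> : (c%:E + #|J|%:R%:E * P B = \int[P]_w (c%:E + #|J|%:R%:E * (\1_B w)%:E))%E.
  rewrite ge0_integralD //.
  - have PT : (P setT = 1%E :> \bar R) by exact: probability_setT.
    rewrite integral_cst //; congr (_ + _)%E.
      exact/esym/(etrans (congr1 (fun y => c%:E * y)%E PT) (mule1 _)).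
    rewrite ge0_integralZl //.
    + by rewrite integral_indic // setIT.
    + by apply/measurable_EFinP; exact: measurable_indic.
  - by apply: measurable_funeM; apply/measurable_EFinP; exact: measurable_indic.
apply: ge0_le_integral => //.
- by move=> w _; apply: sume_ge0 => j _; rewrite lee_fin.
- by apply: emeasurable_sum => j; apply/measurable_EFinP; exact: measurable_indic.
- apply: emeasurable_funD => //; apply: measurable_funeM.
  by apply/measurable_EFinP; exact: measurable_indic.
move=> w _; rewrite sumEFin.
have -> : \sum_j \1_(E j) w = #|[set j | `[< E j w >]]%SET|%:R :> R.
  rewrite -sum1dep_card natr_sum [RHS]big_mkcond /=; apply: eq_bigr => j _.
  rewrite indicE; have [wE|wE] := asboolP (E j w); first by rewrite mem_set.
  by rewrite memNset.
rewrite -EFinM -EFinD lee_fin indicE; have [wB|wB] := pselect (B w).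
  rewrite mem_set // mulr1; apply: le_trans (_ : #|J|%:R <= _); last by rewrite lerDr.
  by rewrite ler_nat max_card.
by rewrite memNset // mulr0 addr0; exact: H.
Qed.

End probability_facts.

Lemma cmeas_model d (T : measurableType d) (R : realType) n (u v p : T -> 'M[R[i]]_n) (s : T -> 'rV[R]_n) :
  measurable_fun setT u -> measurable_fun setT s -> measurable_fun setT v -> measurable_fun setT p ->
  forall i j, cmeas (fun w => (u w *m diagC (s w) *m v w + p w) i j).
Proof.
move=> mu ms mv mp i j.
rewrite (_ : (fun w => _) = (fun w => (u w *m diagC (s w) *m v w) i j + p w i j)); last first.
  by apply/funext => w; rewrite mxE.
have ent (f : T -> 'M[R[i]]_n) k l : measurable_fun setT f -> cmeas (fun w => f w k l).
  by move=> mf; apply/cmeasP; exact: (measurable_matrixP f).1.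
apply: cmeasD; last exact: ent.
apply: cmeas_mulmx => [k l|k l]; last exact: ent.
apply: cmeas_mulmx => [k' l'|k' l']; first exact: ent.
rewrite (_ : (fun w => _) = (fun w => if k' == l' then real_complex R (s w 0 k') else 0)); last first.
  by apply/funext => w; rewrite !mxE; case: eqP.
case: eqP => _; last exact: cmeas_cst.
by apply: cmeas_real; exact: (measurable_matrixP s).1.
Qed.

Section probability_bound.
Context (R : realType) d (Omega : measurableType d) (P : probability Omega R).

Lemma measurable_opnorm_inv_gt n (s : {RV P >-> 'rV[R]_n}) (M : R) : 0 <= M ->
  measurable [set w | (M%:E < opnorm_inv (diagC (s w)))%E].
Proof.
move=> M0; have ms i : measurable_fun setT (fun w => s w 0 i) by exact: (measurable_matrixP s).1.
rewrite (_ : [set w | _] = \bigcup_(i in [set: 'I_n])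
    ([set w | s w 0 i = 0] `|` [set w | M < `|(s w 0 i)^-1|])); last first.
  apply/seteqP; split=> w /=.
    by move/(opnorm_inv_diag _ M0) => [i H]; exists i.
  by move=> [i _ H]; apply/(opnorm_inv_diag _ M0); exists i.
apply: fin_bigcup_measurable => [|i _]; first exact: finite_finset.
apply: measurableU.
  rewrite (_ : [set w | _] = (fun w => s w 0 i) @^-1` [set 0]) //.
  by rewrite -[X in measurable X]setTI; exact: ms.
apply: measurable_gt_set; apply: measurableT_comp => //.
by apply: measurableT_comp (ms i); exact: measurable_inv.
Qed.

Lemma measurable_mean_gt n (s : {RV P >-> 'rV[R]_n}) (c e : R) :
  measurable [set w | e < `|n%:R^-1 * \sum_(i < n) (s w 0 i) ^- 2 - c|].
Proof.
apply: measurable_gt_set; apply: measurableT_comp => //.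
apply: measurable_funB => //; apply: measurable_funM => //.
apply: measurable_sum => i; apply: (measurableT_comp (@measurable_inv R)).
by apply: measurable_funX; exact: (measurable_matrixP s).1.
Qed.

Lemma negligible_not (Q : Omega -> Prop) : {ae P, forall w, Q w} ->
  exists N, [/\ measurable N, P N = 0%E & forall w, ~ N w -> Q w].
Proof.
by move=> [N [mN PN QN]]; exists N; split=> // w Nw; apply: contrapT => nQ; apply: Nw; exact: QN.
Qed.

Lemma haar_unitary_ae n (U : {RV P >-> 'M[R[i]]_n}) : haar_unitary (distribution P U) ->
  {ae P, forall w, U w \is unitarymx}.
Proof.
move=> [[N [mN PN QN]] _]; exists (U @^-1` N); split=> //.
  by rewrite -[X in measurable X]setTI; exact: measurable_funP.
by move=> w nU; apply: QN.
Qed.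

End probability_bound.

(** By [haar_law] the events for all members of the family have the same probability as the original
    one, so [count_events_le] divided by the size of the family bounds it. The constants are fixed
    before the probability space is given, because the space varies with n. *)
Lemma smallev_prob (R : realType) (r : nat) (K M' a rad eps : R) :
  0 <= M' -> 0 < rad -> rad < a -> 0 < eps ->
  exists (eta : R) (n1 : nat), 0 < eta /\ forall n, (n1 <= n)%N ->
  forall d (Omega : measurableType d) (P : probability Omega R)
    (U V A : {RV P >-> 'M[R[i]]_n}) (s : {RV P >-> 'rV[R]_n}),
  haar_unitary (distribution P U) -> haar_unitary (distribution P V) ->
  independent4 U s V A ->
  {ae P, forall w, (\rank (A w) <= r)%N} -> {ae P, forall w, opnorm (A w) <= K} ->
  measurable [set w | smallev rad (U w *m diagC (s w) *m V w + A w)] /\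
  (P [set w | smallev rad (U w *m diagC (s w) *m V w + A w)] <= eps%:E +
    (P [set w | (M'%:E < opnorm_inv (diagC (s w)))%E] +
     P [set w | (eta < `|n%:R^-1 * \sum_(i < n) (s w 0 i) ^- 2 - a ^- 2|)%R]))%E.
Proof.
move=> M0 rad0 rada eps0.
have [eta [n1 [eta0 Hn]]] := family_bound r K M' rad0 rada eps0.
exists eta, n1; split=> // n nn1 d Omega P U V A s hU hV ind rA opA.
have [J [q [q' [J0 qu qu' count]]]] := Hn n nn1.
have mU : measurable_fun setT U by []. have mV : measurable_fun setT V by [].
have mA : measurable_fun setT A by []. have ms : measurable_fun setT s by [].
set E := [set w | smallev _ _]; set H := [set w | (_ < opnorm_inv _)%E]; set S := [set w | eta < _].
have mE : measurable E by apply: measurable_smallev; exact: cmeas_model.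
split=> //; have mH : measurable H by exact: measurable_opnorm_inv_gt.
have mS : measurable S by exact: measurable_mean_gt.
have good : {ae P, forall w, (U w \is unitarymx /\ V w \is unitarymx) /\
    ((\rank (A w) <= r)%N /\ opnorm (A w) <= K)}.
  exact: filterI (filterI (haar_unitary_ae hU) (haar_unitary_ae hV)) (filterI rA opA).
(* The almost sure conditions are moved into one measurable null set, which joins the exceptional
   event [B]. *)
have [N [mN PN HN]] := negligible_not good.
pose B := (H `|` S) `|` N.
have mB : measurable B by do ![apply: measurableU].
have PB : (P B <= P H + P S)%E.
  apply: le_trans (measureU2 _ _ _) _ => //; first exact: measurableU.
  rewrite [X in (_ + X <= _)%E](_ : _ = 0%E) ?adde0; first exact: measureU2.
  exact: PN.
pose Ej j := [set w | smallev rad (q j *m U w *m diagC (s w) *m (q' j *m V w) + A w)].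
pose C := [set x : 'M[R[i]]_n * ('rV[R]_n * ('M[R[i]]_n * 'M[R[i]]_n)) |
  smallev rad (x.1 *m diagC x.2.1 *m x.2.2.1 + x.2.2.2)].
have mC : measurable C.
  apply: measurable_smallev; apply: cmeas_model.
  - exact: measurable_fst.
  - exact: measurableT_comp measurable_fst measurable_snd.
  - by apply: measurableT_comp measurable_fst _; exact: measurableT_comp measurable_snd measurable_snd.
  - by apply: measurableT_comp measurable_snd _; exact: measurableT_comp measurable_snd measurable_snd.
have PEj j : P (Ej j) = P E := haar_law hU hV ind (qu j) (qu' j) mC.
have mEj j : measurable (Ej j).
  apply: measurable_smallev; apply: cmeas_model => //.
    exact: measurableT_comp (measurable_mulmxl _) mU.
  exact: measurableT_comp (measurable_mulmxl _) mV.
have Hc w : ~ B w -> #|[set j | `[< Ej j w >]]%SET|%:R <= eps * #|J|%:R.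
  move=> Bw; have [|[Uu Vu] [Ar AK]] := HN w; first by move=> Nw; apply: Bw; right.
  apply: (count _ _ _ _ Uu Vu _ _ _ Ar AK).
  - move=> i; apply/eqP => si; apply: Bw; left; left.
    by apply/(opnorm_inv_diag _ M0); exists i; left.
  - move=> i; rewrite leNgt; apply/negP => si; apply: Bw; left; left.
    by apply/(opnorm_inv_diag _ M0); exists i; right.
  - rewrite addrC -lerBlDr; apply: le_trans (ler_norm _) _; rewrite leNgt; apply/negP => si.
    by apply: Bw; left; right.
have c0 : 0 <= eps * #|J|%:R by rewrite mulr_ge0 // ltW.
have := count_events_le P c0 mEj mB Hc; rewrite (eq_bigr (fun=> P E)); last by move=> j _; exact: PEj.
move=> Hsum; apply: le_trans (leeD2l _ PB); move: Hsum.
have -> : P E = (fine (P E))%:E by rewrite fineK // fin_num_measure.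
have -> : P B = (fine (P B))%:E by rewrite fineK // fin_num_measure.
move: (fine (P E)) (fine (P B)) => x y.
rewrite sumEFin sumr_const -EFinM -!EFinD !lee_fin -[_ *+ _]mulr_natr [#|J|%:R * y]mulrC -mulrDl.
by rewrite ler_pM2r // ltr0n.
Qed.

Local Close Scope complex_scope.

Theorem theorem2p6 (R : realType)
  (d : nat -> measure_display) (Omega : forall n, measurableType (d n))
  (P : forall n, probability (Omega n) R)
  (U V : forall n, {RV (P n) >-> 'M[R[i]]_n})
  (s : forall n, {RV (P n) >-> 'rV[R]_n})
  (Pert : forall n, {RV (P n) >-> 'M[R[i]]_n})
  (s_ge0 : forall n, (0 < n)%N ->
    {ae P n, forall w, forall i : 'I_n, 0 <= s n w ord0 i})
  (U_haar : forall n, (0 < n)%N -> haar_unitary (distribution (P n) (U n)))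
  (V_haar : forall n, (0 < n)%N -> haar_unitary (distribution (P n) (V n)))
  (indep : forall n, (0 < n)%N -> independent4 (U n) (s n) (V n) (Pert n))
  (b : R) (b_ge0 : 0 <= b)
  (hyp1 : cvg_in_probability P
    (fun n w =>
       n%:R^-1 * complex.Re (\tr (diagC (s n w) *m diagC (s n w))))
    (b ^+ 2))
  (M : R) (M_gt0 : 0 < M)
  (hyp2 : P n [set w | M < opnorm (diagC (s n w))] @[n --> \oo] --> 0%E)
  (kappa : R) (kappa_gt0 : 0 < kappa)
  (hyp3 : forall n, (0 < n)%N ->
    {ae P n, forall w, forall z : R[i],
      n%:R `^ (- kappa) < complex.Im z ->
      `|complex.Im (stieltjes (esd (diagC (s n w))) z)| <= kappa^-1})
  (r : nat) (Pert_rank : forall n, (0 < n)%N ->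
    {ae P n, forall w, (\rank (Pert n w) <= r)%N})
  (K : R) (Pert_bounded : forall n, (0 < n)%N ->
    {ae P n, forall w, opnorm (Pert n w) <= K})
  (M' : R) (M'_gt0 : 0 < M')
  (hyp_inv : P n [set w | (M'%:E < opnorm_inv (diagC (s n w)))%E]
    @[n --> \oo] --> 0%E)
  (a : R) (a_gt0 : 0 < a)
  (hyp_a : cvg_in_probability P
    (fun n w => n%:R^-1 * \sum_(i < n) (s n w ord0 i) ^- 2) (a ^- 2)) :
  forall delta : R, 0 < delta -> delta < a ->
    P n [set w | esd (U n w *m diagC (s n w) *m V n w + Pert n w)
                     [set z : R[i] | cabs z < a - delta] = 0%E]
      @[n --> \oo] --> 1%E.
Proof.
move=> delta delta0 deltaa.
have rad0 : 0 < a - delta by rewrite subr_gt0.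
have rada : a - delta < a by rewrite ltrBlDr ltrDl.
pose E n := [set w | smallev (a - delta) (U n w *m diagC (s n w) *m V n w + Pert n w)].
have mE n : measurable (E n) by apply: measurable_smallev; exact: cmeas_model.
have SE n : (0 < n)%N ->
    [set w | esd (U n w *m diagC (s n w) *m V n w + Pert n w) [set z : R[i] | cabs z < a - delta] = 0%E] = ~` E n.
  by move=> n0; apply/seteqP; split=> w /(esd_disc0 _ _ n0).
apply/fine_cvgP; split.
  near=> n; rewrite SE; last by near: n; exact: nbhs_infty_gt.
  by rewrite fin_num_measure //; exact: measurableC.
apply/cvgrPdist_le => e e0.
have e3 : 0 < e / 3 by rewrite divr_gt0.
have [eta [n1 [eta0 Hn]]] := smallev_prob r K (ltW M'_gt0) rad0 rada e3.
move/fine_cvgP: hyp_inv => [_ /cvgrPdist_le /(_ _ e3) Hinv].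
move/fine_cvgP: (hyp_a _ eta0) => [_ /cvgrPdist_le /(_ _ e3) Ha].
near=> n.
have n0 : (0 < n)%N by near: n; exact: nbhs_infty_gt.
have nn1 : (n1 <= n)%N by near: n; exact: nbhs_infty_ge.
have [_ PE] := Hn n nn1 _ _ (P n) _ _ _ _ (U_haar _ n0) (V_haar _ n0)
  (indep _ n0) (Pert_rank _ n0) (Pert_bounded _ n0).
have H1 : `|0 - fine (P n [set w | (M'%:E < opnorm_inv (diagC (s n w)))%E])| <= e / 3 by near: n.
have H2 : `|0 - fine (P n [set w | eta < `|n%:R^-1 * \sum_(i < n) s n w ord0 i ^- 2 - a ^- 2|])| <= e / 3 by near: n.
have m1 := measurable_opnorm_inv_gt (s n) (ltW M'_gt0).
have m2 := measurable_mean_gt (s n) (a ^- 2) eta.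
have fK X : measurable X -> P n X = (fine (P n X))%:E by move=> mX; rewrite fineK // fin_num_measure.
move: PE H1 H2; rewrite -/(E n) (fK _ (mE n)) (fK _ m1) (fK _ m2) -!EFinD lee_fin.
rewrite /comp SE // probability_setC // (fK _ (mE n)) -EFinB /= subKr.
have : 0 <= fine (P n (E n)) by exact: fine_ge0.
move: (fine (P n (E n))) (fine _) (fine _) => x y z x0 H; rewrite !sub0r !normrN => H1 H2.
rewrite ger0_norm //; apply: le_trans H _.
have h1 := le_trans (ler_norm _) H1; have h2 := le_trans (ler_norm _) H2.
by clear -h1 h2; lra.
Unshelve. all: by end_near.
Qed.
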